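(* Let $n\geq 1$ and let $F:\mathcal{M}_{n}\rightarrow \mathcal{M}_{n}$ be a Lipschitz mapping with $F(0)=0$ such that $$\sigma(F(x)-F(y))\cap\sigma(x-y)\neq\varnothing\qquad (x,y\in\mathcal{M}_n).$$ Then there exists an invertible $u\in\mathcal{M}_n$ such that either $F(x)=uxu^{-1}$ for all $x\in\mathcal{M}_n$, or $F(x)=ux^{t}u^{-1}$ for all $x\in\mathcal{M}_n$.
   Context: $\mathcal{M}_n$ denotes the space of all complex $n\times n$ matrices, equipped with the operator norm (Lipschitz is with respect to this norm). For $x\in\mathcal{M}_n$, $\sigma(x)$ denotes the spectrum (set of eigenvalues) of $x$, and $x^t$ denotes its transpose. *)

(* Defs.v *)
From HB Require Import structures.
From mathcomp Require Import all_boot all_order all_algebra.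
Set Implicit Arguments. Unset Strict Implicit. Unset Printing Implicit Defensive.
Import Order.TTheory GRing.Theory Num.Theory.
Local Open Scope ring_scope.

(* Completeness of the real part of a numerically closed field: every nonempty
   set of reals bounded above has a least upper bound.  A numClosedFieldType
   satisfying this is (isomorphic, as a normed field with conjugation, to) C. *)
Definition real_complete (C : numClosedFieldType) : Prop :=
  forall E : C -> Prop,
    (forall x, E x -> x \is Num.real) ->
    (exists x, E x) ->
    (exists M, forall x, E x -> x <= M) ->
    exists s, (forall x, E x -> x <= s) /\
              (forall M, (forall x, E x -> x <= M) -> s <= M).

Definition vnorm2 (C : numClosedFieldType) (n : nat) (v : 'cV[C]_n) : C :=
  \sum_(i < n) `|v i 0| ^+ 2.

(* opbound A c  <->  ||A||_op <= c   (for c >= 0), operator norm induced by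
   the Euclidean norm: ||A v|| <= c ||v|| for all v. *)
Definition opbound (C : numClosedFieldType) (n : nat) (A : 'M[C]_n) (c : C) : Prop :=
  0 <= c /\ forall v : 'cV[C]_n, vnorm2 (A *m v) <= c ^+ 2 * vnorm2 v.

Definition lipschitz_op (C : numClosedFieldType) (n : nat)
  (F : 'M[C]_n -> 'M[C]_n) : Prop :=
  exists L : C, 0 <= L /\
    forall x y c, opbound (x - y) c -> opbound (F x - F y) (L * c).

Definition spec_meet (C : numClosedFieldType) (n : nat) (A B : 'M[C]_n) : Prop :=
  exists a : C, eigenvalue A a /\ eigenvalue B a.

(* Main.v *)
Require Import Defs.
From HB Require Import structures.
From mathcomp Require Import all_boot all_order all_algebra.
From mathcomp Require Import ring lra.
From mathcomp Require Import boolp classical_sets filter.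
Set Implicit Arguments. Unset Strict Implicit. Unset Printing Implicit Defensive.
Import Order.TTheory GRing.Theory Num.Theory.
Local Open Scope ring_scope.
Local Open Scope classical_set_scope.

(** Suppose first that F is additive.  If x has distinct
    eigenvalues, it lies on a line x + t K with characteristic polynomial p - t,
    and the common eigenvalues at t = 0, 1, 2, ... force every eigenvalue of x to be
    one of F x.  Hence F preserves the traces of squares and cubes, so it is
    complex linear and a Jordan automorphism, and matrix units finish the proof.

    It remains to show that F is additive.  All maps with the same Lipschitz
    constant and the spectral property form a class which is closed under
    the zooms x |-> (F (a + s x) - F a) / s and, by completeness of the scalars,
    under limits along an ultrafilter.  Rademacher's theorem is replaced by
    extremality: maximise a quantity over the class; it remains extremal on every
    zoom of a maximiser, and a further extremal argument finds an additive zoom: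
    a real Lipschitz function which attains its best Euclidean slope along a whole
    line is affine.  The additive zoom is complex linear by the first part.
    Applied to integrals of F dz around squares, averaged over small boxes, this
    shows that those integrals vanish for all F in the class.  Hence F has the mean
    value property on circles, a second difference of F maximal over the class is
    constant by the maximum principle, and telescoping gives that it is zero. *)

(** * Additive maps: preservation of traces *)

(** [F] is never shown to be differentiable: only some ultralimit of zooms is additive, and
    extremality must survive each of these zooms. This shapes the integral step. The integral around
    a square, suitably normalised, is exactly the average of the integrals for the half-scale zooms
    at the corners of its quarters; so for a maximiser every dyadic subsquare is maximal again.
    These centres fill only a plane, whereas the spectral condition yields complex linearity only
    for maps additive on the whole matrix space. Averaging over a box with edges in all real
    directions turns the admissible centres into a lattice that comes close to every point at every
    scale. A complex linear map has integral zero, so the maximum is zero; the thickness of the box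
    then tends to 0 and leaves the square alone.

    What is maximised is the real part of [c] times a complex quantity. The class does not depend on
    [c], so [c] may finally be the conjugate of the value for the given map, and a squared modulus
    is at most 0. Second differences are treated in the same way. *)

Lemma distinct_eigenvalues_diag (F : fieldType) n (A : 'M[F]_n) (d : 'I_n -> F) :
  injective d -> (forall i, eigenvalue A (d i)) ->
  exists2 P, P \in unitmx & P *m A = diag_mx (\row_i d i) *m P.
Proof.
move=> d_inj dA.
have /fin_all_exists2 [v vA v0] i : exists2 v : 'rV_n, v *m A = d i *: v & v != 0.
  exact/eigenvalueP.
pose P := \matrix_i v i.
exists P; last first.
  apply/row_matrixP => i; rewrite row_mul rowK vA row_mul row_diag_mx.
  by rewrite -scalemxAl -rowE rowK mxE.
have direct : mxdirect (\sum_(i < n) eigenspace A (d i)).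
  by apply: mxdirect_sum_eigenspace => i j _ _; apply: d_inj.
have rk_ge1 i : (1 <= \rank (eigenspace A (d i)))%N.
  by rewrite lt0n mxrank_eq0; apply: dA.
have rk_sum : (\rank (\sum_(i < n) eigenspace A (d i))%MS = \sum_(i < n) \rank (eigenspace A (d i)))%N.
  exact: (mxdirectP direct).
have sum1 : (\sum_(i < n) 1 = n)%N by rewrite sum1_card card_ord.
have rk_full : (\rank (\sum_(i < n) eigenspace A (d i))%MS = n)%N.
  apply/anti_leq/andP; split; first exact: rank_leq_col.
  by rewrite rk_sum -{1}sum1; apply: leq_sum => i _.
have rk1 i : \rank (eigenspace A (d i)) = 1%N.
  have le1 : (\sum_(i < n) 1 <= \sum_(i < n) \rank (eigenspace A (d i)) ?= iff
              [forall i, 1 == \rank (eigenspace A (d i))])%N.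
    by apply: leqif_sum => k _; split.
  have := le1.2; rewrite sum1 -rk_sum rk_full eqxx => /esym/forallP/(_ i)/eqP.
  by move=> <-.
rewrite -row_full_unit -sub1mx.
apply: (@submx_trans _ _ _ _ _ _ (\sum_(i < n) eigenspace A (d i))%MS).
  by rewrite sub1mx row_full_unit -row_free_unit /row_free rk_full.
apply/sumsmx_subP => i _.
have vE : (v i <= eigenspace A (d i))%MS by apply/eigenspaceP.
have : (eigenspace A (d i) <= v i)%MS.
  by rewrite -(geq_leqif (mxrank_leqif_sup vE)) rk1 lt0n mxrank_eq0 v0.
by move/submx_trans; apply; rewrite -(rowK v i) row_sub.
Qed.

Lemma similar_trace (F : fieldType) n (P A B : 'M[F]_n) :
  P \in unitmx -> P *m A = B *m P -> \tr A = \tr B.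
Proof.
move=> uP PA; have -> : A = invmx P *m (B *m P) by rewrite -PA mulKmx.
by rewrite mxtrace_mulC mulmxK.
Qed.

(** The size is an argument, not read off the polynomial as in [companionmx], so that the matrices
    of [p] and of [p - t%:P] have the same type. *)
Definition companion_of (F : nzRingType) n (p : seq F) : 'M[F]_n :=
  \matrix_(i, j) if (i == n.-1 :> nat) then - p`_j else (i.+1 == j :> nat)%:R.

Lemma companion_ofK (F : comNzRingType) n (p : {poly F}) :
  p \is monic -> size p = n.+1 -> char_poly (companion_of n p) = p.
Proof.
move=> pm sp; have En : n = (size p).-1 by rewrite sp.
by rewrite {}En in sp *; apply: companionmxK.
Qed.

Lemma companion_of_subC (F : comNzRingType) n (p : {poly F}) (t : F) :
  companion_of n (p - t%:P) = companion_of n p +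
    t *: \matrix_(i, j) ((i == n.-1 :> nat) && (j == 0 :> nat))%:R.
Proof.
apply/matrixP => i j; rewrite !mxE coefB coefC; case: ifP => _ /=; last first.
  by rewrite mulr0 addr0.
by case: eqP => _; rewrite ?mulr1 ?mulr0 ?subr0 ?addr0 // opprB addrC.
Qed.

Lemma eigenvalue_det (F : fieldType) n (A : 'M[F]_n) a :
  eigenvalue A a = (\det (a%:M - A) == 0).
Proof.
rewrite eigenvalue_root_char /root /char_poly -/(horner_eval a _) -det_map_mx.
congr (\det _ == 0); apply/matrixP => i j.
by rewrite !mxE /= /horner_eval !(hornerE, hornerMn).
Qed.

Section TracePowers.
Variables (C : numClosedFieldType) (n : nat) (phi : 'M[C]_n -> 'M[C]_n).
Hypothesis n_gt0 : (0 < n)%N.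
Hypothesis phiD : forall x y, phi (x + y) = phi x + phi y.
Hypothesis phi_spec : forall x, spec_meet (phi x) x.

Lemma poly_nat_roots (p : {poly C}) : (forall m : nat, p.[m%:R] = 0) -> p = 0.
Proof.
move=> p0; apply/eqP; apply/contraT => pn0.
have := @max_poly_roots _ p [seq m%:R | m <- iota 0 (size p)] pn0.
rewrite size_map size_iota ltnn => -> //.
  by apply/allP => _ /mapP[m _ ->]; rewrite /root p0.
rewrite map_inj_uniq ?iota_uniq // => a b /eqP.
by rewrite eqr_nat => /eqP.
Qed.

Lemma additive0 : phi 0 = 0.
Proof. by apply: (addrI (phi 0)); rewrite -phiD !addr0. Qed.

Lemma additiveMn x m : phi (m%:R *: x) = m%:R *: phi x.
Proof.
elim: m => [|m IH]; first by rewrite !scale0r additive0.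
by rewrite -[m.+1]addn1 natrD !scalerDl phiD IH !scale1r.
Qed.

Lemma additiveN x : phi (- x) = - phi x.
Proof. by apply: (addrI (phi x)); rewrite -phiD !subrr additive0. Qed.

(* In companion form, the line x + t J has characteristic polynomial p - t, so
   the common eigenvalues at t = 0, 1, 2, ... are pairwise distinct roots of
   the polynomial det(X - phi x - p(X) phi J), which must vanish. *)
Lemma additive_eigenvalues x (d : 'I_n -> C) :
  injective d -> (forall i, eigenvalue x (d i)) ->
  forall i, eigenvalue (phi x) (d i).
Proof.
move=> d_inj dx.
pose p := \prod_(i < n) ('X - (d i)%:P).
have p_monic : p \is monic by apply: monic_prod_XsubC.
have size_p : size p = n.+1 by rewrite /p -big_enum size_prod_XsubC size_enum_ord.
have proot i : p.[d i] = 0.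
  by apply/rootP; rewrite /p (bigD1 i) //= rootM root_XsubC eqxx.
have [P uP Px] := distinct_eigenvalues_diag d_inj dx.
have dc i : eigenvalue (companion_of n p) (d i).
  by rewrite eigenvalue_root_char companion_ofK //; apply/rootP.
have [Q uQ Qc] := distinct_eigenvalues_diag d_inj dc.
pose S := invmx P *m Q.
have uS : S \in unitmx by rewrite unitmx_mul unitmx_inv uP.
pose J : 'M[C]_n := \matrix_(i, j) ((i == n.-1 :> nat) && (j == 0 :> nat))%:R.
have xE : x = S *m companion_of n p *m invmx S.
  have xP : x = invmx P *m (diag_mx (\row_i d i) *m P) by rewrite -Px mulKmx.
  have -> : S *m companion_of n p = x *m S; last by rewrite mulmxK.
  by rewrite xP /S -mulmxA Qc -!mulmxA (mulmxA P) mulmxV // mul1mx.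
pose K := S *m J *m invmx S.
have size_pt (t : C) : size (p - t%:P) = n.+1.
  by rewrite size_polyDl size_p // size_polyN size_polyC ltnS (leq_trans (leq_b1 _)).
have monic_pt (t : C) : p - t%:P \is monic.
  by rewrite monicE lead_coefDl ?(monicP p_monic) // size_polyN size_polyC size_p
    ltnS (leq_trans (leq_b1 _)).
have charK (t a : C) : eigenvalue (x + t *: K) a -> p.[a] = t.
  have -> : x + t *: K = S *m companion_of n (p - t%:P) *m invmx S.
    by rewrite companion_of_subC mulmxDr mulmxDl -xE -scalemxAr -scalemxAl.
  rewrite -conjumx // => /(eigenvalue_conjmx (stablemx_unit _ uS)).
  rewrite row_free_unit => /(_ uS).
  rewrite [_ \in _]eigenvalue_root_char companion_ofK ?monic_pt ?size_pt //.
  by move/rootP; rewrite hornerD hornerN hornerC => /eqP; rewrite subr_eq0 => /eqP.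
pose W := \det ('X%:M - map_mx polyC (phi x) - p *: map_mx polyC (phi K)).
have WE a : W.[a] = \det (a%:M - phi x - p.[a] *: phi K).
  rewrite /W -/(horner_eval a _) -det_map_mx; congr (\det _).
  by apply/matrixP => i j; rewrite !mxE /= /horner_eval !(hornerE, hornerMn).
have ex_common m : exists a, (p.[a] == m%:R) && (W.[a] == 0).
  have [a [a1 a2]] := phi_spec (x + m%:R *: K).
  have pa := charK _ _ a2; exists a; rewrite WE pa eqxx /=.
  by move: a1; rewrite phiD additiveMn eigenvalue_det opprD addrA.
have W0 : W = 0.
  apply/eqP; apply/contraT => Wn0.
  pose r m := xchoose (ex_common m).
  have rP m : (p.[r m] == m%:R) && (W.[r m] == 0) by apply: (xchooseP (ex_common m)).
  have := @max_poly_roots _ W [seq r m | m <- iota 0 (size W)] Wn0.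
  rewrite size_map size_iota ltnn => -> //.
    by apply/allP => _ /mapP[m _ ->]; case/andP: (rP m).
  rewrite map_inj_uniq ?iota_uniq // => a b rab.
  have /andP[/eqP pa _] := rP a; have /andP[/eqP pb _] := rP b.
  by apply/eqP; rewrite -(eqr_nat C) -pa -pb rab.
(* At [d i], a root of [p], the term in [phi K] drops out of [W]. *)
move=> i; rewrite eigenvalue_det; have := WE (d i).
by rewrite W0 horner0 proot scale0r subr0 => <-.
Qed.

Lemma distinct_eigenvalues_traces x (d : 'I_n -> C) :
  injective d -> (forall i, eigenvalue x (d i)) ->
  \tr (phi x *m phi x) = \tr (x *m x) /\
  \tr (phi x *m phi x *m phi x) = \tr (x *m x *m x).
Proof.
move=> d_inj dx; have dfx := additive_eigenvalues d_inj dx.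
have [P uP Px] := distinct_eigenvalues_diag d_inj dx.
have [Q uQ Qx] := distinct_eigenvalues_diag d_inj dfx.
pose D := diag_mx (\row_i d i).
have sq (y T : 'M[C]_n) : T *m y = D *m T -> T *m (y *m y) = D *m D *m T.
  by move=> Ty; rewrite mulmxA Ty -mulmxA Ty mulmxA.
have cu (y T : 'M[C]_n) : T *m y = D *m T -> T *m (y *m y *m y) = D *m D *m D *m T.
  by move=> Ty; rewrite mulmxA (sq _ _ Ty) -mulmxA Ty !mulmxA.
by rewrite (similar_trace uP (sq _ _ Px)) (similar_trace uQ (sq _ _ Qx))
  (similar_trace uP (cu _ _ Px)) (similar_trace uQ (cu _ _ Qx)).
Qed.

(** In a Schur basis [x] is triangular, and adding [m] times diag(0, 1, 2, ...) moves its
    eigenvalues to [T i i + m * i]. Two of them collide only when [m] is a root of [r]. *)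
Lemma exists_distinct_perturbation x :
  exists D : 'M[C]_n, exists2 r : {poly C}, r != 0 & forall m : nat, r.[m%:R] != 0 ->
   exists2 d : 'I_n -> C, injective d & forall i, eigenvalue (x + m%:R *: D) (d i).
Proof.
have [P /unitarymx_unit uP] := Schur x n_gt0.
rewrite /similar_to conjumx //; set T := P *m x *m invmx P => /is_trig_mxP T_trig.
pose E : 'M[C]_n := diag_mx (\row_i (i : nat)%:R).
exists (invmx P *m E *m P).
pose r := \prod_(k : 'I_n * 'I_n | k.1 != k.2)
  ((T k.1 k.1 - T k.2 k.2)%:P + ((k.1 : nat)%:R - (k.2 : nat)%:R) *: 'X).
exists r.
  apply/prodf_neq0 => -[i j] /= ij; apply/eqP => /(congr1 (fun q : {poly C} => q`_1)).
  rewrite coefD coefC coefZ coefX coef0 /= add0r mulr1 => /eqP.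
  by rewrite subr_eq0 eqr_nat => /eqP/val_inj/eqP; apply/negP.
move=> m rm; exists (fun i => T i i + m%:R * (i : nat)%:R).
  move=> i j /= eq_ij; apply/eqP; apply: contraNT rm => ij.
  rewrite /r horner_prod (bigD1 (i, j)) //= hornerD hornerC hornerZ hornerX.
  apply/eqP; set q := \prod_(_ | _) _.
  suff -> : T i i - T j j + (i%:R - j%:R) * m%:R = 0 by rewrite mul0r.
  have -> : T i i = T j j + m%:R * (j : nat)%:R - m%:R * (i : nat)%:R.
    by rewrite -eq_ij addrK.
  by ring.
move=> i.
have xE : x + m%:R *: (invmx P *m E *m P) = invmx P *m (T + m%:R *: E) *m P.
  rewrite mulmxDr mulmxDl /T -!mulmxA mulVmx // mulmx1 mulKmx //.
  by rewrite -scalemxAl -scalemxAr.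
have trig : is_trig_mx (T + m%:R *: E).
  apply/is_trig_mxP => k l kl; rewrite mxE T_trig // add0r !mxE.
  by rewrite -val_eqE (ltn_eqF kl) mulr0n mulr0.
pose a := T i i + m%:R * (i : nat)%:R.
have TE : (T + m%:R *: E) i i = a by rewrite mxE; congr (_ + _); rewrite !mxE eqxx mulr1n.
rewrite xE eigenvalue_det -/a.
have -> : a%:M - invmx P *m (T + m%:R *: E) *m P = invmx P *m (a%:M - (T + m%:R *: E)) *m P.
  by rewrite mulmxBr mulmxBl -!mulmxA mul_scalar_mx -scalemxAr mulVmx // scalemx1.
rewrite !det_mulmx !mulf_eq0; apply/orP; left; apply/orP; right.
rewrite -eigenvalue_det eigenvalue_root_char char_poly_trig //.
by apply/rootP; rewrite horner_prod (bigD1 i) //= hornerXsubC TE subrr mul0r.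
Qed.

(** Carries an identity polynomial in [m] from the perturbations with distinct eigenvalues back to
    [m = 0]: every natural number is a root of [r * q]. *)
Lemma perturbation_identity (r q : {poly C}) :
  r != 0 -> (forall m : nat, r.[m%:R] != 0 -> q.[m%:R] = 0) -> q.[0] = 0.
Proof.
move=> r0 rq; suff /eqP : r * q = 0.
  by rewrite mulf_eq0 (negPf r0) /= => /eqP->; rewrite horner0.
apply: poly_nat_roots => m; rewrite hornerM.
by have [->|/rq->] := eqVneq r.[m%:R] 0; rewrite ?mul0r ?mulr0.
Qed.

Lemma additive_trace2 x : \tr (phi x *m phi x) = \tr (x *m x).
Proof.
have [D [r r0 rP]] := exists_distinct_perturbation x.
pose t2 (u v : 'M[C]_n) : {poly C} :=
  (\tr (u *m u))%:P + \tr (u *m v + v *m u) *: 'X + \tr (v *m v) *: 'X^2.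
have t2E u v m : (t2 u v).[m] = \tr ((u + m *: v) *m (u + m *: v)).
  rewrite /t2 !(hornerD, hornerZ, hornerC, hornerX, hornerXn).
  rewrite !(mulmxDl, mulmxDr) -!scalemxAl -!scalemxAr.
  by rewrite !(mxtraceD, mxtraceZ); ring.
suff : (t2 (phi x) (phi D) - t2 x D).[0] = 0.
  by rewrite hornerD hornerN !t2E !scale0r !addr0 => /eqP; rewrite subr_eq0 => /eqP.
apply: (perturbation_identity r0) => m /rP[d d_inj dP].
have [tr2 _] := distinct_eigenvalues_traces d_inj dP.
by rewrite hornerD hornerN !t2E -tr2 phiD additiveMn subrr.
Qed.

Lemma additive_trace3 x : \tr (phi x *m phi x *m phi x) = \tr (x *m x *m x).
Proof.
have [D [r r0 rP]] := exists_distinct_perturbation x.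
pose t3 (u v : 'M[C]_n) : {poly C} :=
  (\tr (u *m u *m u))%:P + (\tr (u *m u *m v) + \tr (u *m v *m u) + \tr (v *m u *m u)) *: 'X
  + (\tr (u *m v *m v) + \tr (v *m u *m v) + \tr (v *m v *m u)) *: 'X^2
  + \tr (v *m v *m v) *: 'X^3.
have t3E u v m : (t3 u v).[m] = \tr ((u + m *: v) *m (u + m *: v) *m (u + m *: v)).
  rewrite /t3 !(hornerD, hornerZ, hornerC, hornerX, hornerXn).
  rewrite !(mulmxDl, mulmxDr, =^~ scalemxAl, =^~ scalemxAr).
  by rewrite !(mxtraceD, mxtraceZ); ring.
suff : (t3 (phi x) (phi D) - t3 x D).[0] = 0.
  by rewrite hornerD hornerN !t3E !scale0r !addr0 => /eqP; rewrite subr_eq0 => /eqP.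
apply: (perturbation_identity r0) => m /rP[d d_inj dP].
have [_ tr3] := distinct_eigenvalues_traces d_inj dP.
by rewrite hornerD hornerN !t3E -tr3 phiD additiveMn subrr.
Qed.

Lemma additive_trace_form x y : \tr (phi x *m phi y) = \tr (x *m y).
Proof.
have h := additive_trace2 (x + y).
rewrite phiD !(mulmxDl, mulmxDr) !mxtraceD !additive_trace2 in h.
rewrite (mxtrace_mulC (phi y) (phi x)) (mxtrace_mulC y x) in h.
apply: (@mulfI _ 2); first by rewrite pnatr_eq0.
apply/eqP; rewrite -subr_eq0; apply/eqP.
by rewrite -[RHS](subrr (\tr (x *m x) + \tr (x *m y) + (\tr (x *m y) + \tr (y *m y))))
  -{1}h; ring.
Qed.

Lemma additive_trace_cubic x y : \tr (phi x *m phi x *m phi y) = \tr (x *m x *m y).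
Proof.
(* Polarisation: the part odd in [v] involves only the traces of [u u v] and [v v v], and the latter
   is already preserved. *)
have E (u v : 'M[C]_n) : \tr ((u + v) *m (u + v) *m (u + v)) - \tr ((u - v) *m (u - v) *m (u - v))
   - 2 * \tr (v *m v *m v) = 6 * \tr (u *m u *m v).
  have c1 : \tr (u *m v *m u) = \tr (u *m u *m v).
    by rewrite (mxtrace_mulC (u *m v)) mulmxA.
  have c2 : \tr (v *m u *m u) = \tr (u *m u *m v).
    by rewrite (mxtrace_mulC (u *m u)) mulmxA.
  rewrite !(mulmxDl, mulmxDr, mulNmx, mulmxN, opprK) !(mxtraceD, raddfN) /=.
  by rewrite c1 c2; ring.
have := E (phi x) (phi y).
rewrite -additiveN -!phiD !additive_trace3 E => /mulfI; rewrite pnatr_eq0.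
by move=> /(_ isT).
Qed.

Lemma mxtrace_delta (y : 'M[C]_n) i j : \tr (y *m delta_mx i j) = y j i.
Proof.
rewrite /mxtrace (bigD1 j) //= big1 ?addr0 => [|k ki]; rewrite mxE (bigD1 i) //= mxE.
  rewrite !eqxx mulr1 big1 ?addr0 // => l lj.
  by rewrite mxE (negPf lj) mulr0.
rewrite eqxx (negPf ki) mulr0 add0r big1 // => l lj.
by rewrite mxE (negPf lj) mulr0.
Qed.

Lemma trace_nondegenerate (z : 'M[C]_n) : (forall y, \tr (z *m y) = 0) -> z = 0.
Proof. by move=> z0; apply/matrixP => i j; rewrite mxE -(z0 (delta_mx j i)) mxtrace_delta. Qed.

Lemma linear_left_inverse (f g : {linear 'M[C]_n -> 'M[C]_n}) :
  cancel f g -> cancel g f.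
Proof.
move=> fK y.
have : lin_mx f *m lin_mx g = 1%:M.
  apply/row_matrixP => i; rewrite row_mul !rowE mulmx1.
  rewrite -[delta_mx 0 i]vec_mxK.
  by rewrite mul_vec_lin mul_vec_lin fK.
move=> /mulmx1C GF; apply: (can_inj mxvecK).
by rewrite -!mul_vec_lin -mulmxA GF mulmx1.
Qed.

(** [phi] is not yet known to be linear over [C]. [image_comb] is the complex linear map with the
    same values on matrix units, and [image_coef] reads coordinates off by the trace form. *)
Definition image_comb (c : 'M[C]_n) := \sum_i \sum_j c i j *: phi (delta_mx i j).
Definition image_coef (y : 'M[C]_n) := \matrix_(i, j) \tr (y *m phi (delta_mx j i)).

Lemma image_comb_linear : linear image_comb.
Proof.
move=> a u v; rewrite /image_comb scaler_sumr -big_split /=; apply: eq_bigr => i _.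
rewrite scaler_sumr -big_split /=; apply: eq_bigr => j _.
by rewrite !mxE scalerDl scalerA.
Qed.

Lemma image_coef_linear : linear image_coef.
Proof.
move=> a u v; apply/matrixP => i j.
by rewrite !mxE mulmxDl mxtraceD -scalemxAl mxtraceZ.
Qed.

(** Preservation of the trace form makes [image_coef] a left inverse of [image_comb]. In finite
    dimension it is then also a right inverse, so the images of the matrix units span. *)
Lemma image_combK y : image_comb (image_coef y) = y.
Proof.
pose f := GRing.isLinear.Build C _ _ _ image_comb image_comb_linear.
pose f' : {linear 'M[C]_n -> 'M[C]_n} := HB.pack image_comb f.
pose g := GRing.isLinear.Build C _ _ _ image_coef image_coef_linear.
pose g' : {linear 'M[C]_n -> 'M[C]_n} := HB.pack image_coef g.
apply: (@linear_left_inverse f' g') => c /=.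
apply/matrixP => i j; rewrite mxE.
have -> : \tr (image_comb c *m phi (delta_mx j i)) =
    \sum_k \sum_l c k l * ((i == k) && (j == l))%:R.
  rewrite /image_comb mulmx_suml raddf_sum; apply: eq_bigr => k _.
  rewrite mulmx_suml raddf_sum; apply: eq_bigr => l _ /=.
  by rewrite -scalemxAl mxtraceZ additive_trace_form mxtrace_delta mxE.
rewrite (bigD1 i) //= (bigD1 j) //= !eqxx mulr1 !big1 ?addr0 // => [k ki|l lj].
  by apply: big1 => l _; rewrite eq_sym (negPf ki) mulr0.
by rewrite eq_sym (negPf lj) mulr0.
Qed.

Lemma image_nondegenerate z : (forall y, \tr (z *m phi y) = 0) -> z = 0.
Proof.
move=> z0; apply: trace_nondegenerate => y; rewrite -(image_combK y).
rewrite /image_comb mulmx_sumr raddf_sum big1 //= => i _.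
rewrite mulmx_sumr raddf_sum big1 //= => j _.
by rewrite -scalemxAr mxtraceZ z0 mulr0.
Qed.

(** The trace form is complex bilinear and preserved, so the difference of the two sides is
    orthogonal to the whole image of [phi]. *)
Lemma additive_scalable c x : phi (c *: x) = c *: phi x.
Proof.
apply/eqP; rewrite -subr_eq0; apply/eqP/image_nondegenerate => y.
by rewrite mulmxBl raddfB /= -scalemxAl mxtraceZ !additive_trace_form
  -scalemxAl mxtraceZ subrr.
Qed.

Lemma additive_square x : phi (x *m x) = phi x *m phi x.
Proof.
apply/eqP; rewrite -subr_eq0; apply/eqP/image_nondegenerate => y.
by rewrite mulmxBl raddfB /= additive_trace_form additive_trace_cubic subrr.
Qed.

End TracePowers.

(** * Jordan automorphisms of the matrix algebra *)

Section JordanNormalized.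
Variables (C : numClosedFieldType) (n : nat) (psi : 'M[C]_n -> 'M[C]_n).
Hypothesis psiD : forall x y, psi (x + y) = psi x + psi y.
Hypothesis psiZ : forall c x, psi (c *: x) = c *: psi x.
Hypothesis psi_form : forall x y, \tr (psi x *m psi y) = \tr (x *m y).
Hypothesis psi_sq : forall x, psi (x *m x) = psi x *m psi x.

Lemma jordan_mul x y :
  psi (x *m y + y *m x) = psi x *m psi y + psi y *m psi x.
Proof.
have := psi_sq (x + y); rewrite !(psiD, mulmxDl, mulmxDr) !psi_sq.
by rewrite -!addrA => /addrI; rewrite !addrA => /addIr; rewrite addrC => ->; rewrite addrC.
Qed.

Lemma jordan0 : psi 0 = 0.
Proof. by have := psiZ 0 0; rewrite !scale0r. Qed.

(** As [p] is idempotent and anticommutes with [q], the product [p q p] equals both [p q] and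
    [- p q]. *)
Lemma jordan_orthogonal i j : i != j ->
  psi (delta_mx i i) *m psi (delta_mx j j) = 0.
Proof.
move=> ij; set p := psi _; set q := psi _.
have idem k : psi (delta_mx k k) *m psi (delta_mx k k) = psi (delta_mx k k).
  by rewrite -psi_sq mul_delta_mx.
have pp : p *m p = p by apply: idem.
have pq : p *m q + q *m p = 0.
  by rewrite -jordan_mul !mul_delta_mx_0 ?addr0 ?jordan0 // eq_sym.
have qpE : q *m p = - (p *m q) by apply/eqP; rewrite -addr_eq0 addrC pq.
have e1 : p *m q *m p = - (p *m q).
  by rewrite -mulmxA qpE mulmxN mulmxA pp.
have e2 : p *m q *m p = p *m q.
  by rewrite -[p *m q]opprK -qpE mulNmx -mulmxA pp.
have /eqP : p *m q *+ 2 = 0 by rewrite mulr2n -{1}e2 e1 addNr.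
rewrite -scaler_nat scaler_eq0 pnatr_eq0 /=.
by move/eqP.
Qed.

(** Column [i] of [u] is a nonzero vector fixed by the idempotent [psi (delta_mx i i)], which is
    nonzero because the trace form is preserved. Orthogonality of these idempotents makes the
    columns independent. *)
Lemma jordan_simultaneous_diag :
  exists2 u, u \in unitmx &
    forall i, psi (delta_mx i i) *m u = u *m delta_mx i i.
Proof.
have ex i : exists2 v : 'cV[C]_n, psi (delta_mx i i) *m v = v & v != 0.
  set p := psi _.
  have pp : p *m p = p by rewrite -psi_sq mul_delta_mx.
  have p0 : p != 0.
    apply/eqP => p0; have := psi_form (delta_mx i i) (delta_mx i i).
    rewrite -/p p0 mul0mx raddf0 mxtrace_delta mxE !eqxx => /eqP.
    by rewrite eq_sym oner_eq0.
  have [j pj] : exists j, col j p != 0.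
    apply/existsP; apply: contraNT p0; rewrite negb_exists => /forallP h.
    apply/eqP/matrixP => k j; move: (h j); rewrite negbK => /eqP/matrixP/(_ k 0).
    by rewrite !mxE.
  by exists (col j p) => //; rewrite !colE mulmxA pp.
have /fin_all_exists2 [v pv v0] := ex.
pose u := \matrix_(k, i) v i k 0.
have uE i : psi (delta_mx i i) *m u = u *m delta_mx i i.
  apply/matrixP => k j.
  have -> : (psi (delta_mx i i) *m u) k j = (psi (delta_mx i i) *m v j) k 0.
    by rewrite !mxE; apply: eq_bigr => l _; rewrite mxE.
  have -> : (u *m delta_mx i i) k j = (j == i)%:R * v j k 0.
    rewrite mxE (bigD1 i) //= big1 ?addr0 => [|l li]; rewrite !mxE.
      by rewrite eqxx; case: eqP => [->|_]; rewrite ?mulr1 ?mul1r ?mulr0 ?mul0r.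
    by rewrite (negPf li) mulr0.
  have [->|ji] := eqVneq j i; first by rewrite pv mul1r.
  by rewrite -(pv j) mulmxA jordan_orthogonal 1?eq_sym // mul0mx mul0r mxE.
exists u => //; rewrite -unitmx_tr -row_free_unit -kermx_eq0; apply/rowV0P.
move=> c /sub_kermxP cu; apply/rowP => i; rewrite mxE.
have uc : u *m c^T = 0 by apply: trmx_inj; rewrite trmx_mul trmxK cu trmx0.
have : u *m delta_mx i i *m c^T = 0 by rewrite -uE -mulmxA uc mulmx0.
have -> : u *m delta_mx i i *m c^T = c 0 i *: v i.
  apply/colP => k; rewrite mxE mxE (bigD1 i) //= big1 ?addr0 => [|l li].
    rewrite !mxE (bigD1 i) //= big1 ?addr0 => [|m mi]; rewrite !mxE.
      by rewrite !eqxx mulr1 mulrC.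
    by rewrite (negPf mi) mulr0.
  rewrite mxE big1 ?mul0r // => m _.
  by rewrite !mxE (negPf li) andbF mulr0.
by move=> /eqP; rewrite scaler_eq0 (negPf (v0 i)) orbF => /eqP.
Qed.

Hypothesis psi_diag : forall i, psi (delta_mx i i) = delta_mx i i.

Let a i j := psi (delta_mx i j) i j.
Let b i j := psi (delta_mx i j) j i.

(** Peirce decomposition: [delta_mx i j] is reproduced by the Jordan product with [delta_mx i i] and
    with [delta_mx j j]. Hence a nonzero entry of the image has exactly one index equal to [i] and
    exactly one equal to [j]. *)
Lemma jordan_unit i j : i != j ->
  psi (delta_mx i j) = a i j *: delta_mx i j + b i j *: delta_mx j i.
Proof.
move=> ij; set y := psi _.
have dl k s l : (delta_mx k k *m y) s l = (s == k)%:R * y s l.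
  rewrite mxE (bigD1 k) //= big1 ?addr0 => [|m mk]; rewrite !mxE ?eqxx ?andbT.
    by case: eqP => [->|_]; rewrite ?mul1r ?mul0r.
  by rewrite (negPf mk) andbF mul0r.
have dr k s l : (y *m delta_mx k k) s l = (l == k)%:R * y s l.
  rewrite mxE (bigD1 k) //= big1 ?addr0 => [|m mk]; rewrite !mxE ?eqxx /=.
    by case: eqP => [->|_]; rewrite ?mulr1 ?mul1r ?mulr0 ?mul0r.
  by rewrite (negPf mk) mulr0.
have yi : delta_mx i i *m y + y *m delta_mx i i = y.
  rewrite -psi_diag -jordan_mul mul_delta_mx mul_delta_mx_0 ?addr0 //.
  by rewrite eq_sym.
have yj : delta_mx j j *m y + y *m delta_mx j j = y.
  by rewrite -psi_diag -jordan_mul mul_delta_mx mul_delta_mx_0 ?add0r // eq_sym.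
have yi' k l : (k == i)%:R * y k l + (l == i)%:R * y k l = y k l.
  by rewrite -{3}yi mxE dl dr.
have yj' k l : (k == j)%:R * y k l + (l == j)%:R * y k l = y k l.
  by rewrite -{3}yj mxE dl dr.
apply/matrixP => k l; rewrite !mxE; have := yi' k l; have := yj' k l.
have [->|ki] := eqVneq k i.
  rewrite (negPf ij) /= mul0r add0r mulr0 addr0.
  have [->|li] := eqVneq l i.
    rewrite (negPf ij) mul0r mulr0 => <-; by rewrite !mulr0 addr0.
  have [->|lj] := eqVneq l j; first by rewrite mulr1.
  by rewrite mul0r mulr0.
rewrite !mul0r add0r !mulr0 add0r.
have [->|li] := eqVneq l i; last by rewrite mul0r andbF mulr0.
have [->|kj] := eqVneq k j; first by rewrite mulr1.
by rewrite (negPf ij) !mul0r addr0 mulr0 => <-.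
Qed.

Lemma jordan_ab i j : i != j -> a i j * b i j = 0.
Proof.
move=> ij; have := psi_sq (delta_mx i j).
rewrite mul_delta_mx_0 1?eq_sym // jordan0 jordan_unit //.
rewrite mulmxDl !mulmxDr -!scalemxAl -!scalemxAr !mul_delta_mx_cond !eqxx.
rewrite [j == i]eq_sym (negPf ij) !mulr0n !mulr1n !scaler0 add0r addr0.
move/(congr1 (fun m : 'M[C]_n => m i i)).
by rewrite !mxE !eqxx (negPf ij) /= !mulr0 mulr1 addr0.
Qed.

Lemma jordan_tr i j : i != j -> a i j * a j i + b i j * b j i = 1.
Proof.
move=> ij; have := psi_form (delta_mx i j) (delta_mx j i).
rewrite mxtrace_delta mxE !eqxx /=.
have ji : j != i by rewrite eq_sym.
rewrite (jordan_unit ij) (jordan_unit ji).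
rewrite mulmxDl !mulmxDr -!scalemxAl -!scalemxAr !mul_delta_mx_cond !eqxx.
rewrite (negPf ij) (negPf ji) !mulr0n !mulr1n !scaler0 addr0 add0r.
have tr1 k : \tr (delta_mx k k : 'M[C]_n) = 1.
  by rewrite -(mul_delta_mx k) mxtrace_delta mxE !eqxx.
by rewrite !(mxtraceD, mxtraceZ) !tr1 !mulr1 => ->.
Qed.

Lemma jordan_triple i j k : i != j -> j != k -> i != k ->
  a i k = a i j * a j k /\ b i k = b i j * b j k.
Proof.
move=> ij jk ik; have := jordan_mul (delta_mx i j) (delta_mx j k).
rewrite mul_delta_mx mul_delta_mx_0 1?eq_sym // addr0.
rewrite (jordan_unit ij) (jordan_unit jk) (jordan_unit ik).
rewrite !mulmxDl !mulmxDr -!scalemxAl -!scalemxAr !mul_delta_mx_cond !eqxx.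
rewrite [k == i]eq_sym [k == j]eq_sym [j == i]eq_sym (negPf ij) (negPf jk) (negPf ik).
rewrite !mulr0n !mulr1n !scaler0 ?addr0 ?add0r => E; split.
  move/(congr1 (fun m : 'M[C]_n => m i k)): E.
  by rewrite !mxE !eqxx (negPf ik) /= !mulr0 !mulr1 !addr0 => ->; rewrite // mulrC.
move/(congr1 (fun m : 'M[C]_n => m k i)): E.
by rewrite !mxE !eqxx [k == i]eq_sym (negPf ik) /= !mulr0 !mulr1 !add0r => ->; rewrite // mulrC.
Qed.

(** By [jordan_ab] and [jordan_tr] exactly one of [a i j] and [b i j] is nonzero. The alternative is
    the same for a pair and its reverse, and by [jordan_triple] for consecutive pairs, hence for all
    pairs. *)
Lemma jordan_type : (forall i j, i != j -> b i j = 0) \/ (forall i j, i != j -> a i j = 0).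
Proof.
have F i j : i != j -> (b i j == 0) = (a i j != 0).
  move=> ij; have := jordan_ab ij; have := jordan_tr ij.
  have [->|a0] := eqVneq (a i j) 0.
    rewrite mul0r add0r; have [->|//] := eqVneq (b i j) 0.
    by rewrite mul0r => /eqP; rewrite eq_sym oner_eq0.
  by move=> _ /eqP; rewrite mulf_eq0 (negPf a0).
have sym i j : i != j -> (b i j == 0) = (b j i == 0).
  move=> ij; have ji : j != i by rewrite eq_sym.
  have := jordan_tr ij; have := F _ _ ij; have := F _ _ ji.
  case: (b i j =P 0) => [->|_]; case: (b j i =P 0) => [->|_] // /esym.
    by move=> /negbFE/eqP-> _; rewrite mulr0 mul0r addr0 => /eqP; rewrite eq_sym oner_eq0.
  by move=> _ /esym/negbFE/eqP->; rewrite mulr0 mul0r addr0 => /eqP; rewrite eq_sym oner_eq0.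
have trans i j k : i != j -> j != k -> i != k -> (b i j == 0) = (b j k == 0).
  move=> ij jk ik; have [ea eb] := jordan_triple ij jk ik.
  have := F _ _ ik; rewrite ea eb !mulf_eq0 negb_or (F _ _ ij) (F _ _ jk).
  by case: (a i j == 0); case: (a j k == 0).
have [/existsP[i /existsP[j /andP[ij bij]]]|] :=
  boolP [exists i, exists j, (i != j) && (b i j != 0)]; last first.
  rewrite negb_exists => /forallP h; left => i j ij.
  move: (h i); rewrite negb_exists => /forallP/(_ j).
  by rewrite ij negbK => /eqP.
right.
have row k : i != k -> b i k != 0.
  move=> ik; have [<-//|jk] := eqVneq j k.
  have ji : j != i by rewrite eq_sym.
  by rewrite -(trans j i k) // sym // bij.
suff all_b k l : k != l -> b k l != 0.
  by move=> k l kl; have := F _ _ kl; rewrite (negPf (all_b _ _ kl)) => /esym/negbFE/eqP.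
move=> kl; have [ik|ik] := eqVneq i k; first by subst k; apply: row.
have [il|il] := eqVneq i l; first by subst l; rewrite sym // row // eq_sym.
by rewrite -(trans i k l) // row.
Qed.

(** The coefficients form a multiplicative cocycle, so [a i j] is the quotient of [a i i0] by
    [a j i0], and conjugation by a diagonal matrix realises [psi]. *)
Lemma jordan_inner : (0 < n)%N -> (forall i j, i != j -> b i j = 0) ->
  exists2 u, u \in unitmx & forall x, psi x *m u = u *m x.
Proof.
move=> n_gt0 b0; pose i0 : 'I_n := Ordinal n_gt0.
have aii i : a i i = 1 by rewrite /a psi_diag mxE !eqxx.
have unit i j : psi (delta_mx i j) = a i j *: delta_mx i j.
  have [<-|ij] := eqVneq i j; first by rewrite aii scale1r psi_diag.
  by rewrite jordan_unit // b0 // scale0r addr0.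
have aM i j k : a i k = a i j * a j k.
  have [<-|ij] := eqVneq i j; first by rewrite aii mul1r.
  have [<-|jk] := eqVneq j k; first by rewrite aii mulr1.
  have [<-|ik] := eqVneq i k; last by case: (jordan_triple ij jk ik).
  by have := jordan_tr ij; rewrite b0 // mul0r addr0 aii.
have psiE x i j : psi x i j = a i j * x i j.
  have psi_sum (I : finType) (G : I -> 'M[C]_n) : psi (\sum_k G k) = \sum_k psi (G k).
    by apply: (big_morph psi psiD jordan0).
  have -> : psi x i j = \sum_k \sum_l a k l * x k l * ((i == k) && (j == l))%:R.
    rewrite [in LHS](matrix_sum_delta x) psi_sum summxE; apply: eq_bigr => k _.
    rewrite psi_sum summxE; apply: eq_bigr => l _.
    by rewrite psiZ unit !mxE mulrCA mulrA.
  rewrite (bigD1 i) //= (bigD1 j) //= !eqxx mulr1 !big1 ?addr0 // => [k ki|l lj].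
    by apply: big1 => l _; rewrite eq_sym (negPf ki) mulr0.
  by rewrite eq_sym (negPf lj) mulr0.
exists (diag_mx (\row_i a i i0)).
  rewrite unitmxE det_diag unitfE; apply/prodf_neq0 => i _; rewrite mxE.
  apply/eqP => ai0; have := aM i i0 i; rewrite aii ai0 mul0r => /eqP.
  by rewrite oner_eq0.
move=> x; apply/matrixP => i j; rewrite mul_mx_diag mul_diag_mx !mxE psiE.
by rewrite mulrAC -aM.
Qed.

End JordanNormalized.

Lemma additive_spec_classification (C : numClosedFieldType) n (phi : 'M[C]_n -> 'M[C]_n) :
  (0 < n)%N -> (forall x y, phi (x + y) = phi x + phi y) ->
  (forall x, spec_meet (phi x) x) ->
  exists u : 'M[C]_n, u \in unitmx /\
    ((forall x, phi x = u *m x *m invmx u) \/ (forall x, phi x = u *m x^T *m invmx u)).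
Proof.
move=> n_gt0 phiD phi_spec.
have phiZ := additive_scalable n_gt0 phiD phi_spec.
have phi_form := additive_trace_form n_gt0 phiD phi_spec.
have phi_sq := additive_square n_gt0 phiD phi_spec.
have [u uu phi_u] := jordan_simultaneous_diag phiD phiZ phi_form phi_sq.
pose psi x := invmx u *m phi x *m u.
have psiD x y : psi (x + y) = psi x + psi y by rewrite /psi phiD mulmxDr mulmxDl.
have psiZ c x : psi (c *: x) = c *: psi x by rewrite /psi phiZ -scalemxAr -scalemxAl.
have psiM x y : psi x *m psi y = invmx u *m (phi x *m phi y) *m u.
  by rewrite /psi -!mulmxA (mulmxA u) mulmxV // mul1mx.
have psi_form x y : \tr (psi x *m psi y) = \tr (x *m y).
  by rewrite psiM mxtrace_mulC mulmxA mulmxV // mul1mx phi_form.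
have psi_sq x : psi (x *m x) = psi x *m psi x by rewrite psiM -phi_sq.
have psi_diag i : psi (delta_mx i i) = delta_mx i i.
  by rewrite /psi -mulmxA phi_u mulKmx.
have conj v (y z : 'M[C]_n) : v \in unitmx -> invmx u *m y *m u *m v = v *m z ->
    y = (u *m v) *m z *m invmx (u *m v).
  move=> uv E; have uuv : u *m v \in unitmx by rewrite unitmx_mul uu.
  rewrite -(mulmxA u) -E -[LHS](mulmxK uuv); congr (_ *m _).
  by rewrite !mulmxA mulmxV // mul1mx.
have [b0|a0] := jordan_type psiD psiZ psi_form psi_sq psi_diag.
  have [v uv vE] := jordan_inner psiD psiZ psi_form psi_sq psi_diag n_gt0 b0.
  exists (u *m v); rewrite unitmx_mul uu uv; split=> //; left => x.
  by apply: conj => //; rewrite -vE.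
(* Transposition exchanges the roles of [a] and [b], which reduces this case to the inner one. *)
pose chi x := psi x^T.
have chiD x y : chi (x + y) = chi x + chi y by rewrite /chi linearD psiD.
have chiZ c x : chi (c *: x) = c *: chi x by rewrite /chi linearZ psiZ.
have chi_form x y : \tr (chi x *m chi y) = \tr (x *m y).
  by rewrite /chi psi_form -trmx_mul mxtrace_tr mxtrace_mulC.
have chi_sq x : chi (x *m x) = chi x *m chi x by rewrite /chi trmx_mul psi_sq.
have chi_diag i : chi (delta_mx i i) = delta_mx i i by rewrite /chi trmx_delta.
have b0 i j : i != j -> chi (delta_mx i j) j i = 0.
  by move=> ij; rewrite /chi trmx_delta a0 // eq_sym.
have [v uv vE] := jordan_inner chiD chiZ chi_form chi_sq chi_diag n_gt0 b0.
exists (u *m v); rewrite unitmx_mul uu uv; split=> //; right => x.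
by apply: conj => //; rewrite -vE /chi trmxK.
Qed.

(** * The real subfield *)

(** The order of [C] is only partial; its real elements are packaged as a totally ordered field, in
    which linear and nonlinear arithmetic can be automated. *)
Record reals (C : numClosedFieldType) :=
  Reals { rval :> C; rvalP : rval \is Num.real }.

Section Reals.
Variable C : numClosedFieldType.
Notation R := (reals C).
HB.instance Definition _ := [isSub for @rval C].
HB.instance Definition _ := [Choice of R by <:].
HB.instance Definition _ := [SubChoice_isSubIntegralDomain of R by <:].
HB.instance Definition _ := [SubIntegralDomain_isSubField of R by <:].
HB.instance Definition _ : Order.isPOrder ring_display R :=
  Order.CancelPartial.Pcan _ (@valK _ _ R).

Lemma reals_total : total (<=%O : rel (R : porderType _)).
Proof. by move=> x y; apply/real_leVge/valP/valP. Qed.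
HB.instance Definition _ := Order.POrder_isTotal.Build _ R reals_total.

Lemma rval_zmod_morphism : zmod_morphism (@rval C). Proof. by []. Qed.
Lemma rval_monoid_morphism : monoid_morphism (@rval C). Proof. by []. Qed.
HB.instance Definition _ := GRing.isZmodMorphism.Build R C (@rval C) rval_zmod_morphism.
HB.instance Definition _ := GRing.isMonoidMorphism.Build R C (@rval C) rval_monoid_morphism.

Definition reals_norm (x : R) : R := Reals (normr_real (val x)).
Lemma reals_ler_normD x y : reals_norm (x + y) <= reals_norm x + reals_norm y.
Proof. exact: ler_normD. Qed.
Lemma reals_normr0_eq0 x : reals_norm x = 0 -> x = 0.
Proof. by move=> /(congr1 val)/normr0_eq0 ?; apply/val_inj. Qed.
Lemma reals_normrMn x n : reals_norm (x *+ n) = reals_norm x *+ n.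
Proof. by apply/val_inj; rewrite /= !rmorphMn/= normrMn. Qed.
Lemma reals_normrN x : reals_norm (- x) = reals_norm x.
Proof. by apply/val_inj; apply: normrN. Qed.

Section Num.
Let z : R := 0.
Lemma reals_addr_gt0 (x y : R) : z < x -> z < y -> z < x + y.
Proof. exact: addr_gt0. Qed.
Lemma reals_ger_leVge (x y : R) : z <= x -> z <= y -> (x <= y) || (y <= x).
Proof. exact: ger_leVge. Qed.
Lemma reals_normrM : {morph reals_norm : x y / x * y}.
Proof. by move=> *; apply/val_inj; apply: normrM. Qed.
Lemma reals_ler_def (x y : R) : (x <= y) = (reals_norm (y - x) == y - x).
Proof. by apply: ler_def. Qed.
End Num.

HB.instance Definition _ := Num.Zmodule_isNormed.Build _ R
  reals_ler_normD reals_normr0_eq0 reals_normrMn reals_normrN.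
HB.instance Definition _ := Num.isNumRing.Build R
  reals_addr_gt0 reals_ger_leVge reals_normrM reals_ler_def.

Definition cabs (z : C) : R := Reals (normr_real z).
Definition cre (z : C) : R := Reals (Creal_Re z).

Lemma rvalD (r t : R) : rval (r + t) = rval r + rval t. Proof. by []. Qed.
Lemma rvalN (r : R) : rval (- r) = - rval r. Proof. by []. Qed.
Lemma rvalB (r t : R) : rval (r - t) = rval r - rval t. Proof. by []. Qed.
Lemma rvalM (r t : R) : rval (r * t) = rval r * rval t. Proof. by []. Qed.
Lemma rval1 : rval (1 : R) = 1. Proof. by []. Qed.
Lemma rval0 : rval (0 : R) = 0. Proof. by []. Qed.

Lemma cabs_ge0 z : 0 <= cabs z. Proof. exact: normr_ge0. Qed.
Lemma cabs_eq0 z : (cabs z == 0) = (z == 0).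
Proof. by rewrite -val_eqE /= normr_eq0. Qed.
Lemma cabs0 : cabs 0 = 0. Proof. by apply/val_inj; rewrite /= normr0. Qed.
Lemma cabsM x y : cabs (x * y) = cabs x * cabs y.
Proof. by apply/val_inj; rewrite /= normrM. Qed.
Lemma cabsD x y : cabs (x + y) <= cabs x + cabs y.
Proof. exact: ler_normD. Qed.
Lemma cabsN x : cabs (- x) = cabs x.
Proof. by apply/val_inj; rewrite /= normrN. Qed.
Lemma cabsB x y : cabs (x - y) = cabs (y - x).
Proof. by rewrite -cabsN opprB. Qed.
Lemma cabsV x : cabs x^-1 = (cabs x)^-1.
Proof. by apply/val_inj; rewrite [RHS](fmorphV (@rval C)) /= normfV. Qed.
Lemma cabsX x n : cabs (x ^+ n) = cabs x ^+ n.
Proof. by apply/val_inj; rewrite [RHS](rmorphXn (@rval C)) /= normrX. Qed.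
Lemma cabs_rval (r : R) : cabs (rval r) = `|r|.
Proof. exact: val_inj. Qed.
Lemma cabs_rvalB (r t : R) : cabs (rval r - rval t) = `|r - t|.
Proof. exact: val_inj. Qed.
Lemma cabs_nat n : cabs n%:R = n%:R.
Proof. by apply/val_inj; rewrite [RHS](rmorph_nat (@rval C)) /= normr_nat. Qed.
Lemma cabs1 : cabs 1 = 1. Proof. exact: (cabs_nat 1). Qed.
Lemma cabs_i : cabs 'i = 1.
Proof. by apply/val_inj; rewrite /= normCi. Qed.
Lemma cabs_sum (I : Type) (s : seq I) (P : pred I) (G : I -> C) :
  cabs (\sum_(i <- s | P i) G i) <= \sum_(i <- s | P i) cabs (G i).
Proof.
elim/big_rec2: _ => [|i y1 y2 _ h]; first by rewrite cabs0.
by apply: le_trans (cabsD _ _) _; rewrite lerD2l.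
Qed.

Lemma creD x y : cre (x + y) = cre x + cre y.
Proof. by apply/val_inj; rewrite /= raddfD. Qed.
Lemma creN x : cre (- x) = - cre x.
Proof. by apply/val_inj; rewrite /= raddfN. Qed.
Lemma creB x y : cre (x - y) = cre x - cre y.
Proof. by rewrite creD creN. Qed.
Lemma cre0 : cre 0 = 0. Proof. by apply/val_inj; rewrite /= raddf0. Qed.
Lemma creZ (r : R) x : cre (rval r * x) = r * cre x.
Proof. by apply/val_inj; rewrite /= ReMl // rvalP. Qed.
Lemma cre_rval (r : R) : cre (rval r) = r.
Proof. by apply/val_inj/Creal_ReP/rvalP. Qed.
Lemma cre_rvalB (r t : R) : cre (rval r - rval t) = r - t.
Proof. by rewrite creB !cre_rval. Qed.
Lemma cre_le x : cre x <= cabs x.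
Proof. exact: (leif_Re_Creal x).1. Qed.
Lemma cre_abs x : `|cre x| <= cabs x.
Proof. exact: (leif_normC_Re_Creal x).1. Qed.
Lemma crect z : z = rval (cre z) + 'i * rval (cre (- 'i * z)).
Proof.
rewrite {1}[z]Crect; congr (_ + 'i * _).
by rewrite /= mulNr raddfN /= ReMil opprK.
Qed.
Lemma cabs_re_conj z : cre (z * z^*) = cabs z ^+ 2.
Proof.
apply/val_inj; rewrite [RHS](rmorphXn (@rval C)) /= -normCK; apply/Creal_ReP.
by apply: rpredX; exact: normr_real.
Qed.

Hypothesis hC : real_complete C.

Lemma reals_sup (E : R -> Prop) :
  (exists x, E x) -> (exists M, forall x, E x -> x <= M) ->
  exists s, (forall x, E x -> x <= s) /\ (forall M, (forall x, E x -> x <= M) -> s <= M).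
Proof.
move=> [x0 Ex0] [M EM].
have [s [s_ub s_lub]] : exists s : C, (forall x, (exists2 r, E r & x = rval r) -> x <= s) /\
    (forall M, (forall x, (exists2 r, E r & x = rval r) -> x <= M) -> s <= M).
  apply: hC.
  - by move=> _ [r _ ->]; apply: rvalP.
  - by exists (rval x0), x0.
  - by exists (rval M) => _ [r Er ->]; apply: EM.
have s_real : s \is Num.real.
  have x0s : rval x0 <= s by apply: s_ub; exists x0.
  by rewrite -[s](subrK (rval x0)) realD ?rvalP // ger0_real // subr_ge0.
exists (Reals s_real); split=> [x Ex|M' M'P]; first by apply: s_ub; exists x.
by apply: (s_lub (rval M')) => _ [r Er ->]; apply: M'P.
Qed.

Lemma reals_archi (x : R) : exists n : nat, x < n%:R.
Proof.
apply: contrapT => h.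
have hx n : n%:R <= x by rewrite leNgt; apply/negP => xn; apply: h; exists n.
(* If the naturals were bounded, one less than their least upper bound would bound them too. *)
have [s [ub lub]] := @reals_sup (fun y => exists n : nat, y = n%:R)
  (ex_intro _ 0 (ex_intro _ 0%N erefl)) (ex_intro _ x (fun y yn => let: ex_intro n e := yn in
    eq_rect_r (fun y => y <= x) (hx n) e)).
have : s <= s - 1; last lra.
by apply: lub => _ [n ->]; have := ub n.+1%:R (ex_intro _ n.+1 erefl); rewrite -natr1; lra.
Qed.

Lemma le_of_inv_nat (x y c : R) : (forall n : nat, x <= y + c / n.+1%:R) -> x <= y.
Proof.
move=> h; rewrite leNgt; apply/negP => yx.
have [n cn] := reals_archi (`|c| / (x - y)).
have := h n; rewrite -lerBlDl ler_pdivlMr ?ltr0Sn //.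
rewrite ltr_pdivrMr ?subr_gt0 // in cn.
have := ler_norm c; rewrite -natr1; lra.
Qed.

Lemma expr_small (r e : R) : 0 <= r -> r < 1 -> 0 < e ->
  exists N : nat, forall k, (N <= k)%N -> r ^+ k < e.
Proof.
move=> r0 r1 e0.
have [->|rn0] := eqVneq r 0.
  by exists 1%N => -[|k] // _; rewrite exprS mul0r.
have rp : 0 < r by rewrite lt_def rn0.
(* Bernoulli's inequality for the powers of the inverse of [r], cleared of denominators. *)
have bern k : r ^+ k * (1 + k%:R * (1 - r)) <= 1.
  elim: k => [|k IH]; first by rewrite mul0r addr0 mulr1.
  rewrite exprS -natr1; have := exprn_ge0 k r0.
  move=> a0; have : 0 <= r ^+ k * ((1 - r) ^+ 2 * (1 + k%:R)).
    by rewrite mulr_ge0 // mulr_ge0 ?sqr_ge0 // addr_ge0.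
  lra.
have [N hN] := reals_archi ((e * (1 - r))^-1).
have er : 0 < e * (1 - r) by rewrite mulr_gt0 // subr_gt0.
exists N => k Nk; rewrite ltNge; apply/negP => erk.
have kN : (e * (1 - r))^-1 < k%:R by apply: lt_le_trans hN _; rewrite ler_nat.
have : 1 < k%:R * (e * (1 - r)) by rewrite -ltr_pdivrMr // mul1r.
have k1 : 0 <= 1 + k%:R * (1 - r) by rewrite addr_ge0 // mulr_ge0 // subr_ge0 ltW.
have := bern k; have := ler_wpM2r k1 erk; nra.
Qed.

Lemma half_expr_small (e : R) : 0 < e -> exists N : nat, forall k, (N <= k)%N -> 2^-1 ^+ k < e.
Proof. by apply: expr_small; [rewrite invr_ge0 | rewrite invf_lt1 // ltr1n]. Qed.

End Reals.

(** * Ultralimits *)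

(** An ultrafilter finer than the cofinite filter gives every bounded sequence a limit. A bounded
    sequence of maps then converges at all points at once, with no passage to subsequences. *)
Definition UF : set (set nat) :=
  projT1 (cid (ultraFilterLemma eventually_filter)).

Lemma UF_ultra : UltraFilter UF.
Proof. by rewrite /UF; case: cid => G []. Qed.

Lemma UF_filter : Filter UF.
Proof. by have UFp := @ultra_proper _ _ UF_ultra; exact: filter_filter. Qed.

Lemma UF_S (P Q : nat -> Prop) : (forall k, P k -> Q k) -> UF [set k | P k] -> UF [set k | Q k].
Proof. by move=> PQ; have := UF_filter => UFf; apply: filterS. Qed.

Lemma UF_I (P Q : nat -> Prop) : UF [set k | P k] -> UF [set k | Q k] -> UF [set k | P k /\ Q k].
Proof. by have := UF_filter => UFf; apply: filterI. Qed.

Lemma UF_ev (N : nat) (P : nat -> Prop) : (forall k, (N <= k)%N -> P k) -> UF [set k | P k].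
Proof.
move=> h; rewrite /UF; case: cid => G [GU /= sG]; apply: sG.
by exists N => // k /h.
Qed.

Lemma UF_T (P : nat -> Prop) : (forall k, P k) -> UF [set k | P k].
Proof. by move=> h; apply: (@UF_ev 0). Qed.

Lemma UF_ne (P : nat -> Prop) : UF [set k | P k] -> exists k, P k.
Proof. by have := @ultra_proper _ _ UF_ultra => UFp /filter_ex [k Pk]; exists k. Qed.

Lemma UF_C (P : nat -> Prop) : UF [set k | P k] \/ UF [set k | ~ P k].
Proof. exact: (in_ultra_setVsetC [set k | P k] UF_ultra). Qed.

Section Ultralimits.
Variable C : numClosedFieldType.
Hypothesis hC : real_complete C.
Notation R := (reals C).
Implicit Types (u v : nat -> C) (l m : C).

Definition cvgU u l := forall e : R, 0 < e -> UF [set k | cabs (u k - l) < e].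

Lemma cvgU_cst l : cvgU (fun=> l) l.
Proof. by move=> e e0; apply: UF_T => k; rewrite subrr cabs0. Qed.

Lemma cvgU_near u v l : cvgU u l ->
  (forall e : R, 0 < e -> UF [set k | cabs (u k - v k) < e]) -> cvgU v l.
Proof.
move=> ul uv e e0; have e2 : 0 < e / 2 by rewrite divr_gt0.
apply: UF_S (UF_I (ul _ e2) (uv _ e2)) => k [h1 h2].
have := cabsD (u k - l) (v k - u k); rewrite (cabsB (v k)).
have -> : u k - l + (v k - u k) = v k - l by ring.
lra.
Qed.

Lemma cvgU_eq u v l : cvgU u l -> UF [set k | u k = v k] -> cvgU v l.
Proof.
move=> ul uv; apply: cvgU_near ul _ => e e0.
by apply: UF_S uv => k ->; rewrite subrr cabs0.
Qed.

Lemma cvgU_ext u v l : cvgU u l -> u =1 v -> cvgU v l.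
Proof. by move=> ul uv; apply: cvgU_eq ul (UF_T _). Qed.

Lemma cvgU_D u v l m : cvgU u l -> cvgU v m -> cvgU (fun k => u k + v k) (l + m).
Proof.
move=> ul vm e e0; have e2 : 0 < e / 2 by rewrite divr_gt0.
apply: UF_S (UF_I (ul _ e2) (vm _ e2)) => k [h1 h2].
have := cabsD (u k - l) (v k - m).
have -> : u k - l + (v k - m) = u k + v k - (l + m) by ring.
lra.
Qed.

Lemma cvgU_Ml c u l : cvgU u l -> cvgU (fun k => c * u k) (c * l).
Proof.
move=> ul e e0; have c1 : 0 < cabs c + 1 by rewrite ltr_wpDl ?cabs_ge0.
have e2 : 0 < e / (cabs c + 1) by rewrite divr_gt0.
apply: UF_S (ul _ e2) => k; rewrite -mulrBr cabsM ltr_pdivlMr //.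
have := cabs_ge0 (u k - l); have := cabs_ge0 c; nra.
Qed.

Lemma cvgU_N u l : cvgU u l -> cvgU (fun k => - u k) (- l).
Proof.
by move=> /(cvgU_Ml (-1)); rewrite mulN1r => /cvgU_ext; apply=> k; rewrite mulN1r.
Qed.

Lemma cvgU_B u v l m : cvgU u l -> cvgU v m -> cvgU (fun k => u k - v k) (l - m).
Proof. by move=> ul /cvgU_N; apply: cvgU_D. Qed.

Lemma cvgU_M u v l m : cvgU u l -> cvgU v m -> cvgU (fun k => u k * v k) (l * m).
Proof.
move=> ul vm; apply: (@cvgU_near (fun k => l * v k)); first exact: cvgU_Ml.
move=> e e0; have c1 : 0 < cabs m + 1 by rewrite ltr_wpDl ?cabs_ge0.
have e2 : 0 < e / (cabs m + 1) by rewrite divr_gt0.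
apply: UF_S (UF_I (ul _ e2) (vm _ ltr01)) => k [h1 h2].
rewrite -mulrBl cabsM cabsB; rewrite ltr_pdivlMr // in h1.
have := cabsD (v k - m) m; rewrite subrK => h3.
have := cabs_ge0 (u k - l); have := cabs_ge0 (v k); nra.
Qed.

Lemma cvgU_sum (I : Type) (s : seq I) (P : pred I) (G : I -> nat -> C) (L : I -> C) :
  (forall i, P i -> cvgU (G i) (L i)) ->
  cvgU (fun k => \sum_(i <- s | P i) G i k) (\sum_(i <- s | P i) L i).
Proof.
move=> h; elim: s => [|i s IH].
  by rewrite big_nil; apply: cvgU_ext (cvgU_cst 0) _ => k; rewrite big_nil.
rewrite big_cons; case: ifP => Pi.
  by apply: cvgU_ext (cvgU_D (h i Pi) IH) _ => k; rewrite big_cons Pi.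
by apply: cvgU_ext IH _ => k; rewrite big_cons Pi.
Qed.

Lemma cvgU_prod (I : Type) (s : seq I) (P : pred I) (G : I -> nat -> C) (L : I -> C) :
  (forall i, P i -> cvgU (G i) (L i)) ->
  cvgU (fun k => \prod_(i <- s | P i) G i k) (\prod_(i <- s | P i) L i).
Proof.
move=> h; elim: s => [|i s IH].
  by rewrite big_nil; apply: cvgU_ext (cvgU_cst 1) _ => k; rewrite big_nil.
rewrite big_cons; case: ifP => Pi.
  by apply: cvgU_ext (cvgU_M (h i Pi) IH) _ => k; rewrite big_cons Pi.
by apply: cvgU_ext IH _ => k; rewrite big_cons Pi.
Qed.

Lemma cvgU_abs_le u l (c : R) : cvgU u l -> UF [set k | cabs (u k) <= c] -> cabs l <= c.
Proof.
move=> ul uc; rewrite leNgt; apply/negP => cl.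
have e0 : 0 < cabs l - c by rewrite subr_gt0.
have [k [h1 h2]] := UF_ne (UF_I (ul _ e0) uc).
by have := cabsD (u k) (l - u k); rewrite addrC subrK cabsB; lra.
Qed.

Lemma cvgU_unique u l m : cvgU u l -> cvgU u m -> l = m.
Proof.
move=> ul um; have := cvgU_B ul um => h.
have : cabs (l - m) <= 0 by apply: cvgU_abs_le h (UF_T _) => k; rewrite subrr cabs0.
by rewrite le_eqVlt ltNge cabs_ge0 orbF cabs_eq0 subr_eq0 => /eqP.
Qed.

Lemma cvgU_re_le u l (c : R) : cvgU u l -> UF [set k | cre (u k) <= c] -> cre l <= c.
Proof.
move=> ul uc; rewrite leNgt; apply/negP => cl.
have e0 : 0 < cre l - c by rewrite subr_gt0.
have [k [h1 h2]] := UF_ne (UF_I (ul _ e0) uc).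
by have := cre_le (l - u k); rewrite creB cabsB; lra.
Qed.

Lemma cvgU_re_ge u l (c : R) : cvgU u l -> UF [set k | c <= cre (u k)] -> c <= cre l.
Proof.
move=> /cvgU_N ul uc; rewrite -lerN2 -creN; apply: cvgU_re_le ul _.
by apply: UF_S uc => k; rewrite creN lerN2.
Qed.

Lemma cvgU_re u l : cvgU u l -> cvgU (fun k => rval (cre (u k))) (rval (cre l)).
Proof.
move=> ul e e0; apply: UF_S (ul e e0) => k; apply: le_lt_trans.
by rewrite cabs_rvalB -creB cre_abs.
Qed.

Lemma cvgU_abs u l : cvgU u l -> cvgU (fun k => rval (cabs (u k))) (rval (cabs l)).
Proof.
move=> ul e e0; apply: UF_S (ul e e0) => k; apply: le_lt_trans.
rewrite cabs_rvalB ler_norml.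
have := cabsD (u k - l) l; have := cabsD (l - u k) (u k).
by rewrite !subrK (cabsB l) => h1 h2; lra.
Qed.

(** The limit is the supremum [s] of the levels that [r k] reaches for almost all [k]; the
    ultrafilter decides on which side of [s + e / 2] the sequence lies. *)
Lemma cvgU_real_ex (r : nat -> R) (B : R) : (forall k, `|r k| <= B) ->
  exists l, cvgU (fun k => rval (r k)) l.
Proof.
move=> rB; have rB' k : - B <= r k <= B by rewrite -ler_norml.
have [||s [ub lub]] := @reals_sup _ hC (fun t => UF [set k | t <= r k]).
- by exists (- B); apply: UF_T => k; case/andP: (rB' k).
- exists B => t /UF_ne [k tk]; apply: le_trans tk _.
  by case/andP: (rB' k).
exists (rval s) => e e0.
have [h|h] := UF_C (fun k => s + e / 2 <= r k).
  have := ub _ h; have : 0 < e / 2 by rewrite divr_gt0.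
  lra.
have [t tE st] : exists2 t, UF [set k | t <= r k] & s - e / 2 < t.
  apply: contrapT => hn.
  have : s <= s - e / 2.
    apply: lub => t tE; rewrite leNgt; apply/negP => st.
    by apply: hn; exists t.
  have : 0 < e / 2 by rewrite divr_gt0.
  lra.
apply: UF_S (UF_I h tE) => k [/negP]; rewrite -ltNge => h1 h2.
rewrite cabs_rvalB ltr_norml; lra.
Qed.

Lemma cvgU_ex u (B : R) : (forall k, cabs (u k) <= B) -> exists l, cvgU u l.
Proof.
move=> uB.
have [l1 h1] : exists l, cvgU (fun k => rval (cre (u k))) l.
  by apply: (@cvgU_real_ex _ B) => k; apply: le_trans (cre_abs _) (uB k).
have [l2 h2] : exists l, cvgU (fun k => rval (cre (- 'i * u k))) l.
  apply: (@cvgU_real_ex _ B) => k; apply: le_trans (cre_abs _) _.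
  by rewrite cabsM cabsN cabs_i mul1r.
exists (l1 + 'i * l2).
apply: cvgU_ext (cvgU_D h1 (cvgU_Ml 'i h2)) _ => k.
by rewrite -crect.
Qed.

Definition ulim u : C := xget 0 [set l | cvgU u l].

Lemma ulimP u (B : R) : (forall k, cabs (u k) <= B) -> cvgU u (ulim u).
Proof. by move=> /cvgU_ex h; exact: (@xgetPex _ 0 [set l | cvgU u l] h). Qed.

Lemma ulimE u l : cvgU u l -> ulim u = l.
Proof.
move=> ul; have : cvgU u (ulim u) by apply: (@xgetPex _ 0 [set l | cvgU u l]); exists l.
by move/cvgU_unique; apply.
Qed.

End Ultralimits.

(** * Norms and zooms *)

Section MatrixNorms.
Variables (C : numClosedFieldType) (n : nat).
Notation R := (reals C).
Notation V := 'M[C]_n.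
Implicit Types (x y v : V).

(** [nrm] serves for all Lipschitz estimates. [enorm] is the Frobenius norm, with square [sqn] and
    real inner product [ip]; the slope argument needs a norm that comes from an inner product. *)
Definition nrm x : R := \sum_i \sum_j cabs (x i j).
Definition sqn x : R := \sum_i \sum_j cabs (x i j) ^+ 2.
Definition enorm x : R := cabs (sqrtC (rval (sqn x))).
Definition ip x v : R := \sum_i \sum_j cre (x i j * (v i j)^*).

Lemma nrm_ge0 x : 0 <= nrm x.
Proof. by apply: sumr_ge0 => i _; apply: sumr_ge0 => j _; apply: cabs_ge0. Qed.

Lemma nrm0 : nrm 0 = 0.
Proof. by rewrite /nrm big1 // => i _; rewrite big1 // => j _; rewrite mxE cabs0. Qed.

Lemma nrmD x y : nrm (x + y) <= nrm x + nrm y.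
Proof.
rewrite /nrm -big_split /=; apply: ler_sum => i _; rewrite -big_split /=.
by apply: ler_sum => j _; rewrite mxE cabsD.
Qed.

Lemma nrmZ c x : nrm (c *: x) = cabs c * nrm x.
Proof.
rewrite /nrm mulr_sumr; apply: eq_bigr => i _; rewrite mulr_sumr.
by apply: eq_bigr => j _; rewrite mxE cabsM.
Qed.

Lemma nrmN x : nrm (- x) = nrm x.
Proof. by rewrite -scaleN1r nrmZ cabsN cabs1 mul1r. Qed.

Lemma nrmB x y : nrm (x - y) = nrm (y - x).
Proof. by rewrite -nrmN opprB. Qed.

Lemma sum2_ge (G : 'I_n -> 'I_n -> R) i j :
  (forall k l, 0 <= G k l) -> G i j <= \sum_k \sum_l G k l.
Proof.
move=> G0; rewrite (bigD1 i) //= (bigD1 j) //= -addrA lerDl addr_ge0 //.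
  by apply: sumr_ge0.
by apply: sumr_ge0 => k _; apply: sumr_ge0.
Qed.

Lemma entry_le_nrm x i j : cabs (x i j) <= nrm x.
Proof. by apply: (@sum2_ge (fun k l => cabs (x k l))) => k l; apply: cabs_ge0. Qed.

Lemma sqn_ge0 x : 0 <= sqn x.
Proof. by apply: sumr_ge0 => i _; apply: sumr_ge0 => j _; rewrite sqr_ge0. Qed.

Lemma enorm_ge0 x : 0 <= enorm x. Proof. exact: cabs_ge0. Qed.

Lemma enorm_sqr x : enorm x ^+ 2 = sqn x.
Proof.
by rewrite /enorm -cabsX sqrtCK cabs_rval ger0_norm ?sqn_ge0.
Qed.

Lemma sqnZ c x : sqn (c *: x) = cabs c ^+ 2 * sqn x.
Proof.
rewrite /sqn mulr_sumr; apply: eq_bigr => i _; rewrite mulr_sumr.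
by apply: eq_bigr => j _; rewrite mxE cabsM exprMn.
Qed.

Lemma enormZ c x : enorm (c *: x) = cabs c * enorm x.
Proof.
apply: (@pexpIrn _ 2) => //; rewrite ?nnegrE ?mulr_ge0 ?enorm_ge0 ?cabs_ge0 //.
by rewrite exprMn !enorm_sqr sqnZ.
Qed.

Lemma entry_le_enorm x i j : cabs (x i j) <= enorm x.
Proof.
rewrite -(@ler_pXn2r _ 2) ?nnegrE ?cabs_ge0 ?enorm_ge0 // enorm_sqr.
by apply: (@sum2_ge (fun k l => cabs (x k l) ^+ 2)) => k l; apply: sqr_ge0.
Qed.

Lemma nrm_le_enorm x : nrm x <= (n * n)%:R * enorm x.
Proof.
apply: (@le_trans _ _ (\sum_(i < n) \sum_(j < n) enorm x)).
  by apply: ler_sum => i _; apply: ler_sum => j _; apply: entry_le_enorm.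
by rewrite !sumr_const card_ord -mulrnA mulr_natl.
Qed.

Lemma enorm_eq0 x : (enorm x == 0) = (x == 0).
Proof.
apply/eqP/eqP => [x0|->]; last by rewrite -(scale0r 0) enormZ cabs0 mul0r.
apply/matrixP => i j; have := entry_le_enorm x i j.
by rewrite x0 mxE le_eqVlt ltNge cabs_ge0 orbF cabs_eq0 => /eqP.
Qed.

Lemma enorm_delta i j : enorm (delta_mx i j) = 1.
Proof.
apply: (@pexpIrn _ 2) => //; rewrite ?nnegrE ?enorm_ge0 // enorm_sqr expr1n.
rewrite /sqn (bigD1 i) //= (bigD1 j) //= !big1 ?addr0 => [|k ki|l lj].
- by rewrite mxE !eqxx cabs1 expr1n.
- by rewrite big1 // => l _; rewrite mxE (negPf ki) cabs0 expr0n.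
- by rewrite mxE (negPf lj) andbF cabs0 expr0n.
Qed.

Lemma ipD x y v : ip (x + y) v = ip x v + ip y v.
Proof.
rewrite /ip -big_split /=; apply: eq_bigr => i _; rewrite -big_split /=.
by apply: eq_bigr => j _; rewrite mxE mulrDl creD.
Qed.

Lemma ipZ (r : R) x v : ip (rval r *: x) v = r * ip x v.
Proof.
rewrite /ip mulr_sumr; apply: eq_bigr => i _; rewrite mulr_sumr.
by apply: eq_bigr => j _; rewrite mxE -mulrA creZ.
Qed.

Lemma ipN x v : ip (- x) v = - ip x v.
Proof. by have := ipZ (-1) x v; rewrite rmorphN rmorph1 scaleN1r mulN1r. Qed.

Lemma rval_conj (r : R) : (rval r)^* = rval r.
Proof. exact/CrealP/rvalP. Qed.

Lemma sqn_add x v (s : R) :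
  sqn (x + rval s *: v) = sqn x + 2 * s * ip x v + s ^+ 2 * sqn v.
Proof.
rewrite /sqn /ip !mulr_sumr -!big_split /=; apply: eq_bigr => i _.
rewrite !mulr_sumr -!big_split /=; apply: eq_bigr => j _.
rewrite !mxE; set a := x i j; set b := v i j.
rewrite -!cabs_re_conj rmorphD rmorphM /= rval_conj.
have -> : (a + rval s * b) * (a^* + rval s * b^*) =
  a * a^* + (rval s * (a * b^*) + rval s * (b * a^*)) + rval s * (rval s * (b * b^*)) by ring.
rewrite !creD !creZ.
have -> : cre (b * a^*) = cre (a * b^*).
  have -> : b * a^* = (a * b^*)^* by rewrite rmorphM /= conjCK mulrC.
  by apply: val_inj; rewrite /= Re_conj.
ring.
Qed.

(** Replaces the square root by a rational bound which is sharp to first order when [t] is close to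
    [enorm y]. *)
Lemma enorm_le_amgm y (t : R) : 0 < t -> enorm y <= (t ^+ 2 + sqn y) / (2 * t).
Proof.
move=> t0; rewrite ler_pdivlMr ?mulr_gt0 // -enorm_sqr.
have := sqr_ge0 (t - enorm y); nra.
Qed.

Definition lipschitz_nrm (L : R) (F : V -> V) := forall x y, nrm (F x - F y) <= L * nrm (x - y).

Definition zoom (a : V) (s : C) (F : V -> V) : V -> V :=
  fun x => s^-1 *: (F (a + s *: x) - F a).

Lemma zoom0 a s F : zoom a s F 0 = 0.
Proof. by rewrite /zoom scaler0 addr0 subrr scaler0. Qed.

Lemma zoom_lipschitz L a s F : s != 0 -> lipschitz_nrm L F -> lipschitz_nrm L (zoom a s F).
Proof.
move=> s0 FL x y; rewrite /zoom -scalerBr nrmZ opprB addrA subrK cabsV.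
have cs0 : 0 < cabs s by rewrite lt_def cabs_ge0 cabs_eq0 s0.
rewrite mulrC ler_pdivrMr //; apply: le_trans (FL _ _) _.
by rewrite opprD addrACA subrr add0r -scalerBr nrmZ -mulrA (mulrC (cabs s)).
Qed.

Lemma zoom_zoom a s b t F :
  zoom b t (zoom a s F) =1 zoom (a + s *: b) (s * t) F.
Proof.
move=> x; rewrite /zoom -scalerBr scalerA -invfM (mulrC t) opprB addrA subrK.
by rewrite (scalerDr s b) scalerA addrA.
Qed.

End MatrixNorms.

(** * Ultralimits of matrices and of Lipschitz families *)

Section MatrixLimits.
Variables (C : numClosedFieldType) (n : nat).
Hypothesis hC : real_complete C.
Notation R := (reals C).
Notation V := 'M[C]_n.
Implicit Types (u w : nat -> V) (l m : V).

Definition cvgM u l := forall i j, cvgU (fun k => u k i j) (l i j).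

Lemma cvgM_cst l : cvgM (fun=> l) l.
Proof. by move=> i j; apply: cvgU_cst. Qed.

Lemma cvgM_D u w l m : cvgM u l -> cvgM w m -> cvgM (fun k => u k + w k) (l + m).
Proof.
move=> ul wm i j; rewrite mxE; apply: cvgU_ext (cvgU_D (ul i j) (wm i j)) _ => k.
by rewrite mxE.
Qed.

Lemma cvgM_Z c u l : cvgM u l -> cvgM (fun k => c *: u k) (c *: l).
Proof.
move=> ul i j; rewrite mxE; apply: cvgU_ext (cvgU_Ml c (ul i j)) _ => k.
by rewrite mxE.
Qed.

Lemma cvgM_B u w l m : cvgM u l -> cvgM w m -> cvgM (fun k => u k - w k) (l - m).
Proof.
move=> ul /(cvgM_Z (-1)); rewrite scaleN1r => /(cvgM_D ul) h i j.
by apply: cvgU_ext (h i j) _ => k; rewrite scaleN1r.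
Qed.

Lemma cvgM_eq u w l : cvgM u l -> UF [set k | u k = w k] -> cvgM w l.
Proof. by move=> ul uw i j; apply: cvgU_eq (ul i j) _; apply: UF_S uw => k ->. Qed.

Lemma cvgM_ext u w l : cvgM u l -> u =1 w -> cvgM w l.
Proof. by move=> ul uw; apply: cvgM_eq ul (UF_T _). Qed.

Lemma cvgM_unique u l m : cvgM u l -> cvgM u m -> l = m.
Proof. by move=> ul um; apply/matrixP => i j; apply: cvgU_unique (ul i j) (um i j). Qed.

Lemma cvgM_nrm u l : cvgM u l -> cvgU (fun k => rval (nrm (u k))) (rval (nrm l)).
Proof.
move=> ul; rewrite /nrm rmorph_sum /=.
have h i : cvgU (fun k => \sum_j rval (cabs (u k i j))) (\sum_j rval (cabs (l i j))).
  by apply: cvgU_sum => j _; apply: cvgU_abs.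
rewrite [X in cvgU _ X](_ : _ = \sum_i \sum_j rval (cabs (l i j))); last first.
  by apply: eq_bigr => i _; rewrite rmorph_sum.
apply: cvgU_ext (cvgU_sum _ (fun i _ => h i)) _ => k.
by rewrite rmorph_sum; apply: eq_bigr => i _; rewrite rmorph_sum.
Qed.

Lemma cvgM_sqn u l : cvgM u l -> cvgU (fun k => rval (sqn (u k))) (rval (sqn l)).
Proof.
move=> ul; rewrite /sqn rmorph_sum /=.
have h i : cvgU (fun k => \sum_j rval (cabs (u k i j)) * rval (cabs (u k i j)))
    (\sum_j rval (cabs (l i j)) * rval (cabs (l i j))).
  by apply: cvgU_sum => j _; apply: cvgU_M; apply: cvgU_abs.
rewrite [X in cvgU _ X](_ : _ = \sum_i \sum_j rval (cabs (l i j)) * rval (cabs (l i j))); last first.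
  by apply: eq_bigr => i _; rewrite rmorph_sum.
apply: cvgU_ext (cvgU_sum _ (fun i _ => h i)) _ => k.
by rewrite rmorph_sum; apply: eq_bigr => i _; rewrite rmorph_sum.
Qed.

Lemma cvgU_le (r t : nat -> R) (a b : R) :
  cvgU (fun k => rval (r k)) (rval a) -> cvgU (fun k => rval (t k)) (rval b) ->
  UF [set k | r k <= t k] -> a <= b.
Proof.
move=> ra tb rt; rewrite -subr_le0 -cre_rvalB.
apply: cvgU_re_le (cvgU_B ra tb) _; apply: UF_S rt => k rtk /=.
by rewrite cre_rvalB subr_le0.
Qed.

Lemma cvgM_nrm_le u l (c : R) : cvgM u l -> UF [set k | nrm (u k) <= c] -> nrm l <= c.
Proof. 
move=> /cvgM_nrm ul uc.
exact: (@cvgU_le (fun k => nrm (u k)) (fun=> c) _ _ ul (cvgU_cst _) uc). Qed.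

Lemma cvgM_dist u l (e : R) : cvgM u l -> 0 < e -> UF [set k | nrm (u k - l) < e].
Proof.
move=> ul e0; have := cvgM_nrm (cvgM_B ul (cvgM_cst l)); rewrite subrr nrm0 => /(_ _ e0).
by apply: UF_S => k; rewrite rmorph0 subr0 cabs_rval ger0_norm ?nrm_ge0.
Qed.

Lemma cvgM_near u w l : cvgM u l ->
  (forall e : R, 0 < e -> UF [set k | nrm (u k - w k) < e]) -> cvgM w l.
Proof.
move=> ul h i j; apply: cvgU_near (ul i j) _ => e e0; apply: UF_S (h e e0) => k.
by apply: le_lt_trans; have := entry_le_nrm (u k - w k) i j; rewrite !mxE.
Qed.

Definition mlim u : V := \matrix_(i, j) ulim (fun k => u k i j).

Lemma mlimP u (B : R) : (forall k, nrm (u k) <= B) -> cvgM u (mlim u).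
Proof.
move=> uB i j; rewrite mxE; apply: (ulimP hC (B := B)) => k.
exact: le_trans (entry_le_nrm _ _ _) (uB k).
Qed.

Definition flim (F : nat -> V -> V) : V -> V := fun x => mlim (fun k => F k x).

Section LipschitzFamily.
Variables (L : R) (F : nat -> V -> V).
Hypothesis F0 : forall k, F k 0 = 0.
Hypothesis FL : forall k, lipschitz_nrm L (F k).

Lemma lip_bound k x : nrm (F k x) <= L * nrm x.
Proof. by have := FL k x 0; rewrite F0 !subr0. Qed.

Lemma flimP x : cvgM (F^~ x) (flim F x).
Proof. by apply: (@mlimP _ (L * nrm x)) => k; apply: lip_bound. Qed.

Lemma flim0 : flim F 0 = 0.
Proof.
by apply: cvgM_unique (flimP 0) _; apply: cvgM_ext (cvgM_cst 0) _ => k; rewrite F0.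
Qed.

Lemma flim_lipschitz : lipschitz_nrm L (flim F).
Proof.
move=> x y; apply: cvgM_nrm_le (cvgM_B (flimP x) (flimP y)) _.
by apply: UF_T => k; apply: FL.
Qed.

(** The common Lipschitz constant permits evaluation at moving points. *)
Lemma flim_app z l : cvgM z l -> cvgM (fun k => F k (z k)) (flim F l).
Proof.
move=> zl; apply: cvgM_near (flimP l) _ => e e0.
have L1 : 0 < `|L| + 1 by rewrite ltr_wpDl.
have e1 : 0 < e / (`|L| + 1) by rewrite divr_gt0.
apply: UF_S (cvgM_dist zl e1) => k; rewrite ltr_pdivlMr // nrmB => h.
have := FL k l (z k); have := nrm_ge0 (l - z k); have := ler_norm L.
have := normr_ge0 L; nra.
Qed.

End LipschitzFamily.
End MatrixLimits.

(** * Additive members of zoom-closed classes *)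

Section DyadicScaling.
Variable C : numClosedFieldType.
Hypothesis hC : real_complete C.
Notation R := (reals C).

Lemma cabs_exp_half j : cabs (2^-1 ^+ j : C) = 2^-1 ^+ j.
Proof. by rewrite cabsX cabsV cabs_nat. Qed.

Lemma rval_exp_half j : rval (2^-1 ^+ j : R) = 2^-1 ^+ j.
Proof. by rewrite (rmorphXn (@rval C)) (fmorphV (@rval C)) (rmorph_nat (@rval C)). Qed.

Lemma exp_half_neq0 (F : numFieldType) j : (2^-1 ^+ j : F) != 0.
Proof. by rewrite expf_neq0 // invr_neq0 // pnatr_eq0. Qed.

Lemma exp_half_gt0 (F : numFieldType) j : 0 < (2^-1 ^+ j : F).
Proof. by rewrite exprn_gt0 // invr_gt0. Qed.

Lemma exp_half_inv (F : numFieldType) j : (2^-1 ^+ j : F)^-1 = 2 ^+ j.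
Proof. by rewrite exprVn invrK. Qed.

Lemma dyadic_normalize (t : R) : 0 < t -> t <= 1 -> exists j : nat, 1 <= 2 ^+ j * t <= 2.
Proof.
move=> t0 t1; have ex : exists j : nat, 1 <= 2 ^+ j * t.
  have [N /(_ N (leqnn N)) h] := half_expr_small hC t0; exists N.
  by rewrite -exp_half_inv mulrC ler_pdivlMr ?exp_half_gt0 // mul1r ltW.
have /ex_minnP [j j1 jmin] := ex; exists j; rewrite j1 /=.
case: j j1 jmin => [|j] j1 jmin; first by rewrite mul1r; lra.
have : 2 ^+ j * t < 1 by rewrite ltNge; apply/negP => /jmin; rewrite ltnn.
by rewrite exprS; lra.
Qed.

Lemma two_expr_ge (t : R) : exists p : nat, t <= 2 ^+ p.
Proof.
have [N hN] := reals_archi hC t; exists N; apply: le_trans (ltW hN) _.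
by rewrite -natrX ler_nat ltnW // ltn_expl.
Qed.

End DyadicScaling.

Section LinearMember.
Variables (C : numClosedFieldType) (n : nat).
Hypothesis hC : real_complete C.
Notation R := (reals C).
Notation V := 'M[C]_n.
Variables (L C0 : R).
Hypothesis C0_ge0 : 0 <= C0.

Definition entry_re (c : C) (i j : 'I_n) (y : V) : R := cre (c * y i j).

Lemma entry_reD c i j x y : entry_re c i j (x + y) = entry_re c i j x + entry_re c i j y.
Proof. by rewrite /entry_re mxE mulrDr creD. Qed.
Lemma entry_reN c i j x : entry_re c i j (- x) = - entry_re c i j x.
Proof. by rewrite /entry_re mxE mulrN creN. Qed.
Lemma entry_reB c i j x y : entry_re c i j (x - y) = entry_re c i j x - entry_re c i j y.
Proof. by rewrite entry_reD entry_reN. Qed.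
Lemma entry_reZ c i j (r : R) x : entry_re c i j (rval r *: x) = r * entry_re c i j x.
Proof. by rewrite /entry_re mxE mulrCA creZ. Qed.
Lemma entry_re_le c i j x : entry_re c i j x <= cabs c * nrm x.
Proof.
apply: le_trans (cre_le _) _; rewrite cabsM ler_wpM2l ?cabs_ge0 //.
exact: entry_le_nrm.
Qed.
Lemma cvgM_entry_re c i j u l : cvgM u l ->
  cvgU (fun k => rval (entry_re c i j (u k))) (rval (entry_re c i j l)).
Proof. by move=> ul; apply/cvgU_re/cvgU_Ml/ul. Qed.

(** A zoom is required not at every point but only at some centre within a fixed multiple of the
    scale: maximality will be inherited only at lattice points. *)
Record blowup_class (G : (V -> V) -> Prop) : Prop := BlowupClass {
  blowup_0 : forall F, G F -> F 0 = 0;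
  blowup_lip : forall F, G F -> lipschitz_nrm L F;
  blowup_lim : forall F : nat -> V -> V, (forall k, G (F k)) -> G (flim F);
  blowup_zoom : forall (x : V) (j : nat), exists2 a, nrm (x - a) <= C0 * 2^-1 ^+ j &
    forall F, G F -> G (zoom a (2^-1 ^+ j) F) }.

Section Step.
Variables (G : (V -> V) -> Prop).
Hypothesis GB : blowup_class G.
Variables (c : C) (i j : 'I_n).
Let f (F : V -> V) x : R := entry_re c i j (F x).

Lemma entry_re_zoom a m F x : f (zoom a (2^-1 ^+ m) F) x = 2 ^+ m * (f F (a + 2^-1 ^+ m *: x) - f F a).
Proof.
rewrite /f /zoom exp_half_inv (_ : 2 ^+ m = rval (2 ^+ m : R)) ?entry_reZ ?entry_reB //.
by rewrite (rmorphXn (@rval C)) (rmorph_nat (@rval C)).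
Qed.

Lemma entry_re_lip F x y : G F -> f F x - f F y <= cabs c * L * nrm (x - y).
Proof.
move=> GF; rewrite /f -entry_reB; apply: le_trans (entry_re_le _ _ _ _) _.
by rewrite -mulrA ler_wpM2l ?cabs_ge0 //; apply: (blowup_lip GB GF).
Qed.

(** [M] is the supremum of slopes over a normalised range of base points and increments. Short
    increments are brought into this range by a zoom, long ones by repeated halving, so [M] bounds
    all slopes; near-maximal slopes thus occur in a bounded range. *)
Lemma slope_sup F0 : G F0 -> exists M : R, [/\ 0 <= M,
  (forall F x v, G F -> f F (x + v) - f F x <= M * enorm v) &
  (forall e, 0 < e -> exists F x v,
    [/\ G F, nrm x <= C0, 1 <= enorm v <= 2 & (M - e) * enorm v <= f F (x + v) - f F x])].
Proof.
move=> GF0.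
pose E m := exists F x v, [/\ G F, nrm x <= C0, 1 <= enorm v <= 2 & m * enorm v <= f F (x + v) - f F x].
have [||M [Mub Mlub]] := @reals_sup _ hC E.
- exists (f F0 (0 + delta_mx i j) - f F0 0), F0, 0, (delta_mx i j).
  by rewrite nrm0 enorm_delta; split=> //; rewrite ?mulr1 ?lexx //=; lra.
- exists (cabs c * `|L| * (n * n)%:R) => m [F [x [v [GF _ /andP[v1 _] mv]]]].
  have v0 : 0 < enorm v by lra.
  rewrite -(ler_pM2r v0); apply: le_trans mv _; apply: le_trans (entry_re_lip _ _ GF) _.
  rewrite addrAC subrr add0r -!mulrA ler_wpM2l ?cabs_ge0 //.
  apply: le_trans (ler_wpM2r (nrm_ge0 _) (ler_norm L)) _.
  by rewrite ler_wpM2l // nrm_le_enorm.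
have near F x v : G F -> nrm x <= C0 -> 1 <= enorm v <= 2 -> f F (x + v) - f F x <= M * enorm v.
  move=> GF xC vN; have v0 : 0 < enorm v by lra.
  rewrite -ler_pdivrMr //; apply: Mub; exists F, x, v; split=> //.
  by rewrite divfK // gt_eqF.
have small F x v : G F -> 0 < enorm v -> enorm v <= 1 -> f F (x + v) - f F x <= M * enorm v.
  move=> GF v0 v1; have [m mv] := dyadic_normalize hC v0 v1.
  have [a xa aG] := blowup_zoom GB x m.
  have two0 : (0 : R) < 2 ^+ m by rewrite exprn_gt0.
  have h2 : 2^-1 ^+ m * 2 ^+ m = 1 :> C by rewrite -exp_half_inv mulfV // exp_half_neq0.
  have ey : nrm (2 ^+ m *: (x - a)) <= C0.
    rewrite nrmZ cabsX cabs_nat mulrC -ler_pdivlMr //.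
    by rewrite -exprVn.
  have ev : enorm (2 ^+ m *: v) = 2 ^+ m * enorm v by rewrite enormZ cabsX cabs_nat.
  have := near _ _ (2 ^+ m *: v) (aG F GF) ey; rewrite ev => /(_ mv).
  rewrite !entry_re_zoom !scalerDr !scalerA h2 !scale1r addrA (addrC a) subrK.
  rewrite -mulrBr opprB addrA subrK mulrCA ler_pM2l //.
have halving F v : G F -> (forall x, f F (x + 2^-1 *: v) - f F x <= M * enorm (2^-1 *: v)) ->
    forall x, f F (x + v) - f F x <= M * enorm v.
  move=> GF h x; have := h x; have := h (x + 2^-1 *: v).
  rewrite -addrA -scalerDl (_ : 2^-1 + 2^-1 = 1 :> C); last by field.
  by rewrite scale1r enormZ cabsV cabs_nat; lra.
have slope F x v : G F -> f F (x + v) - f F x <= M * enorm v.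
  move=> GF; have [->|v0] := eqVneq v 0.
    by rewrite addr0 subrr -(scale0r 0) enormZ cabs0 mul0r mulr0.
  have [p hp] := two_expr_ge hC (enorm v).
  elim: p v v0 hp x => [|p IH] v v0 hp x.
    by apply: small => //; rewrite lt_def enorm_eq0 v0 enorm_ge0.
  apply: halving => // y; apply: IH.
    by rewrite scaler_eq0 negb_or v0 invr_eq0 pnatr_eq0.
  by rewrite enormZ cabsV cabs_nat; move: hp; rewrite exprS; lra.
exists M; split=> //.
  have := slope F0 0 (delta_mx i j) GF0; have := slope F0 (delta_mx i j) (- delta_mx i j) GF0.
  by rewrite subrr add0r -scaleN1r enormZ cabsN cabs1 enorm_delta; lra.
move=> e e0; apply: contrapT => hn.
have : M <= M - e; last lra.
apply: Mlub => m [F [x [v [GF xC vN mv]]]]; rewrite leNgt; apply/negP => mM.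
apply: hn; exists F, x, v; split=> //; apply: le_trans mv.
by rewrite ler_wpM2r ?enorm_ge0 // ltW.
Qed.

Lemma inv_nat_gt0 k : (0 : R) < k.+1%:R^-1.
Proof. by rewrite invr_gt0 ltr0Sn. Qed.

Lemma UF_inv_nat (e : R) : 0 < e -> UF [set k | k.+1%:R^-1 < e].
Proof.
move=> e0; have [N hN] := reals_archi hC e^-1; apply: (@UF_ev N) => k Nk.
rewrite invf_plt ?posrE ?ltr0Sn //; apply: lt_trans hN _.
by rewrite ltr_nat ltnS.
Qed.

(** Near-maximal triples are bounded and have an ultralimit; the lower bound 1 on the increments
    keeps the limiting direction nonzero. *)
Lemma slope_attained F0 : G F0 -> exists M F x v,
  [/\ 0 <= M, (forall F x v, G F -> f F (x + v) - f F x <= M * enorm v), G F,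
      0 < enorm v & M * enorm v <= f F (x + v) - f F x].
Proof.
move=> GF0; have [M [M0 slope near]] := slope_sup GF0.
have /choice [T TP] : forall k : nat, exists t : (V -> V) * V * V,
    [/\ G t.1.1, nrm t.1.2 <= C0, 1 <= enorm t.2 <= 2 &
      (M - k.+1%:R^-1) * enorm t.2 <= f t.1.1 (t.1.2 + t.2) - f t.1.1 t.1.2].
  move=> k; have [F [x [v h]]] := near _ (inv_nat_gt0 k); by exists (F, x, v).
pose F k := (T k).1.1; pose x k := (T k).1.2; pose v k := (T k).2.
have GF k : G (F k) by case: (TP k).
have F0' k := blowup_0 GB (GF k); have FL k := blowup_lip GB (GF k).
have xl : cvgM x (mlim x) by apply: (mlimP hC (B := C0)) => k; case: (TP k).
have vl : cvgM v (mlim v).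
  apply: (mlimP hC (B := (n * n)%:R * 2)) => k; apply: le_trans (nrm_le_enorm _) _.
  by rewrite ler_wpM2l //; case: (TP k) => _ _ /andP[].
have el : cvgU (fun k => rval (enorm (v k))) (rval (enorm (mlim v))).
  move=> e e0; apply: UF_S (cvgM_sqn vl e0) => k; rewrite !cabs_rvalB.
  rewrite -!enorm_sqr subr_sqr normrM => h.
  apply: le_lt_trans h; have := normr_ge0 (enorm (v k) - enorm (mlim v)).
  rewrite [X in _ -> _ <= _ * X]ger0_norm ?addr_ge0 ?enorm_ge0 //.
  have := enorm_ge0 (mlim v); case: (TP k) => _ _ /andP[h1 _] _.
  by rewrite -/(v k) in h1 *; nra.
have v1 : 1 <= enorm (mlim v).
  apply: (cvgU_le (r := fun=> 1) (cvgU_cst _) el); apply: UF_T => k.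
  by case: (TP k) => _ _ /andP[].
exists M, (flim F), (mlim x), (mlim v); split=> //.
- exact: (blowup_lim GB).
- lra.
have dl : cvgU (fun k => rval (M * enorm (v k)) - (rval (f (F k) (x k + v k)) - rval (f (F k) (x k))))
   (rval (M * enorm (mlim v)) - (rval (f (flim F) (mlim x + mlim v)) - rval (f (flim F) (mlim x)))).
  apply: cvgU_B; last apply: cvgU_B.
  - rewrite rvalM; apply: cvgU_ext (cvgU_Ml (rval M) el) _ => k.
    by rewrite rvalM.
  - by apply: cvgM_entry_re; apply: (flim_app hC F0' FL (cvgM_D xl vl)).
  - by apply: cvgM_entry_re; apply: (flim_app hC F0' FL xl).
have h e : 0 < e -> cre (rval (M * enorm (mlim v)) -
    (rval (f (flim F) (mlim x + mlim v)) - rval (f (flim F) (mlim x)))) <= 2 * e.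
  move=> e0; apply: cvgU_re_le dl _; apply: UF_S (UF_inv_nat e0) => k ke.
  rewrite !creB !cre_rval; case: (TP k) => _ _ /andP[_ h2] h3.
  rewrite -/(F k) -/(x k) -/(v k) in h2 h3.
  have := ler_wpM2r (ltW (inv_nat_gt0 k)) h2.
  by move: (k.+1%:R^-1) ke h3 => d ke h3 h4; lra.
rewrite -subr_le0; apply/ler_addgt0Pr => e e0; rewrite add0r.
have := h (e / 2); rewrite !creB !cre_rval (_ : 2 * (e / 2) = e); last by field.
by apply; rewrite divr_gt0.
Qed.

(** A maximal slope over a segment forces the maximal slope on each of its parts. Zooming at the
    midpoint lengthens the segment, and in the limit it becomes a whole line. *)
Lemma linear_along_line F0 : G F0 -> exists M F u v,
  [/\ 0 <= M, (forall F x v, G F -> f F (x + v) - f F x <= M * enorm v), G F,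
      0 < enorm v & forall t : R, f F (u + rval t *: v) - f F u = t * (M * enorm v)].
Proof.
move=> GF0; have [M [F [x [v [M0 slope GF v0 Mv]]]]] := slope_attained GF0.
have seg (t : R) : 0 <= t <= 1 -> f F (x + rval t *: v) = f F x + t * (M * enorm v).
  move=> /andP[t0 t1]; have := slope F x (rval t *: v) GF.
  have := slope F (x + rval t *: v) (rval (1 - t) *: v) GF.
  have tt : t + (1 - t) = 1 by ring.
  rewrite -addrA -scalerDl -rvalD tt rval1 scale1r.
  rewrite !enormZ !cabs_rval !ger0_norm ?subr_ge0 // => h1 h2.
  have e1 : M * ((1 - t) * enorm v) = M * enorm v - t * (M * enorm v) by ring.
  have e2 : M * (t * enorm v) = t * (M * enorm v) by ring.
  rewrite e1 in h1; rewrite e2 in h2; apply/eqP; rewrite eq_le; apply/andP; split.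
    lra.
  lra.
pose p := x + rval (1 / 2) *: v.
have line (t : R) : `|t| <= 1 / 2 -> f F (p + rval t *: v) - f F p = t * (M * enorm v).
  rewrite ler_norml => ht; rewrite /p -addrA -scalerDl -rvalD !seg; [ring|lra|lra].
have /choice [a aP] : forall k, exists a, nrm (p - a) <= C0 * 2^-1 ^+ k /\
    forall F, G F -> G (zoom a (2^-1 ^+ k) F).
  by move=> k; have [a] := blowup_zoom GB p k; exists a.
(* The midpoint [p] in the coordinates of the zoom centred at [a k]; it stays bounded although it
   need not be the centre. *)
pose u k := 2 ^+ k *: (p - a k).
have ub k : nrm (u k) <= C0.
  rewrite /u nrmZ cabsX cabs_nat mulrC -ler_pdivlMr ?exprn_gt0 // -exprVn.
  by case: (aP k).
pose Fk k := zoom (a k) (2^-1 ^+ k) F.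
have GFk k : G (Fk k) by apply: (aP k).2.
have F0' k := blowup_0 GB (GFk k); have FL k := blowup_lip GB (GFk k).
have ul := mlimP hC ub.
exists M, (flim Fk), (mlim u), v; split=> //; first exact: (blowup_lim GB).
move=> t.
have h2 k : 2^-1 ^+ k * 2 ^+ k = 1 :> C by rewrite -exp_half_inv mulfV // exp_half_neq0.
have eqk : UF [set k | f (Fk k) (u k + rval t *: v) - f (Fk k) (u k) = t * (M * enorm v)].
  have t1 : 0 < (2 * (`|t| + 1))^-1 by rewrite invr_gt0 mulr_gt0 // ltr_wpDl.
  have [N hN] := half_expr_small hC t1.
  apply: (@UF_ev N) => k Nk; have tk := hN k Nk.
  rewrite !entry_re_zoom -mulrBr opprB addrA subrK /u scalerDr !scalerA h2 scale1r.
  rewrite addrA (addrC (a k)) subrK.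
  have -> : 2^-1 ^+ k * rval t = rval (2^-1 ^+ k * t) by rewrite rvalM rval_exp_half.
  rewrite line; first by rewrite !mulrA -exprMn mulfV ?pnatr_eq0 // expr1n mul1r.
  rewrite normrM ger0_norm ?ltW ?exp_half_gt0 //.
  rewrite -[X in _ < X]div1r ltr_pdivlMr ?mulr_gt0 ?ltr_wpDl // in tk.
  have := exp_half_gt0 R k; lra.
have d1 : cvgU (fun k => rval (f (Fk k) (u k + rval t *: v)) - rval (f (Fk k) (u k)))
    (rval (f (flim Fk) (mlim u + rval t *: v)) - rval (f (flim Fk) (mlim u))).
  apply: cvgU_B; apply: cvgM_entry_re; apply: (flim_app hC F0' FL) => //.
  by apply: cvgM_D => //; apply: cvgM_cst.
apply: (can_inj (@cre_rval C)); rewrite rvalB.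
apply: (cvgU_unique d1); apply: cvgU_eq (cvgU_cst _) _.
by apply: UF_S eqk => k <-; rewrite rvalB.
Qed.

(* A Lipschitz function attaining its Euclidean slope along a whole line is affine. *)
Lemma linear_step F0 : G F0 -> exists (l : V -> R) F,
  [/\ forall x y, l (x + y) = l x + l y, forall (r : R) x, l (rval r *: x) = r * l x,
      G F & forall x, f F x = l x].
Proof.
move=> GF0; have [M [F [u [v [M0 slope GF v0 line]]]]] := linear_along_line GF0.
exists (fun x => M / enorm v * ip x v), F; split=> //.
- by move=> x y; rewrite ipD mulrDr.
- by move=> r x; rewrite ipZ mulrCA.
set N := enorm v in v0 line *.
have affine y : f F (u + y) - f F u = M / N * ip y v.
  have qE (s : R) : sqn (y + rval s *: v) = sqn y + 2 * s * ip y v + s ^+ 2 * N ^+ 2.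
    by rewrite sqn_add enorm_sqr.
  (* Compare [F (u + y)] with the values at [u - s v] and [u + s v], known from the line. The
     distances are [s N], plus or minus [ip y v / N], up to an error of order [1 / s]; letting [s]
     grow gives equality. *)
  have key (s : R) : 0 < s ->
      f F (u + y) - f F u <= M / N * ip y v + M * sqn y / (2 * N) / s /\
      M / N * ip y v - M * sqn y / (2 * N) / s <= f F (u + y) - f F u.
    move=> s0; have sN : 0 < s * N by rewrite mulr_gt0.
    have := slope F (u + rval (- s) *: v) (y + rval s *: v) GF.
    have := slope F (u + y) (rval s *: v - y) GF.
    have -> : u + rval (- s) *: v + (y + rval s *: v) = u + y.
      by rewrite rvalN scaleNr /= addrACA addNr addr0.
    have -> : u + y + (rval s *: v - y) = u + rval s *: v.
      by rewrite addrACA subrr addr0.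
    have := line s; have := line (- s) => l1 l2 h1 h2.
    have b2 := ler_wpM2l M0 (enorm_le_amgm (y + rval s *: v) sN).
    have b1 := ler_wpM2l M0 (enorm_le_amgm (rval s *: v - y) sN).
    rewrite qE in b2.
    have eq1 : sqn (rval s *: v - y) = sqn y - 2 * s * ip y v + s ^+ 2 * N ^+ 2.
      have -> : rval s *: v - y = - (y + rval (- s) *: v).
        by rewrite rvalN scaleNr opprD opprK addrC.
      rewrite -scaleN1r sqnZ cabsN cabs1 expr1n mul1r sqn_add sqrrN -(enorm_sqr v) -/N.
      ring.
    rewrite eq1 in b1.
    have e1 : M * (((s * N) ^+ 2 + (sqn y - 2 * s * ip y v + s ^+ 2 * N ^+ 2)) / (2 * (s * N))) =
       s * (M * N) - M / N * ip y v + M * sqn y / (2 * N) / s.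
      by field; rewrite !gt_eqF.
    have e2 : M * (((s * N) ^+ 2 + (sqn y + 2 * s * ip y v + s ^+ 2 * N ^+ 2)) / (2 * (s * N))) =
       s * (M * N) + M / N * ip y v + M * sqn y / (2 * N) / s.
      by field; rewrite !gt_eqF.
    rewrite e1 in b1; rewrite e2 in b2; split; lra.
  apply/eqP; rewrite eq_le; apply/andP; split.
    apply: (@le_of_inv_nat _ hC _ _ (M * sqn y / (2 * N))) => k.
    by case: (key k.+1%:R (ltr0Sn _ _)).
  apply: (@le_of_inv_nat _ hC _ _ (M * sqn y / (2 * N))) => k.
  by rewrite -lerBlDr; case: (key k.+1%:R (ltr0Sn _ _)).
have f0 : f F 0 = 0 by rewrite /f (blowup_0 GB GF) /entry_re mxE mulr0 cre0.
move=> x; have := affine (x - u); have := affine (- u).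
have -> : u + (x - u) = x by rewrite addrC subrK.
by rewrite subrr f0 ipD !ipN; lra.
Qed.

End Step.

(** Prescribing a coordinate as a real linear function leaves a blow-up class, so the real
    coordinates can be linearised one after another. *)
Lemma blowup_restrict G (c : C) i j (l : V -> R) : blowup_class G ->
  (forall x y, l (x + y) = l x + l y) -> (forall (r : R) x, l (rval r *: x) = r * l x) ->
  blowup_class (fun F => G F /\ forall x, entry_re c i j (F x) = l x).
Proof.
move=> GB lD lZ; split.
- by move=> F [GF _]; apply: (blowup_0 GB).
- by move=> F [GF _]; apply: (blowup_lip GB).
- move=> F GF; split; first by apply: (blowup_lim GB) => k; case: (GF k).
  move=> x; apply: (can_inj (@cre_rval C)).
  have F0 k : F k 0 = 0 by apply: (blowup_0 GB (GF k).1).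
  have FL k : lipschitz_nrm L (F k) by apply: (blowup_lip GB (GF k).1).
  apply: (cvgU_unique (cvgM_entry_re c i j (flimP hC F0 FL x))).
  by apply: cvgU_ext (cvgU_cst _) _ => k; rewrite (GF k).2.
- move=> x m; have [a xa aG] := blowup_zoom GB x m; exists a => // F [GF Fl].
  split; first exact: aG.
  move=> y; have := @entry_re_zoom c i j a m F y; rewrite /= => ->.
  rewrite !Fl lD addrAC subrr add0r -rval_exp_half lZ mulrA -exprMn mulfV ?pnatr_eq0 //.
  by rewrite expr1n mul1r.
Qed.

Lemma exists_additive_member G : blowup_class G -> (exists F, G F) ->
  exists2 F, G F & forall x y, F (x + y) = F x + F y.
Proof.
move=> GB exG.
(* The factors [1] and [- 'i] yield the real and the imaginary part of each entry. *)
have [F GF Fadd] : exists2 F, G F & forall t,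
    t \in [seq (c, ij) | c <- [:: 1; - 'i], ij <- enum (@predT ('I_n * 'I_n)%type)] ->
    forall x y, entry_re t.1 t.2.1 t.2.2 (F (x + y)) =
      entry_re t.1 t.2.1 t.2.2 (F x) + entry_re t.1 t.2.1 t.2.2 (F y).
  set s := [seq _ | _ <- _, _ <- _]; elim: s G GB exG => [|[c [i j]] s IH] G GB [F0 GF0].
    by exists F0.
  have [l [F [lD lZ GF Fl]]] := linear_step GB c i j GF0.
  have [|F' [GF' Fl'] F'add] := IH _ (blowup_restrict c i j GB lD lZ).
    by exists F.
  exists F' => // t; rewrite inE => /orP[/eqP->|]; last exact: F'add.
  by move=> x y /=; rewrite !Fl' lD.
exists F => // x y; apply/matrixP => i j; rewrite mxE.
have memb (c : C) : c \in [:: 1; - 'i] ->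
    (c, (i, j)) \in [seq (c, ij) | c <- [:: 1; - 'i], ij <- enum (@predT ('I_n * 'I_n)%type)].
  by move=> cs; apply: allpairs_f => //; rewrite mem_enum.
have h1 := Fadd _ (memb 1 (mem_head _ _)) x y.
have h2 := Fadd _ (memb (- 'i) _) x y.
rewrite [LHS]crect [RHS]crect; congr (rval _ + 'i * rval _).
  by move: h1; rewrite /entry_re /= !mul1r -creD.
have in2 : - 'i \in [:: 1; - 'i : C] by rewrite !inE eqxx orbT.
by have := h2 in2; rewrite /entry_re /= -creD -mulrDr.
Qed.

End LinearMember.

(** * Riemann sums over squares and boxes *)

Section SegmentAverages.
Variables (C : numClosedFieldType) (n : nat).
Notation R := (reals C).
Notation V := 'M[C]_n.
Implicit Types (g h : V -> C) (b w x y : V) (s : seq V).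

Definition lipC (L : R) g := forall x y, cabs (g x - g y) <= L * nrm (x - y).

(* The left Riemann sum of [g] with 2^k nodes on the segment [x, x + b]. *)
Fixpoint av (k : nat) b g x : C :=
  if k is m.+1 then 2^-1 * (av m (2^-1 *: b) g x + av m (2^-1 *: b) g (x + 2^-1 *: b))
  else g x.

(** A Riemann sum for the mean of [g] over the parallelepiped at the given point with edges [s]. *)
Definition avl k s g : V -> C := foldr (fun b h => av k b h) g s.

(** The mean over the vertices of that parallelepiped. *)
Fixpoint corner_av s g x : C :=
  if s is b :: s' then 2^-1 * (corner_av s' g x + corner_av s' g (x + b)) else g x.

(* [- 'i] times a Riemann sum for the integral of [g (x + z w) dz] over the
   boundary of the unit square. *)
Definition square_defect k w g x : C :=
  av k ('i *: w) g (x + w) - av k ('i *: w) g x +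
  'i * (av k w g (x + 'i *: w) - av k w g x).

Definition halves s := [seq 2^-1 *: b | b <- s].

Lemma av_affine k b g h (a : V) (t c d : C) x : (forall y, h y = d * (g (a + t *: y) - c)) ->
  av k b h x = d * (av k (t *: b) g (a + t *: x) - c).
Proof.
move=> E; elim: k b x => [|k IH] b x //=; rewrite !IH scalerDr addrA.
by rewrite [t *: (_ *: _)]scalerA (mulrC t) -scalerA; field.
Qed.

Lemma av_ext k b g h x : g =1 h -> av k b g x = av k b h x.
Proof. by move=> gh; elim: k b x => [|k IH] b x //=; rewrite !IH. Qed.

Lemma av_lin2 k b g h (c d : C) x :
  av k b (fun y => c * g y + d * h y) x = c * av k b g x + d * av k b h x.
Proof. by elim: k b x => [|k IH] b x //=; rewrite !IH; ring. Qed.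

Lemma av_shift k b g a x : av k b (fun y => g (y + a)) x = av k b g (x + a).
Proof. by elim: k b x => [|k IH] b x //=; rewrite !IH addrAC. Qed.

Lemma cabs_half : cabs (2^-1 : C) = 2^-1.
Proof. by rewrite cabsV cabs_nat. Qed.

Lemma cabs_mean (a b c d : C) :
  cabs (2^-1 * (a + b) - 2^-1 * (c + d)) <= 2^-1 * (cabs (a - c) + cabs (b - d)).
Proof.
have -> : 2^-1 * (a + b) - 2^-1 * (c + d) = 2^-1 * ((a - c) + (b - d)) by ring.
by rewrite cabsM cabs_half ler_wpM2l ?invr_ge0 // cabsD.
Qed.

Lemma nrm_half b : nrm (2^-1 *: b) = 2^-1 * nrm b.
Proof. by rewrite nrmZ cabs_half. Qed.

Lemma av_contract k b g h (e : R) x : (forall y, cabs (g y - h y) <= e) ->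
  cabs (av k b g x - av k b h x) <= e.
Proof.
move=> gh; elim: k b x => [|k IH] b x //=; apply: le_trans (cabs_mean _ _ _ _) _.
have := IH (2^-1 *: b) x; have := IH (2^-1 *: b) (x + 2^-1 *: b); lra.
Qed.

Section Lip.
Variable L : R.
Hypothesis L_ge0 : 0 <= L.

Lemma av_lip2 k b b' g x x' : lipC L g ->
  cabs (av k b g x - av k b' g x') <= L * (nrm (x - x') + nrm (b - b')).
Proof.
move=> gL; elim: k b b' x x' => [|k IH] b b' x x' /=.
  apply: le_trans (gL _ _) _; have := mulr_ge0 L_ge0 (nrm_ge0 (b - b')); lra.
apply: le_trans (cabs_mean _ _ _ _) _.
have := IH (2^-1 *: b) (2^-1 *: b') x x'.
have := IH (2^-1 *: b) (2^-1 *: b') (x + 2^-1 *: b) (x' + 2^-1 *: b').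
rewrite -scalerBr opprD addrACA -scalerBr.
have := ler_wpM2l L_ge0 (nrmD (x - x') (2^-1 *: (b - b'))).
rewrite nrm_half; have := mulr_ge0 L_ge0 (nrm_ge0 (b - b')); lra.
Qed.

Lemma av_lip k b g : lipC L g -> lipC L (av k b g).
Proof.
by move=> gL x y; have := av_lip2 k b b x y gL; rewrite subrr nrm0 addr0.
Qed.

Lemma av0 k g x : av k 0 g x = g x.
Proof. by elim: k x => [|k IH] x //=; rewrite scaler0 addr0 IH; field. Qed.

Lemma av_near k b g x : lipC L g -> cabs (av k b g x - g x) <= L * nrm b.
Proof.
by move=> gL; have := av_lip2 k b 0 x x gL; rewrite av0 subrr nrm0 add0r subr0.
Qed.

Lemma av_rate k b g x : lipC L g ->
  cabs (av k.+1 b g x - av k b g x) <= L * nrm b * 2^-1 ^+ k.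
Proof.
move=> gL; elim: k b x => [|k IH] b x.
  rewrite /= (_ : _ - _ = 2^-1 * (g (x + 2^-1 *: b) - g x)); last by field.
  rewrite cabsM cabs_half; have := gL (x + 2^-1 *: b) x.
  rewrite addrAC subrr add0r nrm_half.
  have := mulr_ge0 L_ge0 (nrm_ge0 b); rewrite expr0; lra.
rewrite [av k.+2 _ _ _]/= -/(av k.+1) [av k.+1 b _ _]/=.
apply: le_trans (cabs_mean _ _ _ _) _.
have := IH (2^-1 *: b) x; have := IH (2^-1 *: b) (x + 2^-1 *: b).
by rewrite nrm_half exprS /=; lra.
Qed.

Definition lsum s : R := \sum_(b <- s) nrm b.

Lemma lsum_ge0 s : 0 <= lsum s.
Proof. by apply: sumr_ge0 => b _; apply: nrm_ge0. Qed.

Lemma avl_lip k s g : lipC L g -> lipC L (avl k s g).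
Proof. by move=> gL; elim: s => [|b s IH] //=; apply: av_lip. Qed.

Lemma avl_near k s g x : lipC L g -> cabs (avl k s g x - g x) <= L * lsum s.
Proof.
move=> gL; elim: s x => [|b s IH] x /=.
  by rewrite subrr cabs0 /lsum big_nil mulr0.
have := cabsD (av k b (avl k s g) x - avl k s g x) (avl k s g x - g x).
rewrite addrA subrK; have := IH x; have := av_near k b x (avl_lip k s gL).
by rewrite /lsum big_cons; lra.
Qed.

Lemma avl_rate k s g x : lipC L g ->
  cabs (avl k.+1 s g x - avl k s g x) <= L * lsum s * 2^-1 ^+ k.
Proof.
move=> gL; elim: s x => [|b s IH] x.
  by rewrite /= subrr cabs0 /lsum big_nil mulr0 mul0r.
rewrite [avl _ _ _]/= -/(avl k.+1 s g) [avl k _ _]/= -/(avl k s g).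
have := cabsD (av k.+1 b (avl k.+1 s g) x - av k b (avl k.+1 s g) x)
  (av k b (avl k.+1 s g) x - av k b (avl k s g) x).
rewrite addrA subrK; have := av_contract k b x IH.
have := av_rate k b x (avl_lip k.+1 s gL).
by rewrite /lsum big_cons; lra.
Qed.

End Lip.

Lemma cabs_square_defect_le (a b c d a' b' c' d' : C) (e : R) :
  cabs (a - a') <= e -> cabs (b - b') <= e -> cabs (c - c') <= e -> cabs (d - d') <= e ->
  cabs ((a - b + 'i * (c - d)) - (a' - b' + 'i * (c' - d'))) <= 4 * e.
Proof.
move=> ha hb hc hd.
have -> : (a - b + 'i * (c - d)) - (a' - b' + 'i * (c' - d')) =
  (a - a') + ((- (b - b')) + ('i * (c - c') + 'i * (- (d - d')))) by ring.
have := cabsD (a - a') ((- (b - b')) + ('i * (c - c') + 'i * (- (d - d')))).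
have := cabsD (- (b - b')) ('i * (c - c') + 'i * (- (d - d'))).
have := cabsD ('i * (c - c')) ('i * (- (d - d'))).
by rewrite !cabsM cabs_i !cabsN; lra.
Qed.

Lemma corner_av_ext s g h x : g =1 h -> corner_av s g x = corner_av s h x.
Proof. by move=> gh; elim: s x => [|b s IH] x //=; rewrite !IH. Qed.

Lemma corner_av_lin2 s g h (c d : C) x :
  corner_av s (fun y => c * g y + d * h y) x = c * corner_av s g x + d * corner_av s h x.
Proof. by elim: s x => [|b s IH] x //=; rewrite !IH; ring. Qed.

Lemma corner_avZ s g (c : C) x : corner_av s (fun y => c * g y) x = c * corner_av s g x.
Proof. by elim: s x => [|b s IH] x //=; rewrite !IH; ring. Qed.

Lemma corner_av_shift s g a x : corner_av s (fun y => g (y + a)) x = corner_av s g (x + a).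
Proof. by elim: s x => [|b s IH] x //=; rewrite !IH addrAC. Qed.

Lemma av_corner k b s g x : av k b (corner_av s g) x = corner_av s (av k b g) x.
Proof.
elim: s x => [|a s IH] x //.
rewrite (@av_ext k b _ (fun y => 2^-1 * corner_av s g y + 2^-1 * corner_av s g (y + a))).
  by rewrite av_lin2 av_shift !IH -mulrDr.
by move=> y /=; ring.
Qed.

Lemma avlS k s g x : avl k.+1 s g x = corner_av (halves s) (avl k (halves s) g) x.
Proof.
elim: s x => [|b s IH] x //; rewrite [LHS]/= -/(avl k.+1 s g).
rewrite (av_ext _ _ _ IH) (av_ext _ _ (x + _) IH) !av_corner.
by [].
Qed.

Lemma square_defect_corner k w s g x :
  square_defect k w (corner_av s g) x = corner_av s (square_defect k w g) x.
Proof.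
rewrite /square_defect !av_corner.
rewrite -(corner_av_shift s _ w) -(corner_av_shift s _ ('i *: w)).
rewrite -[corner_av s (fun y => av k ('i *: w) g (y + w)) x]mul1r.
rewrite -[corner_av s (av k ('i *: w) g) x]mul1r -mulNr -corner_av_lin2.
rewrite mulrBr -[- ('i * _)]mulNr -[_ + _ * _]corner_av_lin2.
rewrite -[corner_av s _ x]mul1r -[X in _ + X]mul1r -corner_av_lin2.
by apply: corner_av_ext => y; ring.
Qed.

(** The square is cut into quarters, whose inner edges cancel. Edges carry averages, not integrals,
    whence the factor 2; the factor 1/2 in [square_defect_zoom] will compensate it. *)
Lemma square_defectS k w g x :
  square_defect k.+1 w g x =
  2 * corner_av [:: 2^-1 *: w; 2^-1 *: ('i *: w)] (square_defect k (2^-1 *: w) g) x.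
Proof.
rewrite /square_defect /=.
set u := 2^-1 *: w; set v := 2^-1 *: ('i *: w).
have iu : 'i *: u = v by rewrite /u /v !scalerA mulrC.
have wE : w = u + u by rewrite -scalerDl (_ : 2^-1 + 2^-1 = 1 :> C) ?scale1r //; field.
have vE : 'i *: w = v + v by rewrite -scalerDl (_ : 2^-1 + 2^-1 = 1 :> C) ?scale1r //; field.
rewrite iu vE [in x + w]wE !addrA (addrAC x u v) (addrAC (x + v) u v).
by rewrite ?(addrAC (x + u) u v) ?(addrAC x u v) ?(addrAC (x + v) u v); field.
Qed.

Definition zoomC a (t : C) g : V -> C := fun x => t^-1 * (g (a + t *: x) - g a).

Lemma avl_affine k s g h (a : V) (t c d : C) x : (forall y, h y = d * (g (a + t *: y) - c)) ->
  avl k s h x = d * (avl k [seq t *: b | b <- s] g (a + t *: x) - c).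
Proof.
move=> E; elim: s x => [|b s IH] x //.
by rewrite [LHS]/= (av_affine k b x IH).
Qed.

Lemma square_defect_zoom k w s g a :
  square_defect k (2^-1 *: w) (avl k (halves s) g) a =
  2^-1 * square_defect k w (avl k s (zoomC a 2^-1 g)) 0.
Proof.
have E y : avl k s (zoomC a 2^-1 g) y = 2 * (avl k (halves s) g (a + 2^-1 *: y) - g a).
  by apply: avl_affine => z; rewrite /zoomC invrK.
rewrite /square_defect !(av_affine k _ _ E) !add0r scaler0 addr0.
by rewrite !scalerA (mulrC 'i); field.
Qed.

Definition box_defect w s k g := square_defect k w (avl k s g) 0.

(** Exact self-similarity: refining the mesh once averages the same functional over half-scale
    zooms. The constants subtracted by the zooms do not matter, since a constant has no defect. *)
Lemma box_defectS w s k g : box_defect w s k.+1 g =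
  corner_av (halves [:: w, 'i *: w & s]) (fun a => box_defect w s k (zoomC a 2^-1 g)) 0.
Proof.
rewrite /box_defect square_defectS.
have E x : square_defect k (2^-1 *: w) (avl k.+1 s g) x =
    corner_av (halves s) (square_defect k (2^-1 *: w) (avl k (halves s) g)) x.
  rewrite -square_defect_corner /square_defect.
  by rewrite !(av_ext _ _ _ (avlS k s g)).
rewrite (corner_av_ext _ _ E).
rewrite -[LHS]/(2 * corner_av (halves [:: w, 'i *: w & s])
  (square_defect k (2^-1 *: w) (avl k (halves s) g)) 0).
rewrite (corner_av_ext _ _ (square_defect_zoom k w s g)).
by rewrite corner_avZ mulrA mulfV ?pnatr_eq0 // mul1r.
Qed.

End SegmentAverages.

(** * The class of spectral maps *)

Section SpectralClass.
Variables (C : numClosedFieldType) (n : nat).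
Hypothesis hC : real_complete C.
Notation R := (reals C).
Notation V := 'M[C]_n.
Variable L : R.

Definition spec_class (F : V -> V) : Prop :=
  [/\ F 0 = 0, lipschitz_nrm L F & forall x y, spec_meet (F x - F y) (x - y)].

Lemma spec_class_zoom a (s : C) F : s != 0 -> spec_class F -> spec_class (zoom a s F).
Proof.
move=> s0 [F0 FL Fs]; split; first exact: zoom0.
  exact: zoom_lipschitz.
move=> x y; have [e [e1 e2]] := Fs (a + s *: x) (a + s *: y).
have scale (A : V) t : eigenvalue A t -> eigenvalue (s^-1 *: A) (s^-1 * t).
  by move=> /eigenvalueP [v vA v0]; apply/eigenvalueP; exists v => //;
    rewrite -scalemxAr vA scalerA.
exists (s^-1 * e); split.
  by rewrite /zoom -scalerBr opprB addrA subrK; apply: scale.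
have -> : x - y = s^-1 *: (a + s *: x - (a + s *: y)).
  by rewrite opprD addrACA subrr add0r -scalerBr scalerA mulVf // scale1r.
exact: scale.
Qed.

Lemma cvgM_det (u : nat -> V) l : cvgM u l -> cvgU (fun k => \det (u k)) (\det l).
Proof.
move=> ul; apply: cvgU_sum => s _; apply: cvgU_Ml; apply: cvgU_prod => i _.
exact: ul.
Qed.

(** The common eigenvalue may vary with [k], but the spectrum of [x - y] is finite and fixed. The
    product of the determinants over that spectrum vanishes for every [k], hence in the limit. *)
Lemma spec_class_lim (F : nat -> V -> V) : (forall k, spec_class (F k)) -> spec_class (flim F).
Proof.
move=> FS; have F0 k : F k 0 = 0 by case: (FS k).
have FL k : lipschitz_nrm L (F k) by case: (FS k).
split; first exact: (flim0 hC F0 FL).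
  exact: (flim_lipschitz hC F0 FL).
move=> x y; have Al := cvgM_B (flimP hC F0 FL x) (flimP hC F0 FL y).
have [rs rsE] := closed_field_poly_normal (char_poly (x - y)).
rewrite (monicP (char_poly_monic _)) scale1r in rsE.
have pl : cvgU (fun k => \prod_(z <- rs) \det (z%:M - (F k x - F k y)))
    (\prod_(z <- rs) \det (z%:M - (flim F x - flim F y))).
  by apply: cvgU_prod => z _; apply: cvgM_det; apply: cvgM_B (cvgM_cst _) Al.
have p0 : \prod_(z <- rs) \det (z%:M - (flim F x - flim F y)) = 0.
  apply: (cvgU_unique pl); apply: cvgU_ext (cvgU_cst 0) _ => k.
  have [e [e1 e2]] : spec_meet (F k x - F k y) (x - y) by case: (FS k).
  apply/esym/eqP; rewrite prodf_seq_eq0; apply/hasP; exists e.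
    by rewrite eigenvalue_root_char rsE root_prod_XsubC in e2.
  by rewrite -eigenvalue_det.
have :  \prod_(z <- rs) \det (z%:M - (flim F x - flim F y)) == 0.
  by rewrite p0.
rewrite prodf_seq_eq0 => /hasP [z zrs /= z0].
exists z; split; first by rewrite eigenvalue_det.
by rewrite eigenvalue_root_char rsE root_prod_XsubC.
Qed.

Lemma cvgM_zoom a (s : C) (F : nat -> V -> V) x : (forall k, F k 0 = 0) ->
  (forall k, lipschitz_nrm L (F k)) ->
  cvgM (fun k => zoom a s (F k) x) (zoom a s (flim F) x).
Proof.
by move=> F0 FL; apply/cvgM_Z/cvgM_B; apply: (flimP hC F0 FL).
Qed.
End SpectralClass.

(** * Integrals around a square, averaged over a box *)

Section BoxIntegral.
Variables (C : numClosedFieldType) (n : nat).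
Hypothesis hC : real_complete C.
Notation R := (reals C).
Notation V := 'M[C]_n.
Implicit Types (g : V -> C).
Variables (L : R) (w : V) (s : seq V).
Hypothesis L_ge0 : 0 <= L.

Let T k g := box_defect w s k g.
Let K : R := 4 * (L * nrm w + L * lsum s).

Lemma box_rate_ge0 : 0 <= K.
Proof.
have := mulr_ge0 L_ge0 (nrm_ge0 w); have := mulr_ge0 L_ge0 (lsum_ge0 s).
rewrite /K; lra.
Qed.

Lemma nrm_i (x : V) : nrm ('i *: x) = nrm x.
Proof. by rewrite nrmZ cabs_i mul1r. Qed.

Lemma box_defect_rate k g : lipC L g -> cabs (T k.+1 g - T k g) <= K * 2^-1 ^+ k.
Proof.
move=> gL.
have h b y : nrm b = nrm w -> cabs (av k.+1 b (avl k.+1 s g) y - av k b (avl k s g) y) <=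
    (L * nrm w + L * lsum s) * 2^-1 ^+ k.
  move=> bw; have := cabsD (av k.+1 b (avl k.+1 s g) y - av k b (avl k.+1 s g) y)
    (av k b (avl k.+1 s g) y - av k b (avl k s g) y).
  rewrite addrA subrK; have := av_rate L_ge0 k b y (avl_lip L_ge0 k.+1 s gL).
  have := av_contract k b y (fun z => avl_rate L_ge0 k s z gL); rewrite bw; lra.
rewrite /T /box_defect /square_defect /K -mulrA.
by apply: cabs_square_defect_le; apply: h; rewrite ?nrm_i.
Qed.

Lemma box_defect_cauchy k m g : lipC L g ->
  cabs (T (k + m) g - T k g) <= 2 * K * (2^-1 ^+ k - 2^-1 ^+ (k + m)).
Proof.
move=> gL; elim: m => [|m IH]; first by rewrite addn0 !subrr cabs0 mulr0.
have := cabsD (T (k + m.+1) g - T (k + m) g) (T (k + m) g - T k g).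
rewrite addrA subrK addnS exprS; have := box_defect_rate (k + m) gL; lra.
Qed.

Lemma box_defect_bound k g : lipC L g -> cabs (T k g) <= 2 * L * nrm w + 2 * K.
Proof.
move=> gL; have := cabsD (T k g - T 0 g) (T 0 g); rewrite subrK.
have := box_defect_cauchy 0 k gL; rewrite add0n expr0.
have : cabs (T 0 g) <= 2 * L * nrm w.
  have E : avl 0 s g =1 g by elim: s => [|b r IH] x //=; rewrite IH.
  rewrite /T /box_defect /square_defect /= !E !add0r.
  have := cabsD (g w - g 0) ('i * (g ('i *: w) - g 0)).
  rewrite cabsM cabs_i mul1r; have := gL w 0; have := gL ('i *: w) 0.
  by rewrite !subr0 nrm_i; lra.
have := mulr_ge0 box_rate_ge0 (ltW (exp_half_gt0 R k)); have := box_rate_ge0; lra.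
Qed.

Definition box_integral g : C := ulim (fun k => T k g).

Lemma box_integralP g : lipC L g -> cvgU (fun k => T k g) (box_integral g).
Proof. by move=> gL; apply: (ulimP hC (fun k => box_defect_bound k gL)). Qed.

Lemma box_integral_rate k g : lipC L g -> cabs (box_integral g - T k g) <= 2 * K * 2^-1 ^+ k.
Proof.
move=> gL; apply: cvgU_abs_le (cvgU_B (box_integralP gL) (cvgU_cst (T k g))) _.
apply: (@UF_ev k) => m km; rewrite -(subnKC km).
apply: le_trans (box_defect_cauchy _ _ gL) _.
apply: ler_wpM2l; first by rewrite mulr_ge0 // box_rate_ge0.
by rewrite lerBlDr lerDl ltW // exp_half_gt0.
Qed.

Lemma cvgU_av k b (g : nat -> V -> C) l x : (forall y, cvgU (fun m => g m y) (l y)) ->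
  cvgU (fun m => av k b (g m) x) (av k b l x).
Proof.
by move=> h; elim: k b x => [|k IH] b x //=; apply: cvgU_Ml; apply: cvgU_D.
Qed.

Lemma cvgU_avl k r (g : nat -> V -> C) l x : (forall y, cvgU (fun m => g m y) (l y)) ->
  cvgU (fun m => avl k r (g m) x) (avl k r l x).
Proof. by move=> h; elim: r x => [|b r IH] x //=; apply: cvgU_av. Qed.

Lemma cvgU_box_defect k (g : nat -> V -> C) l : (forall y, cvgU (fun m => g m y) (l y)) ->
  cvgU (fun m => T k (g m)) (T k l).
Proof.
move=> h; have h' b x : cvgU (fun m => av k b (avl k s (g m)) x) (av k b (avl k s l) x).
  by apply: cvgU_av => y; apply: cvgU_avl.
by apply: cvgU_D; [|apply: cvgU_Ml]; apply: cvgU_B.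
Qed.

(** The rate of the Riemann sums depends only on [L], [w] and [s], so the limits in the mesh and in
    [m] can be interchanged. *)
Lemma cvgU_box_integral (g : nat -> V -> C) l : (forall m, lipC L (g m)) -> lipC L l ->
  (forall y, cvgU (fun m => g m y) (l y)) ->
  cvgU (fun m => box_integral (g m)) (box_integral l).
Proof.
move=> gL lL h e e0.
have e1 : 0 < e / (8 * K + 8) by rewrite divr_gt0 //; have := box_rate_ge0; lra.
have [N /(_ N (leqnn N)) hN] := half_expr_small hC e1.
have e2 : 0 < e / 2 by rewrite divr_gt0.
apply: UF_S (cvgU_box_defect N h e2) => m hm.
have := box_integral_rate N (gL m); have := box_integral_rate N lL.
rewrite ltr_pdivlMr in hN; last by have := box_rate_ge0; lra.
have := cabsD (box_integral (g m) - T N (g m)) ((T N (g m) - T N l) + (T N l - box_integral l)).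
have := cabsD (T N (g m) - T N l) (T N l - box_integral l).
rewrite (cabsB (T N l) (box_integral l)).
have -> : box_integral (g m) - T N (g m) + (T N (g m) - T N l + (T N l - box_integral l)) =
  box_integral (g m) - box_integral l by ring.
have := exp_half_gt0 R N; lra.
Qed.

Lemma cvgU_corner_av r (g : nat -> V -> C) l x : (forall y, cvgU (fun m => g m y) (l y)) ->
  cvgU (fun m => corner_av r (g m) x) (corner_av r l x).
Proof.
by move=> h; elim: r x => [|b r IH] x //=; apply: cvgU_Ml; apply: cvgU_D.
Qed.

Lemma zoomC_lip a (t : C) g : t != 0 -> lipC L g -> lipC L (zoomC a t g).
Proof.
move=> t0 gL x y; rewrite /zoomC -mulrBr cabsM opprB addrA subrK cabsV.
have ct0 : 0 < cabs t by rewrite lt_def cabs_ge0 cabs_eq0 t0.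
rewrite mulrC ler_pdivrMr //; apply: le_trans (gL _ _) _.
by rewrite opprD addrACA subrr add0r -scalerBr nrmZ -mulrA (mulrC (cabs t)).
Qed.

Lemma box_integral_corner g : lipC L g ->
  box_integral g = corner_av (halves [:: w, 'i *: w & s]) (fun a => box_integral (zoomC a 2^-1 g)) 0.
Proof.
move=> gL; have h2 : (2^-1 : C) != 0 by rewrite invr_neq0 // pnatr_eq0.
(* A limit along an ultrafilter need not be invariant under a shift of the index; the rate shows
   that here it is. *)
have c1 : cvgU (fun k => T k.+1 g) (box_integral g).
  apply: cvgU_near (box_integralP gL) _ => e e0.
  have e1 : 0 < e / (K + 1) by rewrite divr_gt0 //; have := box_rate_ge0; lra.
  have [N hN] := half_expr_small hC e1; apply: (@UF_ev N) => k Nk.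
  rewrite cabsB; apply: le_lt_trans (box_defect_rate _ gL) _.
  have := hN k Nk; rewrite ltr_pdivlMr; last by have := box_rate_ge0; lra.
  have := exp_half_gt0 R k; lra.
apply: (cvgU_unique c1).
apply: cvgU_ext (cvgU_corner_av (g := fun k a => T k (zoomC a 2^-1 g)) _ _ _) _.
  by move=> y; apply: box_integralP; apply: zoomC_lip.
by move=> k; rewrite /T box_defectS.
Qed.

End BoxIntegral.

(** * Lattice points in boxes and cones *)

Section LatticeBoxes.
Variables (C : numClosedFieldType) (n : nat).
Hypothesis hC : real_complete C.
Notation R := (reals C).
Notation V := 'M[C]_n.
Implicit Types (s : seq V) (a b x y : V).

(** Only nonnegative coefficients occur, because corner averages move in the positive direction of
    each edge. *)
Fixpoint inbox (N : nat) s a : Prop :=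
  if s is b :: s' then exists2 l : nat, (l < N)%N & exists2 a', inbox N s' a' & a = l%:R *: b + a'
  else a = 0.

Fixpoint incone s a : Prop :=
  if s is b :: s' then exists2 t : R, 0 <= t & exists2 a', incone s' a' & a = rval t *: b + a'
  else a = 0.

Lemma inbox_widen M N s a : (M <= N)%N -> inbox M s a -> inbox N s a.
Proof.
move=> MN; elim: s a => [//|b s IH] a [l lM [a' /IH a'N ->]].
by exists l; [apply: leq_trans MN | exists a'].
Qed.

Lemma inbox0 N s : (0 < N)%N -> inbox N s 0.
Proof.
move=> N0; elim: s => [//|b s IH]; exists 0%N => //; exists 0 => //.
by rewrite scale0r addr0.
Qed.

Lemma inbox_addM c M N s a b : inbox M s a -> inbox N s b -> exists P, inbox P s (c%:R *: a + b).
Proof.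
elim: s a b => [|e s IH] a b; first by move=> -> ->; exists 0%N; rewrite /= scaler0 addr0.
move=> [l lM [a' a'M ->]] [m mN [b' b'N ->]]; have [P hP] := IH _ _ a'M b'N.
exists (maxn P (c * l + m).+1) => /=; exists (c * l + m)%N.
  by rewrite leq_max leqnn orbT.
exists (c%:R *: a' + b'); first exact: inbox_widen (leq_maxl _ _) hP.
by rewrite scalerDr addrACA natrD natrM scalerDl scalerA.
Qed.

(** Splits the last binary digit off every coefficient, which corresponds to one more halving of the
    box. *)
Lemma inbox_split m s a : inbox (2 ^ m.+1) s a ->
  exists a1 a2, [/\ inbox (2 ^ m) s a1, inbox 2 s a2 & a = 2%:R *: a1 + a2].
Proof.
elim: s a => [|e s IH] a; first by move=> ->; exists 0, 0; rewrite scaler0 addr0.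
move=> [l lM [a' /IH [a1 [a2 [h1 h2 ->]]] ->]].
exists ((l %/ 2)%:R *: e + a1), ((l %% 2)%:R *: e + a2); split.
- exists (l %/ 2)%N; last by exists a1.
  by rewrite ltn_divLR // mulnC -expnS.
- by exists (l %% 2)%N; [rewrite ltn_mod | exists a2].
rewrite scalerDr addrACA scalerA -scalerDl -natrM -natrD mulnC -divn_eq.
by [].
Qed.

(** A mean of quantities at most [M] reaches [M] only if each of them does. *)
Lemma corner_av_max s (h : V -> C) (M : R) x : (forall a, cre (h a) <= M) ->
  M <= cre (corner_av (halves s) h x) ->
  forall a, inbox 2 s a -> M <= cre (h (x + 2^-1 *: a)).
Proof.
move=> hM.
have half_cre (z : C) : cre (2^-1 * z) = 2^-1 * cre z.
  by have := creZ (2^-1) z; rewrite (fmorphV (@rval C)) (rmorph_nat (@rval C)).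
have le r y : cre (corner_av r h y) <= M.
  by elim: r y => [|b r IH] y //=; rewrite half_cre creD; have := IH y; have := IH (y + b); lra.
elim: s x => [|b s IH] x /=; first by move=> h1 a ->; rewrite scaler0 addr0.
rewrite half_cre creD => h1 a [[|[|//]] _ [a' a's ->]].
  rewrite scale0r add0r; apply: IH => //.
  have := le (halves s) (x + 2^-1 *: b); rewrite /halves in h1 *; lra.
rewrite scale1r scalerDr addrA; apply: IH => //.
have := le (halves s) x; rewrite /halves in h1 *; lra.
Qed.

Lemma cone_round s y : incone s y ->
  exists N a, inbox N s a /\ nrm (y - a) <= lsum s.
Proof.
elim: s y => [|b s IH] y.
  by move=> ->; exists 0%N, 0; rewrite subrr nrm0 /lsum big_nil.
move=> [t t0 [y' /IH [N [a [aN ya]]] ->]].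
have ex : exists l : nat, t < l.+1%:R.
  by have [m hm] := reals_archi hC t; exists m; apply: lt_trans hm _; rewrite ltr_nat.
have /ex_minnP [l tl lmin] := ex.
have lt : l%:R <= t.
  case: l tl lmin => [//|l] tl lmin; rewrite leNgt; apply/negP => /lmin.
  by rewrite ltnn.
exists (maxn N l.+1), (l%:R *: b + a); split.
  exists l; first by rewrite leq_max leqnn orbT.
  by exists a => //; apply: inbox_widen aN; apply: leq_maxl.
rewrite opprD addrACA -scalerBl; apply: le_trans (nrmD _ _) _.
rewrite /lsum big_cons lerD // nrmZ.
have -> : rval t - l%:R = rval (t - l%:R) by rewrite rvalB (rmorph_nat (@rval C)).
rewrite cabs_rval ger0_norm ?subr_ge0 // -[X in _ <= X]mul1r.
by rewrite ler_wpM2r ?nrm_ge0 //; rewrite -natr1 in tl; lra.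
Qed.

Lemma incone0 s : incone s 0.
Proof. by elim: s => [//|b s IH]; exists 0 => //; exists 0 => //; rewrite rval0 scale0r addr0. Qed.

Lemma inconeD s x y : incone s x -> incone s y -> incone s (x + y).
Proof.
elim: s x y => [|b s IH] x y; first by move=> -> ->; rewrite /= addr0.
move=> [t t0 [x' hx ->]] [u u0 [y' hy ->]]; exists (t + u); first exact: addr_ge0.
exists (x' + y'); first exact: IH.
by rewrite rvalD scalerDl addrACA.
Qed.

Lemma incone_mem s b (t : R) : b \in s -> 0 <= t -> incone s (rval t *: b).
Proof.
move=> bs t0; elim: s bs => [//|a s IH]; rewrite inE => /orP[/eqP->|/IH h].
  by exists t => //; exists 0; [exact: incone0 | rewrite addr0].
by exists 0 => //; exists (rval t *: b) => //; rewrite rval0 scale0r add0r.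
Qed.

Lemma incone_sum s (I : Type) (r : seq I) (G : I -> V) :
  (forall i, incone s (G i)) -> incone s (\sum_(i <- r) G i).
Proof.
by move=> h; elim/big_ind: _ => [|x y|i _] //; [exact: incone0 | exact: inconeD].
Qed.

(** All four directions per entry are needed for the nonnegative cone to be the whole space; [d] is
    the thickness of the box. *)
Definition spanning_steps (d : R) : seq V :=
  [seq rval d *: (e *: delta_mx p.1 p.2) |
    e <- [:: 1; -1; 'i; - 'i], p <- enum (@predT ('I_n * 'I_n)%type)].

Lemma incone_spanning (d : R) y : 0 < d -> incone (spanning_steps d) y.
Proof.
move=> d0; set s := spanning_steps d.
have memb (e : C) i j : e \in [:: 1; -1; 'i; - 'i] -> rval d *: (e *: delta_mx i j) \in s.
  move=> es; apply/allpairsP; exists (e, (i, j)); split=> //=.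
  by rewrite mem_enum.
have pos (e : C) i j (t : R) : e \in [:: 1; -1; 'i; - 'i] -> 0 <= t ->
    incone s ((rval t * e) *: delta_mx i j).
  move=> es t0; have td : 0 <= t / d by rewrite divr_ge0 // ltW.
  have := incone_mem (memb e i j es) td; rewrite !scalerA -rvalM divfK //.
  by rewrite gt_eqF.
have real (e : C) i j (t : R) : e \in [:: 1; -1; 'i; - 'i] -> - e \in [:: 1; -1; 'i; - 'i] ->
    incone s ((rval t * e) *: delta_mx i j).
  move=> es nes; have [t0|t0] := leP 0 t; first exact: pos.
  have := pos (- e) i j (- t) nes; rewrite rvalN mulrNN; apply; lra.
rewrite (matrix_sum_delta y); apply: incone_sum => i; apply: incone_sum => j.
rewrite (crect (y i j)) scalerDl; apply: inconeD.
  by rewrite -[rval _]mulr1; apply: real; rewrite !inE eqxx ?orbT.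
rewrite mulrC; apply: real; rewrite !inE eqxx ?orbT //.
Qed.

Lemma lsum_spanning (d : R) : 0 <= d -> lsum (spanning_steps d) = d * lsum (spanning_steps 1).
Proof.
move=> d0; rewrite /lsum /spanning_steps !big_allpairs_dep mulr_sumr; apply: eq_bigr => e _.
rewrite mulr_sumr; apply: eq_bigr => p _.
by rewrite [in LHS]nrmZ cabs_rval ger0_norm // [in RHS]nrmZ rval1 cabs1 mul1r.
Qed.

End LatticeBoxes.

(** * Vanishing of the box integrals *)

Section ExtremalCubes.
Variables (C : numClosedFieldType) (n : nat).
Hypotheses (hC : real_complete C) (n_gt0 : (0 < n)%N).
Notation R := (reals C).
Notation V := 'M[C]_n.
Variables (L : R).
Hypothesis L_ge0 : 0 <= L.
Implicit Types (F : V -> V).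

Definition entry_fun F (i j : 'I_n) : V -> C := fun x => F x i j.

Lemma entry_fun_lip F i j : lipschitz_nrm L F -> lipC L (entry_fun F i j).
Proof.
move=> FL x y; apply: le_trans (FL x y).
by have := entry_le_nrm (F x - F y) i j; rewrite !mxE.
Qed.

Lemma entry_fun_zoom a t F i j : entry_fun (zoom a t F) i j = zoomC a t (entry_fun F i j).
Proof. by apply/funext => x; rewrite /entry_fun /zoom /zoomC !mxE. Qed.

Lemma spec_lip F i j : spec_class L F -> lipC L (entry_fun F i j).
Proof. by case=> _ FL _; apply: entry_fun_lip. Qed.

Lemma zoom_comp b t a s F : zoom b t (zoom a s F) = zoom (a + s *: b) (s * t) F.
Proof. by apply/funext; apply: zoom_zoom. Qed.

Lemma spec_class_max (J : (V -> V) -> R) (B : R) :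
  (forall F, spec_class L F -> J F <= B) ->
  (forall F : nat -> V -> V, (forall k, spec_class L (F k)) ->
     cvgU (fun k => rval (J (F k))) (rval (J (flim F)))) ->
  (exists F, spec_class L F) ->
  exists F, spec_class L F /\ forall F', spec_class L F' -> J F' <= J F.
Proof.
move=> JB Jlim [F0 F0S]; pose E m := exists2 F, spec_class L F & m = J F.
have [||M [Mub Mlub]] := @reals_sup _ hC E.
- by exists (J F0), F0.
- by exists B => m [F FS ->]; apply: JB.
have near k : exists F, spec_class L F /\ M - k.+1%:R^-1 <= J F.
  apply: contrapT => hn; have : M <= M - k.+1%:R^-1.
    apply: Mlub => _ [F FS ->]; rewrite leNgt; apply/negP => h.
    by apply: hn; exists F; split=> //; apply: ltW.
  by have := inv_nat_gt0 C k; rewrite lerBrDl gerDr leNgt => ->.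
have [F FP] := choice near; have FS k : spec_class L (F k) by case: (FP k).
exists (flim F); split; first exact: (spec_class_lim hC FS).
move=> F' F'S; apply: le_trans (Mub _ (ex_intro2 _ _ _ F'S erefl)) _.
apply/ler_addgt0Pr => e e0; rewrite -lerBlDr.
rewrite -[J (flim F)]cre_rval; apply: (cvgU_re_ge (Jlim _ FS)).
apply: UF_S (UF_inv_nat hC e0) => k ke; rewrite cre_rval.
by have [_] := FP k; move: (k.+1%:R^-1) ke => t; lra.
Qed.

Section FixedBox.
Variables (w : V) (d : R) (c : C) (i j : 'I_n).
Hypothesis d_gt0 : 0 < d.
Let s := spanning_steps n d.
Let box : seq V := [:: w, 'i *: w & s].
Let J F : R := cre (c * box_integral w s (entry_fun F i j)).

Lemma cvgU_box_value (F : nat -> V -> V) : (forall k, spec_class L (F k)) ->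
  cvgU (fun k => rval (J (F k))) (rval (J (flim F))).
Proof.
move=> FS; have F0 k : F k 0 = 0 by case: (FS k).
have FL k : lipschitz_nrm L (F k) by case: (FS k).
apply/cvgU_re/cvgU_Ml; apply: (cvgU_box_integral hC w s L_ge0).
- by move=> k; apply: spec_lip.
- exact: spec_lip (spec_class_lim hC FS).
- by move=> y; apply: (flimP hC F0 FL).
Qed.

Lemma box_value_bound F : spec_class L F ->
  J F <= cabs c * (2 * L * nrm w + 2 * (4 * (L * nrm w + L * lsum s))).
Proof.
move=> FS; apply: le_trans (cre_le _) _; rewrite cabsM ler_wpM2l ?cabs_ge0 //.
apply: cvgU_abs_le (box_integralP hC w s L_ge0 (spec_lip i j FS)) _.
by apply: UF_T => k; apply: box_defect_bound L_ge0 _ _ (spec_lip i j FS).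
Qed.

Lemma box_value_max F0 : spec_class L F0 -> exists F, spec_class L F /\
  forall F', spec_class L F' -> J F' <= J F.
Proof. by move=> F0S; apply: (spec_class_max box_value_bound cvgU_box_value); exists F0. Qed.

Lemma box_value_corner F M : spec_class L F ->
  (forall F', spec_class L F' -> J F' <= M) -> M <= J F ->
  forall a, inbox 2 box a -> M <= J (zoom (2^-1 *: a) 2^-1 F).
Proof.
move=> FS hM MF a ab.
have h2 : (2^-1 : C) != 0 by rewrite invr_neq0 // pnatr_eq0.
have E b : cre (c * box_integral w s (zoomC b 2^-1 (entry_fun F i j))) = J (zoom b 2^-1 F).
  by rewrite -entry_fun_zoom.
have := @corner_av_max C n box (fun b => c * box_integral w s (zoomC b 2^-1 (entry_fun F i j))) M 0 => h.
rewrite -E; have := h _ _ a ab; rewrite add0r; apply.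
  by move=> b; rewrite E; apply: hM; apply: spec_class_zoom.
by rewrite corner_avZ -(box_integral_corner hC w s L_ge0 (spec_lip i j FS)).
Qed.

(** By [m] bisections, a maximiser remains maximal on each dyadic subcube of its box. *)
Lemma box_value_subcubes F M : spec_class L F ->
  (forall F', spec_class L F' -> J F' <= M) -> M <= J F ->
  forall m a, inbox (2 ^ m) box a -> M <= J (zoom (2^-1 ^+ m *: a) (2^-1 ^+ m) F).
Proof.
move=> FS hM MF; elim=> [|m IH] a.
  move=> ab; have -> : a = 0.
    elim: box a ab => [//|b r IHr] a [[|//] _ [a' /IHr -> ->]].
    by rewrite scale0r addr0.
  suff -> : zoom (2^-1 ^+ 0 *: 0) (2^-1 ^+ 0) F = F by [].
  apply/funext => x; rewrite /zoom expr0 !scale1r invr1 scale1r add0r.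
  by case: FS => -> _ _; rewrite subr0.
move=> /inbox_split [a1 [a2 [h1 h2 ->]]].
have FS' := spec_class_zoom (2^-1 ^+ m *: a1) (exp_half_neq0 C m) FS.
have := box_value_corner FS' hM (IH _ h1) h2.
rewrite zoom_comp scalerA -exprSr.
have -> : 2^-1 ^+ m.+1 *: (2%:R *: a1 + a2) = 2^-1 ^+ m *: a1 + 2^-1 ^+ m.+1 *: a2.
  by rewrite scalerDr scalerA exprSr -mulrA mulVf ?mulr1 // pnatr_eq0.
by [].
Qed.

Lemma zoom_flim a t (F : nat -> V -> V) : t != 0 -> (forall k, spec_class L (F k)) ->
  zoom a t (flim F) = flim (fun k => zoom a t (F k)).
Proof.
move=> t0 FS; have F0 k : F k 0 = 0 by case: (FS k).
have FL k : lipschitz_nrm L (F k) by case: (FS k).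
apply/funext => x; apply: cvgM_unique (cvgM_zoom hC a t x F0 FL) _.
apply: (flimP hC (L := L)) => k; first exact: zoom0.
exact: zoom_lipschitz.
Qed.

Lemma box_value_lim_ge (F : nat -> V -> V) M : (forall k, spec_class L (F k)) ->
  UF [set k | M <= J (F k)] -> M <= J (flim F).
Proof.
move=> FS MF; rewrite -[J (flim F)]cre_rval; apply: (cvgU_re_ge (cvgU_box_value FS)).
by apply: UF_S MF => k; rewrite cre_rval.
Qed.

Lemma av_affine_dir m b (g h : V -> C) : (forall x y, h (x + y) = h x + g y) ->
  forall x y, av m b h (x + y) = av m b h x + g y.
Proof.
move=> ha x y; elim: m b x => [|m IH] b x //=.
by rewrite (addrAC x) !IH; field.
Qed.

(** Opposite edges differ by [g w'] and by ['i * g w']; after multiplication of the latter by ['i]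
    the two contributions cancel. *)
Lemma square_defect_affine k (g h : V -> C) w' x : (forall x y, h (x + y) = h x + g y) ->
  g ('i *: w') = 'i * g w' -> square_defect k w' h x = 0.
Proof.
move=> ha gi; rewrite /square_defect !(av_affine_dir _ _ ha) gi.
set A := av _ _ _ _; set B := av _ _ _ _.
have -> : A + g w' - A + 'i * (B + 'i * g w' - B) = g w' + 'i ^+ 2 * g w' by ring.
by rewrite sqrCi mulN1r subrr.
Qed.

(** The spectral condition makes an additive member complex linear, and its box average is affine
    with the same linear part. *)
Lemma box_value_additive F : spec_class L F -> (forall x y, F (x + y) = F x + F y) -> J F = 0.
Proof.
move=> [F0 FL Fs] FD.
have Fs' x : spec_meet (F x) x by have := Fs x 0; rewrite F0 !subr0.
have FZ := additive_scalable n_gt0 FD Fs'.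
suff E k : box_defect w s k (entry_fun F i j) = 0.
  rewrite /J (_ : box_integral _ _ _ = 0) ?mulr0 ?cre0 //.
  by apply: ulimE; apply: cvgU_ext (cvgU_cst 0) _ => k; rewrite E.
apply: (@square_defect_affine _ (entry_fun F i j)); last first.
  by rewrite /entry_fun FZ mxE.
elim: s => [|b r IH] x y /=; first by rewrite /entry_fun FD mxE.
exact: av_affine_dir.
Qed.

(** The maps that reach the maximum [M] on all lattice cubes of all scales form a blow-up class. Its
    additive member has value 0, so [M] is at most 0. *)
Lemma box_value_nonpos F : spec_class L F -> J F <= 0.
Proof.
move=> FS; have [Fm [FmS Fmax]] := box_value_max FS.
apply: le_trans (Fmax _ FS) _; set M := J Fm in Fmax *.
pose G F := spec_class L F /\
  forall m N a, inbox N box a -> M <= J (zoom (2^-1 ^+ m *: a) (2^-1 ^+ m) F).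
have GB : blowup_class L (lsum box) G.
  split.
  - by move=> F' [[]].
  - by move=> F' [[]].
  - move=> F' GF'; have F'S k := (GF' k).1; split; first exact: (spec_class_lim hC F'S).
    move=> m N a ab; rewrite zoom_flim ?exp_half_neq0 //; apply: box_value_lim_ge.
      by move=> k; apply: spec_class_zoom => //; apply: exp_half_neq0.
    by apply: UF_T => k; apply: (GF' k).2 ab.
  move=> x m.
  (* The directions of [s] alone reach every point; the square's own edges get coefficient 0. *)
  have yc : incone box (2 ^+ m *: x).
    exists 0 => //; exists (2 ^+ m *: x); last by rewrite rval0 scale0r add0r.
    exists 0 => //; exists (2 ^+ m *: x); last by rewrite rval0 scale0r add0r.
    exact: incone_spanning.
  have [N [a [ab ya]]] := cone_round hC yc.
  exists (2^-1 ^+ m *: a).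
    have -> : x - 2^-1 ^+ m *: a = 2^-1 ^+ m *: (2 ^+ m *: x - a).
      by rewrite scalerBr scalerA -exp_half_inv mulfV ?scale1r // exp_half_neq0.
    by rewrite nrmZ cabs_exp_half mulrC ler_wpM2r // ltW // exp_half_gt0.
  move=> F' [F'S F'M]; split; first by apply: spec_class_zoom => //; apply: exp_half_neq0.
  move=> m' N' a' ab'; rewrite zoom_comp scalerA -exprD.
  have [P hP] := inbox_addM (2 ^ m') ab ab'.
  have -> : 2^-1 ^+ m *: a + 2^-1 ^+ (m + m') *: a' = 2^-1 ^+ (m + m') *: ((2 ^ m')%:R *: a + a').
    rewrite scalerDr scalerA exprD -mulrA natrX -exprMn mulVf ?pnatr_eq0 //.
    by rewrite expr1n mulr1.
  exact: F'M hP.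
(* The maximiser controls only cubes inside its own box. Zooming in at the corner 0 enlarges this
   box, and in the limit no bound on the coefficients remains. *)
pose F1 := flim (fun k => zoom 0 (2^-1 ^+ k) Fm).
have FkS k : spec_class L (zoom 0 (2^-1 ^+ k) Fm).
  by apply: spec_class_zoom => //; apply: exp_half_neq0.
have GF1 : G F1.
  split; first exact: (spec_class_lim hC FkS).
  move=> m N a ab; rewrite zoom_flim ?exp_half_neq0 //; apply: box_value_lim_ge.
    by move=> k; apply: spec_class_zoom => //; apply: exp_half_neq0.
  apply: (@UF_ev N) => k Nk; rewrite zoom_comp add0r scalerA -exprD.
  apply: (box_value_subcubes FmS) => //; apply: inbox_widen ab.
  by rewrite (leq_trans Nk) // (leq_trans (ltnW (ltn_expl k (ltnSn 1)))) // leq_exp2l // leq_addr.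
have [phi [phiS phiM] phiD] := exists_additive_member hC (lsum_ge0 box) GB (ex_intro _ _ GF1).
have := phiM 0%N 1%N 0 (inbox0 _ (ltnSn 0)).
rewrite (_ : zoom _ _ phi = phi) ?box_value_additive //.
apply/funext => x; rewrite /zoom expr0 !scale1r invr1 scale1r add0r.
by case: phiS => -> _ _; rewrite subr0.
Qed.

End FixedBox.

(** The averaged integral is zero, so only the discretisation error and the effect of the averaging
    remain; the latter vanishes with the thickness [d]. *)
Lemma square_defect_small F k w a i j : spec_class L F ->
  cabs (square_defect k w (entry_fun F i j) a) <= 8 * L * nrm w * 2^-1 ^+ k.
Proof.
wlog -> : a F / a = 0 => [base|] FS.
  have := base 0 (zoom a 1 F) erefl (spec_class_zoom a (oner_neq0 _) FS).
  rewrite entry_fun_zoom.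
  have E m b x : av m b (zoomC a 1 (entry_fun F i j)) x =
      1 * (av m (1 *: b) (entry_fun F i j) (a + 1 *: x) - entry_fun F i j a).
    by apply: av_affine => y; rewrite /zoomC invr1.
  rewrite /square_defect !E !scale1r !mul1r !addr0 !add0r.
  set u := av _ _ _ _; set v := av _ _ _ _; set u' := av _ _ _ _.
  set v' := av _ _ _ _; set e := entry_fun _ _ _ _.
  by have -> : u - e - (v - e) + 'i * (u' - e - (v' - e)) = u - v + 'i * (u' - v') by ring.
have gL := spec_lip i j FS; set g := entry_fun F i j in gL *.
have thin d : 0 < d -> cabs (square_defect k w g 0) <=
    8 * L * nrm w * 2^-1 ^+ k +
    d * (8 * L * lsum (spanning_steps n 1) * 2^-1 ^+ k + 4 * L * lsum (spanning_steps n 1)).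
  move=> d0; pose s := spanning_steps n d.
  (* With the conjugate of the integral as [c], nonpositivity bounds its squared modulus by 0. *)
  have I0 : box_integral w s g = 0.
    have := box_value_nonpos w (box_integral w s g)^* i j d0 FS.
    rewrite -/s -/g mulrC cabs_re_conj => h.
    apply/eqP; rewrite -cabs_eq0 -sqrf_eq0 eq_le h sqr_ge0 //.
  have := box_integral_rate hC w s L_ge0 k gL; rewrite I0 sub0r cabsN.
  have := cabsD (square_defect k w g 0 - box_defect w s k g) (box_defect w s k g).
  rewrite subrK.
  have : cabs (square_defect k w g 0 - box_defect w s k g) <= 4 * (L * lsum s).
    have near b y : cabs (av k b g y - av k b (avl k s g) y) <= L * lsum s.
      by apply: av_contract => z; rewrite cabsB; apply: avl_near.
    by rewrite /box_defect /square_defect; apply: cabs_square_defect_le.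
  by rewrite /s (lsum_spanning n (ltW d0)); lra.
set A := 8 * L * _ * _ + _ in thin.
apply: (@le_of_inv_nat _ hC _ _ A) => m.
by have := thin _ (inv_nat_gt0 C m); rewrite [_^-1 * A]mulrC.
Qed.

End ExtremalCubes.

(** * The mean value property on circles *)

Section DyadicRoots.
Variable C : numClosedFieldType.
Notation R := (reals C).

(* Bisecting the angle of ['i]: [droot m] is a primitive root of unity of order [2 ^ m.+2]. *)
Fixpoint droot (m : nat) : C :=
  if m is k.+1 then (rval (cabs (1 + droot k)))^-1 * (1 + droot k) else 'i.

Definition cim (z : C) : R := cre (- 'i * z).

Lemma cabs_sq_re_im z : cabs z ^+ 2 = cre z ^+ 2 + cim z ^+ 2.
Proof.
apply: (can_inj (@cre_rval C)); rewrite rvalD !(rmorphXn (@rval C)) /= normC2_Re_Im.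
by rewrite mulNr raddfN /= ReMil opprK.
Qed.

Lemma cre_i : cre ('i : C) = 0. Proof. by apply: val_inj; rewrite /= Re_i. Qed.
Lemma cre_1 : cre (1 : C) = 1. Proof. by rewrite -[1 in LHS]rval1 cre_rval. Qed.
Lemma cimD x y : cim (x + y) = cim x + cim y.
Proof. by rewrite /cim mulrDr creD. Qed.
Lemma cim_1 : cim (1 : C) = 0. Proof. by rewrite /cim mulr1 creN cre_i oppr0. Qed.
Lemma cimZ (r : R) z : cim (rval r * z) = r * cim z.
Proof. by rewrite /cim mulrCA creZ. Qed.

Lemma droot_spec m : [/\ cabs (droot m) = 1, 0 <= cre (droot m) & 0 < cim (droot m)].
Proof.
elim: m => [|m [h1 h2 h3]] /=.
  rewrite cabs_i cre_i /cim mulNr -expr2 sqrCi opprK cre_1; split=> //.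
set D := cabs (1 + droot m); have D0 : 0 < D.
  rewrite lt_def cabs_ge0 andbT; apply/eqP => D0.
  by have := cre_le (1 + droot m); rewrite -/D D0 creD cre_1; lra.
have -> : (rval D)^-1 = rval D^-1 by rewrite (fmorphV (@rval C)).
split.
- by rewrite cabsM cabs_rval -/D ger0_norm ?mulVf ?gt_eqF // invr_ge0 ltW.
- by rewrite creZ mulr_ge0 ?invr_ge0 ?(ltW D0) // creD cre_1; lra.
- by rewrite cimZ mulr_gt0 ?invr_gt0 // cimD cim_1; lra.
Qed.

Lemma droot_sqr m : droot m.+1 ^+ 2 = droot m.
Proof.
have [h1 h2 h3] := droot_spec m; set w := droot m in h1 h2 h3 *.
rewrite [droot _]/= -/w exprMn exprVn.
have w0 : 1 + w != 0.
  by apply/eqP => e; have := creD 1 w; rewrite e cre0 cre_1; lra.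
have wc : w * w^* = 1 by rewrite -normCK -[`|w|]/(rval (cabs w)) h1 rval1 expr1n.
have -> : rval (cabs (1 + w)) ^+ 2 = (1 + w) * (1 + w^*).
  by rewrite /= normCK rmorphD rmorph1.
have -> : (1 + w) ^+ 2 = w * ((1 + w) * (1 + w^*)).
  have -> : w * ((1 + w) * (1 + w^*)) = (1 + w) * (w + w * w^*) by ring.
  by rewrite wc; ring.
rewrite mulrCA mulVf ?mulr1 // mulf_neq0 //.
have -> : 1 + w^* = (1 + w)^* by rewrite rmorphD rmorph1.
by rewrite fmorph_eq0.
Qed.

Lemma droot_order m : droot m ^+ (2 ^ m.+2) = 1.
Proof.
elim: m => [|m IH]; first by rewrite /= (exprM _ 2 2) sqrCi sqrrN expr1n.
by rewrite expnS exprM droot_sqr.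
Qed.

Definition dstep m : R := cabs (droot m - 1).

Lemma dstep_sq m : dstep m ^+ 2 = 2 - 2 * cre (droot m).
Proof.
have [h1 h2 h3] := droot_spec m; rewrite /dstep cabs_sq_re_im.
have := cabs_sq_re_im (droot m); rewrite h1 expr1n creB cre_1.
rewrite (_ : cim (droot m - 1) = cim (droot m)).
  by move=> e; rewrite sqrrB; lra.
by rewrite /cim mulrBr creB mulr1 creN cre_i; lra.
Qed.

Lemma dstep_gt0 m : 0 < dstep m.
Proof.
have [h1 h2 h3] := droot_spec m.
rewrite lt_def cabs_ge0 andbT cabs_eq0 subr_eq0; apply/eqP => e.
by move: h3; rewrite e cim_1 ltxx.
Qed.

Lemma dstep_le_im m : dstep m / 2 <= cim (droot m).
Proof.
have [h1 h2 h3] := droot_spec m; have := dstep_sq m; have := dstep_gt0 m.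
have := cabs_sq_re_im (droot m); rewrite h1 expr1n => e s0 sq.
rewrite leNgt; apply/negP => h.
have : cim (droot m) ^+ 2 < (dstep m / 2) ^+ 2.
  by rewrite ltr_pXn2r // nnegrE; lra.
have := sqr_ge0 (dstep m); rewrite exprMn sq.
have : cre (droot m) <= 1 by have := cre_le (droot m); rewrite h1.
have -> : cim (droot m) ^+ 2 = 1 - cre (droot m) ^+ 2 by lra.
rewrite exprVn; nra.
Qed.

(** Factor [z ^+ 2 - 1]: as the real part of the root is nonnegative, the factor [z + 1] has modulus
    at least the square root of 2, which exceeds 4/3. *)
Lemma dstepS m : dstep m.+1 <= 3 / 4 * dstep m.
Proof.
have [h1 h2 h3] := droot_spec m.+1.
have e : dstep m = dstep m.+1 * cabs (droot m.+1 + 1).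
  by rewrite /dstep -cabsM -subr_sqr_1 droot_sqr.
have d0 := dstep_gt0 m.+1.
have : 4 / 3 <= cabs (droot m.+1 + 1).
  rewrite -(@ler_pXn2r _ 2) ?nnegrE ?cabs_ge0 ?divr_ge0 // cabs_sq_re_im creD cre_1.
  have := sqr_ge0 (cim (droot m.+1 + 1)).
  have := cabs_sq_re_im (droot m.+1); rewrite h1 expr1n cimD cim_1 addr0.
  rewrite sqrrD; lra.
by rewrite e => h; nra.
Qed.

Lemma dstep_le m : dstep m <= 2 * (3 / 4) ^+ m.
Proof.
elim: m => [|m IH]; last by have := dstepS m; rewrite exprS; lra.
by have := @cabsD C 'i (- 1); rewrite cabsN cabs1 cabs_i expr0 /dstep /=; lra.
Qed.

(** For growing [k] these powers fill an arc whose size depends on [m] only. The exponent is read in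
    binary, and the digits contribute a geometric series. *)
Lemma droot_pow_near m k j : (j < 2 ^ k)%N ->
  cabs (droot (m + k) ^+ j - 1) <= 8 * (3 / 4) ^+ m.
Proof.
suff h : forall k j, (j < 2 ^ k)%N ->
    cabs (droot (m + k) ^+ j - 1) <= 8 * ((3 / 4) ^+ m - (3 / 4) ^+ (m + k)).
  move=> /h /le_trans; apply; have : 0 <= (3 / 4 : R) ^+ (m + k) by apply: exprn_ge0; lra.
  lra.
elim=> [|k' IH] j' jk.
  by move: jk; rewrite expn0 ltnS leqn0 => /eqP->; rewrite expr0 subrr cabs0 addn0 subrr mulr0.
have e : droot (m + k'.+1) ^+ j' = droot (m + k') ^+ (j' %/ 2) * droot (m + k'.+1) ^+ (j' %% 2).
  by rewrite addnS -(droot_sqr (m + k')) -exprM -exprD mulnC -divn_eq.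
rewrite e; set x := droot _ ^+ _; set y := droot _ ^+ (j' %% 2).
have -> : x * y - 1 = x * (y - 1) + (x - 1) by ring.
have xa : cabs x = 1 by rewrite cabsX; have [-> _ _] := droot_spec (m + k'); rewrite expr1n.
have hx : cabs (x - 1) <= 8 * ((3 / 4) ^+ m - (3 / 4) ^+ (m + k')).
  by apply: IH; rewrite ltn_divLR // mulnC -expnS.
have hy : cabs (y - 1) <= 2 * (3 / 4) ^+ (m + k'.+1).
  rewrite /y; have := ltn_pmod j' (ltn0Sn 1); case: (j' %% 2)%N => [|[|//]] _.
    by rewrite expr0 subrr cabs0 mulr_ge0 // exprn_ge0 // divr_ge0.
  by rewrite expr1; apply: dstep_le.
have := cabsD (x * (y - 1)) (x - 1); rewrite cabsM xa mul1r.
have : 0 <= (3 / 4 : R) ^+ (m + k') by apply: exprn_ge0; lra.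
by rewrite addnS exprS in hy *; lra.
Qed.

End DyadicRoots.

(** * Telescoping square defects towards the centre of a circle *)

Section MeanValue.
Variables (C : numClosedFieldType) (n : nat).
Hypotheses (hC : real_complete C) (n_gt0 : (0 < n)%N).
Notation R := (reals C).
Notation V := 'M[C]_n.
Variables (L : R) (F : V -> V) (i j : 'I_n).
Hypotheses (L_ge0 : 0 <= L) (FS : spec_class L F).
Let g := entry_fun F i j.
Variable m : nat.
Let w := droot C m.
Let N := (2 ^ m.+2)%N.
Let e := dstep C m.
(** Chosen so that [w = 1 + 'i * kappa]: with [a = w ^+ l *: z] and [u = kappa *: a], the chord from
    [a] to the next vertex is ['i *: u], and [u] and ['i *: u] span a square. *)
Let kappa := - 'i * (w - 1).

Let gL : lipC L g. Proof. exact: spec_lip. Qed.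
Let e_gt0 : 0 < e. Proof. exact: dstep_gt0. Qed.
Let cabs_w : cabs w = 1. Proof. by have [] := droot_spec C m. Qed.
Let cabs_wX l : cabs (w ^+ l) = 1. Proof. by rewrite cabsX cabs_w expr1n. Qed.
Let cabs_kappa : cabs kappa = e. Proof. by rewrite cabsM cabsN cabs_i mul1r. Qed.
Let wE : w = 1 + 'i * kappa.
Proof. by rewrite /kappa mulrA mulrN -expr2 sqrCi opprK mul1r addrC subrK. Qed.

Lemma dstep_le2 : e <= 2.
Proof. by have := cabsD w (- 1); rewrite cabsN cabs1 cabs_w /e /dstep -/w; lra. Qed.

(** The real part of [kappa] is the imaginary part of [w]. *)
Lemma radial_ratio_ge : 1 + e / 2 <= cabs (1 + kappa).
Proof.
apply: le_trans (cre_le _); rewrite creD cre_1 lerD2l.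
by have := dstep_le_im C m; rewrite /kappa -/(cim _) cimD -rval1 -rvalN -[rval _]mulr1
  cimZ cim_1 mulr0 addr0.
Qed.

Lemma cabs_step l : cabs ('i * kappa * w ^+ l) = e.
Proof. by rewrite 2!cabsM cabs_i mul1r cabs_kappa cabs_wX mulr1. Qed.

Definition edge_sum k z := \sum_(l < N) av k (('i * kappa * w ^+ l) *: z) g (w ^+ l *: z).

(* The radial edges telescope around the circle, so passing from radius [z] to
   [(1 + kappa) z] changes the sum over angular edges only by square defects. *)
Lemma edge_sum_step k z :
  cabs (edge_sum k ((1 + kappa) *: z) - edge_sum k z) <=
  N%:R * (2 * L * e ^+ 2 * nrm z + 8 * L * e * nrm z * 2^-1 ^+ k).
Proof.
pose Q l := av k ((kappa * w ^+ l) *: z) g (w ^+ l *: z).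
have QN : \sum_(l < N) (Q l.+1 - Q l) = 0.
  rewrite -(big_mkord xpredT (fun l => Q l.+1 - Q l)) telescope_sumr //.
  by rewrite /Q (droot_order C m) expr0 subrr.
have term l : exists2 E : C, cabs E <= 2 * L * e ^+ 2 * nrm z + 8 * L * e * nrm z * 2^-1 ^+ k &
    av k (('i * kappa * w ^+ l) *: ((1 + kappa) *: z)) g (w ^+ l *: ((1 + kappa) *: z)) -
    av k (('i * kappa * w ^+ l) *: z) g (w ^+ l *: z) = E - 'i * (Q l.+1 - Q l).
  set a := w ^+ l *: z; set u := kappa *: a.
  have na : nrm a = nrm z by rewrite /a nrmZ cabs_wX mul1r.
  have nu : nrm u = e * nrm z by rewrite /u nrmZ cabs_kappa na.
  have au : w ^+ l *: ((1 + kappa) *: z) = a + u.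
    by rewrite /u /a !scalerA -scalerDl; congr (_ *: _); ring.
  have aiu : w ^+ l.+1 *: z = a + 'i *: u.
    by rewrite /u /a !scalerA -scalerDl exprS {1}wE; congr (_ *: _); ring.
  have iu : ('i * kappa * w ^+ l) *: z = 'i *: u by rewrite /u /a !scalerA.
  have Ql : Q l = av k u g a by rewrite /Q /u /a scalerA.
  (* [X] and [Y] are the far sides of the square spanned by [u] and ['i *: u]. The true edges [P']
     and [Q l.+1] start at the same points, with directions off by [('i * kappa) *: u]; hence the
     terms in [e ^+ 2]. *)
  rewrite au iu; set X := av k ('i *: u) g (a + u).
  set P' := av k _ g (a + u); set Y := av k u g (a + 'i *: u).
  have hP : cabs (P' - X) <= L * (e ^+ 2 * nrm z).
    have := av_lip2 L_ge0 k (('i * kappa * w ^+ l) *: ((1 + kappa) *: z)) ('i *: u) (a + u) (a + u) gL.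
    rewrite subrr nrm0 add0r.
    have -> : ('i * kappa * w ^+ l) *: ((1 + kappa) *: z) - 'i *: u = ('i * kappa) *: u.
      by rewrite /u /a !scalerA -scalerBl; congr (_ *: _); ring.
    by rewrite nrmZ cabsM cabs_i mul1r cabs_kappa nu expr2 -[e * e * _]mulrA.
  have hQ : cabs (Y - Q l.+1) <= L * (e ^+ 2 * nrm z).
    rewrite /Q aiu cabsB.
    have := av_lip2 L_ge0 k ((kappa * w ^+ l.+1) *: z) u (a + 'i *: u) (a + 'i *: u) gL.
    rewrite subrr nrm0 add0r.
    have -> : (kappa * w ^+ l.+1) *: z - u = ('i * kappa) *: u.
      by rewrite /u /a !scalerA -scalerBl exprS {1}wE; congr (_ *: _); ring.
    by rewrite nrmZ cabsM cabs_i mul1r cabs_kappa nu expr2 -[e * e * _]mulrA.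
  have hS := square_defect_small hC n_gt0 L_ge0 k u a i j FS.
  exists ((P' - X) + square_defect k u g a - 'i * (Y - Q l.+1)).
    have := cabsD ((P' - X) + square_defect k u g a) (- ('i * (Y - Q l.+1))).
    have := cabsD (P' - X) (square_defect k u g a).
    by rewrite cabsN cabsM cabs_i mul1r; rewrite nu in hS; lra.
  by rewrite /square_defect -/X -/Y -Ql; ring.
rewrite /edge_sum -sumrB.
have /choice [E EP] l : exists E : C,
    cabs E <= 2 * L * e ^+ 2 * nrm z + 8 * L * e * nrm z * 2^-1 ^+ k /\
    av k (('i * kappa * w ^+ l) *: ((1 + kappa) *: z)) g (w ^+ l *: ((1 + kappa) *: z)) -
    av k (('i * kappa * w ^+ l) *: z) g (w ^+ l *: z) = E - 'i * (Q l.+1 - Q l).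
  by have [E E1 E2] := term l; exists E.
rewrite (eq_bigr (fun l : 'I_N => E l - 'i * (Q l.+1 - Q l))); last by move=> l _; case: (EP l).
rewrite sumrB -mulr_sumr QN mulr0 subr0; apply: le_trans (cabs_sum _ _ _) _.
rewrite [X in _ <= X]mulr_natl -[X in _ *+ X]card_ord -sumr_const.
by apply: ler_sum => l _; case: (EP l).
Qed.

Lemma edge_sum_near0 k z : cabs (edge_sum k z - N%:R * g 0) <= N%:R * (3 * L * nrm z).
Proof.
have -> : N%:R * g 0 = \sum_(l < N) g 0 by rewrite sumr_const card_ord mulr_natl.
rewrite /edge_sum -sumrB; apply: le_trans (cabs_sum _ _ _) _.
rewrite mulr_natl -[X in _ *+ X]card_ord -sumr_const; apply: ler_sum => l _.
have := cabsD (av k (('i * kappa * w ^+ l) *: z) g (w ^+ l *: z) - g (w ^+ l *: z))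
  (g (w ^+ l *: z) - g 0).
rewrite addrA subrK.
have := av_near L_ge0 k (('i * kappa * w ^+ l) *: z) (w ^+ l *: z) gL.
have := gL (w ^+ l *: z) 0; rewrite subr0 !nrmZ cabs_step cabs_wX mul1r.
have := mulr_ge0 L_ge0 (nrm_ge0 z); have := dstep_le2; nra.
Qed.

(** Each step inwards shrinks the radius by at least [1 + e / 2] and costs at most [10 * L * e ^+ 2]
    times the new radius, as [2^-1 ^+ k <= e]. The constant 20 makes the costs sum up exactly. *)
Lemma edge_sum_decay k J z : 2^-1 ^+ k <= e ->
  cabs (edge_sum k z - N%:R * g 0) <=
  N%:R * ((3 * L * (cabs (1 + kappa))^-1 ^+ J + 20 * L * e) * nrm z).
Proof.
move=> ke; set rho := cabs (1 + kappa); have r1 : 1 + e / 2 <= rho by apply: radial_ratio_ge.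
have r0 : 0 < rho by have := e_gt0; lra.
elim: J z => [|J IH] z.
  apply: le_trans (edge_sum_near0 k z) _; rewrite ler_wpM2l // ler_wpM2r ?nrm_ge0 //.
  by rewrite expr0; have := mulr_ge0 L_ge0 (ltW e_gt0); lra.
have k0 : 1 + kappa != 0 by rewrite -cabs_eq0 gt_eqF.
pose z' := (1 + kappa)^-1 *: z.
have zE : z = (1 + kappa) *: z' by rewrite scalerA mulfV // scale1r.
have nz : nrm z' = rho^-1 * nrm z by rewrite nrmZ cabsV.
have := cabsD (edge_sum k z - edge_sum k z') (edge_sum k z' - N%:R * g 0).
rewrite addrA subrK; have := IH z'; have := edge_sum_step k z'.
rewrite -zE nz; set q := rho^-1; have q0 : 0 < q by rewrite invr_gt0.
have qr : q * (1 + e / 2) <= 1 by rewrite mulrC ler_pdivrMr // mul1r.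
move=> h1 h2 /le_trans; apply; apply: le_trans (lerD h1 h2) _.
rewrite -mulrDr ler_wpM2l //.
have Lq : 0 <= L * e * nrm z * q.
  by rewrite !mulr_ge0 ?(ltW q0) ?(ltW e_gt0) ?nrm_ge0.
have Lz : 0 <= L * e * nrm z by rewrite !mulr_ge0 ?(ltW e_gt0) ?nrm_ge0.
rewrite (exprS q J).
have t1 : 8 * L * e * (q * nrm z) * 2^-1 ^+ k <= 8 * L * e * (q * nrm z) * e.
  by apply: ler_wpM2l => //; lra.
have t2 : 20 * (L * e * nrm z) * (q * (1 + e / 2)) <= 20 * (L * e * nrm z) * 1.
  by apply: ler_wpM2l => //; lra.
move: (q ^+ J) t1 t2 => qJ t1 t2; lra.
Qed.

Lemma mean_value z :
  cabs (\sum_(l < N) g (w ^+ l *: z) - N%:R * g 0) <= N%:R * (21 * L * e * nrm z).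
Proof.
have [k /(_ k (leqnn k)) /ltW ke] := half_expr_small hC e_gt0.
(* Letting [J] grow removes the crude term of [edge_sum_near0]. Passing from edge averages to vertex
   values costs one more [L * e * nrm z], whence 21. *)
have limit : cabs (edge_sum k z - N%:R * g 0) <= N%:R * (20 * L * e * nrm z).
  apply/ler_addgt0Pr => t t0.
  have r1 := radial_ratio_ge; set rho := cabs (1 + kappa) in r1.
  have c0 : 0 < N%:R * (3 * L * nrm z) + 1.
    by rewrite ltr_wpDl // mulr_ge0 // mulr_ge0 ?nrm_ge0 // mulr_ge0.
  have rr : rho^-1 < 1 by rewrite invf_lt1; have := e_gt0; lra.
  have r0 : 0 <= rho^-1 by rewrite invr_ge0; have := e_gt0; lra.
  have [J /(_ J (leqnn J)) hJ] := expr_small hC r0 rr (divr_gt0 t0 c0).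
  rewrite ltr_pdivlMr // in hJ.
  apply: le_trans (edge_sum_decay J z ke) _; rewrite -/rho.
  have := exprn_ge0 J r0; move: (rho^-1 ^+ J) hJ => qJ hJ q0; lra.
have near : cabs (\sum_(l < N) g (w ^+ l *: z) - edge_sum k z) <= N%:R * (L * e * nrm z).
  rewrite /edge_sum -sumrB; apply: le_trans (cabs_sum _ _ _) _.
  rewrite mulr_natl -[X in _ *+ X]card_ord -sumr_const; apply: ler_sum => l _.
  rewrite cabsB; apply: le_trans (av_near L_ge0 k _ _ gL) _.
  by rewrite nrmZ cabs_step mulrA.
have := cabsD (\sum_(l < N) g (w ^+ l *: z) - edge_sum k z) (edge_sum k z - N%:R * g 0).
rewrite addrA subrK; lra.
Qed.

End MeanValue.

(** * The maximum principle and additivity *)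

Section MaximumPrinciple.
Variables (C : numClosedFieldType) (n : nat).
Hypotheses (hC : real_complete C) (n_gt0 : (0 < n)%N).
Notation R := (reals C).
Notation V := 'M[C]_n.
Variable L : R.
Hypothesis L_ge0 : 0 <= L.

Section SecondDifference.
Variables (c : C) (i j : 'I_n) (v : V).

Definition second_diff (F : V -> V) x : V := F (x + v + v) - F (x + v) - (F (x + v) - F x).
Let g F x : R := entry_re c i j (second_diff F x).

Lemma second_diff_zoom F x : second_diff (zoom x 1 F) 0 = second_diff F x.
Proof.
rewrite /second_diff /zoom invr1 !scale1r !add0r addr0 !addrA.
by apply/matrixP => k l; rewrite !mxE; ring.
Qed.

Lemma second_diff_lip F x y : lipschitz_nrm L F ->
  g F x - g F y <= cabs c * (4 * (L * nrm (x - y))).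
Proof.
move=> FL; rewrite /g -entry_reB; apply: le_trans (entry_re_le _ _ _ _) _.
rewrite ler_wpM2l ?cabs_ge0 //.
have e b : nrm (F (x + b) - F (y + b)) <= L * nrm (x - y).
  by have := FL (x + b) (y + b); rewrite opprD addrACA subrr addr0.
have h0 := e 0; have h1 := e v; have h2 := e (v + v); rewrite !addr0 !addrA in h0 h1 h2.
have -> : second_diff F x - second_diff F y = (F (x + v + v) - F (y + v + v)) +
   (- (F (x + v) - F (y + v))) + (- (F (x + v) - F (y + v)) + (F x - F y)).
  by rewrite /second_diff; apply/matrixP => k l; rewrite !mxE; ring.
have t1 := nrmD (F (x + v + v) - F (y + v + v) + - (F (x + v) - F (y + v)))
  (- (F (x + v) - F (y + v)) + (F x - F y)).
have t2 := nrmD (F (x + v + v) - F (y + v + v)) (- (F (x + v) - F (y + v))).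
have t3 := nrmD (- (F (x + v) - F (y + v))) (F x - F y).
rewrite nrmN in t2 t3; lra.
Qed.

(** Mean values on circles around 0, [v] and [2 v], the middle one counted twice: 84 is 4 times
    21. *)
Lemma second_diff_mean F m z : spec_class L F ->
  (2 ^ m.+2)%:R * g F 0 - \sum_(l < (2 ^ m.+2)%N) g F (droot C m ^+ l *: z) <=
  (2 ^ m.+2)%:R * (cabs c * (84 * L * dstep C m * nrm z)).
Proof.
move=> FS; set N := (2 ^ m.+2)%N; set w := droot C m.
have mv b : cabs (\sum_(l < N) (F (b + w ^+ l *: z) i j - F b i j)) <=
    N%:R * (21 * L * dstep C m * nrm z).
  have := mean_value hC n_gt0 i j L_ge0 (spec_class_zoom b (oner_neq0 _) FS) m z.
  rewrite entry_fun_zoom [zoomC _ _ _ 0]/zoomC scaler0 addr0 subrr mulr0 mulr0 subr0.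
  rewrite -/N -/w; set S1 := \sum_(l < N) _; set S2 := \sum_(l < N) _.
  suff -> : S2 = S1 by [].
  by apply: eq_bigr => l _; rewrite /zoomC invr1 mul1r scale1r.
have gE x : g F 0 - g F x = cre (- c * ((F (v + v + x) i j - F (v + v) i j) -
    (F (v + x) i j - F v i j) - ((F (v + x) i j - F v i j) - (F (0 + x) i j - F 0 i j)))).
  rewrite /g -entry_reB /entry_re /second_diff; congr cre.
  rewrite !mxE !add0r (addrC v x) [v + v + x]addrC addrA; ring.
have -> : N%:R * g F 0 - \sum_(l < N) g F (w ^+ l *: z) = \sum_(l < N) (g F 0 - g F (w ^+ l *: z)).
  by rewrite sumrB sumr_const card_ord mulr_natl.
have cre_sum (G : 'I_N -> C) : \sum_(l < N) cre (G l) = cre (\sum_(l < N) G l).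
  by elim/big_rec2: _ => [|l y1 y2 _ ->]; rewrite ?cre0 // creD.
rewrite (eq_bigr _ (fun l _ => gE _)) cre_sum -mulr_sumr !sumrB.
rewrite -!sumrB; apply: le_trans (cre_le _) _; rewrite cabsM cabsN mulrCA ler_wpM2l ?cabs_ge0 //.
rewrite [X in cabs X](_ : _ = \sum_(l < N) (F (v + v + w ^+ l *: z) i j - F (v + v) i j) -
  \sum_(l < N) (F (v + w ^+ l *: z) i j - F v i j) - (\sum_(l < N) (F (v + w ^+ l *: z) i j - F v i j) -
  \sum_(l < N) (F (0 + w ^+ l *: z) i j - F 0 i j))); last by rewrite -!sumrB.
set S2 := \sum_(l < N) (F (v + v + _) i j - _); set S1 := \sum_(l < N) (F (v + _) i j - _).
set S0 := \sum_(l < N) (F (0 + _) i j - _).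
have h2 : cabs S2 <= _ := mv (v + v); have h1 : cabs S1 <= _ := mv v; have h0 : cabs S0 <= _ := mv 0.
have := cabsD (S2 - S1) (- (S1 - S0)); have := cabsD S2 (- S1); have := cabsD S1 (- S0).
rewrite !cabsN; lra.
Qed.

(** If the value at [z] were below [M], it would be so near [z] too, hence on an arc whose share of
    the circle does not depend on [k]. The mean would stay below [M], against the mean value
    property as [k] grows. *)
Lemma second_diff_max_const F M : spec_class L F -> (forall x, g F x <= M) -> M <= g F 0 ->
  forall z, M <= g F z.
Proof.
move=> FS gM M0 z; rewrite leNgt; apply/negP => gz.
set eta := M - g F z; have eta0 : 0 < eta by rewrite subr_gt0.
have FL : lipschitz_nrm L F by case: FS.
pose K : R := cabs c * (L * nrm z) + 1.
have K0 : 0 < K by rewrite ltr_wpDl // !mulr_ge0 ?cabs_ge0 ?nrm_ge0.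
have q0 : (0 : R) <= 3 / 4 by lra.
have q1 : (3 / 4 : R) < 1 by lra.
(* 64 is 2 * 4 * 8: half of [eta], the Lipschitz constant of the second difference, and the arc
   bound. *)
have [m0 /(_ m0 (leqnn _)) hm0] := expr_small hC q0 q1 (divr_gt0 eta0 (mulr_gt0 (ltr0Sn R 63) K0)).
rewrite ltr_pdivlMr ?mulr_gt0 // in hm0.
have P0 : (0 : R) < 2 ^+ m0 by rewrite exprn_gt0.
(* 1344 is 4 * 84 * 2 * 2: the arc is one part in [4 * 2 ^+ m0] of the circle, 84 is the mean value
   constant, and the two factors 2 come from [dstep_le] and from half of [eta]. *)
have [k /(_ (m0 + k)%N (leq_addl _ _)) hk] := expr_small hC q0 q1
  (divr_gt0 eta0 (mulr_gt0 (mulr_gt0 (ltr0Sn R 1343) P0) K0)).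
rewrite ltr_pdivlMr ?mulr_gt0 // in hk.
have := second_diff_mean (m0 + k) z FS.
set m := (m0 + k)%N; set N := (2 ^ m.+2)%N; set w := droot C m.
have NE : N%:R = 4 * 2 ^+ m0 * 2 ^+ k :> R by rewrite /N natrX /m !exprS exprD; ring.
have sum_le : \sum_(l < N) g F (w ^+ l *: z) <= N%:R * M - 2 ^+ k * (eta / 2).
  have kN : (2 ^ k <= N)%N by rewrite leq_exp2l // (leq_trans (leq_addl m0 k)) // -addn2 leq_addr.
  have -> : N%:R * M - 2 ^+ k * (eta / 2) = \sum_(l < N) (M - if (l < 2 ^ k)%N then eta / 2 else 0).
    rewrite sumrB sumr_const card_ord mulr_natl -big_mkcond /=.
    by rewrite -(big_ord_widen N (fun=> eta / 2) kN) sumr_const card_ord -natrX mulr_natl.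
  apply: ler_sum => l _; case: ifP => lk; last by rewrite subr0.
  have near := droot_pow_near C m0 lk.
  have := second_diff_lip (w ^+ l *: z) z FL.
  have -> : w ^+ l *: z - z = (w ^+ l - 1) *: z by rewrite scalerBl scale1r.
  rewrite nrmZ => h.
  have : cabs c * (4 * (L * (cabs (w ^+ l - 1) * nrm z))) <= eta / 2; last by rewrite /eta; lra.
  have cL : 0 <= cabs c * (L * nrm z) by rewrite !mulr_ge0 ?cabs_ge0 ?nrm_ge0.
  have := ler_wpM2r cL near; rewrite -/m -/w => h'.
  have p0 := exprn_ge0 m0 q0.
  apply: (@le_trans _ _ (4 * (8 * (3 / 4) ^+ m0 * (cabs c * (L * nrm z))))); first by lra.
  by rewrite /K in hm0; lra.
have d := dstep_le C m; have d0 := dstep_gt0 C m; rewrite NE in sum_le *.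
move=> h.
have Q0 : (0 : R) < 2 ^+ k by rewrite exprn_gt0.
have cL : 0 <= cabs c * (L * nrm z) by rewrite !mulr_ge0 ?cabs_ge0 ?nrm_ge0.
have : 2 ^+ k * (eta / 2) <= 2 ^+ k * (2 ^+ m0 * (336 * dstep C m * (cabs c * (L * nrm z)))).
  have := ler_wpM2l (ltW (mulr_gt0 (mulr_gt0 (ltr0Sn R 3) P0) Q0)) M0; lra.
rewrite ler_pM2l // => h'.
have : dstep C m * (cabs c * (L * nrm z)) <= 2 * (3 / 4) ^+ m * K.
  apply: ler_pM => //; [exact: ltW | rewrite /K; lra].
move/(ler_wpM2l (ltW P0)) => h''; rewrite -/m in hk; lra.
Qed.

(** Translates stay in the class, so a maximiser at 0 bounds its second difference everywhere and
    keeps it equal to [M]. First differences along [v] then grow by [M] per step, yet they are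
    bounded. *)
Lemma second_diff_nonpos F : spec_class L F -> g F 0 <= 0.
Proof.
move=> FS.
pose D F k : R := entry_re c i j (F (k%:R *: v + v) - F (k%:R *: v)).
have D_bound F1 k : lipschitz_nrm L F1 -> `|D F1 k| <= cabs c * (L * nrm v).
  move=> FL; rewrite ler_norml lerNl -entry_reN opprB.
  have h := FL (k%:R *: v + v) (k%:R *: v); rewrite addrAC subrr add0r in h.
  by apply/andP; split; apply: le_trans (entry_re_le _ _ _ _) _;
    rewrite ler_wpM2l ?cabs_ge0 // nrmB.
have gD F1 k : g F1 (k%:R *: v) = D F1 k.+1 - D F1 k.
  rewrite /D -entry_reB /g /second_diff -[in RHS]natr1 scalerDl scale1r.
  by [].
have [|||F' [FS' Fmax]] := @spec_class_max _ _ hC L (fun F => g F 0) (2 * (cabs c * (L * nrm v))).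
- move=> F1 [_ FL _]; have := gD F1 0%N; rewrite scale0r => ->.
  by have := D_bound F1 0%N FL; have := D_bound F1 1%N FL; rewrite !ler_norml; lra.
- move=> Fk FkS; have F0 k : Fk k 0 = 0 by case: (FkS k).
  have FL k : lipschitz_nrm L (Fk k) by case: (FkS k).
  by apply: cvgM_entry_re; apply: cvgM_B; apply: cvgM_B; apply: (flimP hC F0 FL).
- by exists F.
apply: le_trans (Fmax _ FS) _; set M := g F' 0.
have gM x : g F' x <= M.
  by rewrite /g -second_diff_zoom; apply: Fmax; apply: spec_class_zoom => //; apply: oner_neq0.
have ge z : M <= g F' z by apply: second_diff_max_const gM _ z.
have tel k : k%:R * M <= D F' k - D F' 0.
  elim: k => [|k IH]; first by rewrite mul0r subrr.
  by have := ge (k%:R *: v); rewrite gD -natr1; lra.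
have FL' : lipschitz_nrm L F' by case: FS'.
rewrite leNgt; apply/negP => M0.
have [k hk] := reals_archi hC (2 * (cabs c * (L * nrm v)) / M).
rewrite ltr_pdivrMr // in hk.
have := tel k; have := D_bound F' k FL'; have := D_bound F' 0%N FL'; rewrite !ler_norml; lra.
Qed.

End SecondDifference.

Lemma spec_class_second_diff F v x : spec_class L F -> second_diff v F x = 0.
Proof.
move=> FS; rewrite -second_diff_zoom; apply/matrixP => i j; rewrite [RHS]mxE.
set G := zoom x 1 F; have GS : spec_class L G by apply: spec_class_zoom => //; apply: oner_neq0.
have := second_diff_nonpos (second_diff v G 0 i j)^* i j v GS.
rewrite /entry_re mulrC cabs_re_conj => h.
by apply/eqP; rewrite -cabs_eq0 -sqrf_eq0 eq_le h sqr_ge0.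
Qed.

Lemma spec_class_additive F : spec_class L F -> forall x y : V, F (x + y) = F x + F y.
Proof.
move=> FS x y; have F0 : F 0 = 0 by case: FS.
(* The second difference from [a] with step half of [b - a] involves [a], the midpoint and [b]. *)
have mid a b : F a + F b = 2 *: F (2^-1 *: (a + b)).
  have := spec_class_second_diff (2^-1 *: (b - a)) a FS; rewrite /second_diff.
  have -> : a + 2^-1 *: (b - a) = 2^-1 *: (a + b).
    by apply/matrixP => i j; rewrite !mxE; field.
  have -> : 2^-1 *: (a + b) + 2^-1 *: (b - a) = b.
    by apply/matrixP => i j; rewrite !mxE; field.
  set m := F (2^-1 *: _) => e.
  have -> : F a + F b = F b - m - (m - F a) + 2 *: m.
    by apply/matrixP => i j; rewrite !mxE; ring.
  by rewrite e add0r.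
by rewrite mid -(addr0 (F (x + y))) -F0 mid addr0.
Qed.

End MaximumPrinciple.

(** * The operator norm *)

Section OperatorNorm.
Variables (C : numClosedFieldType) (n : nat).
Notation R := (reals C).
Implicit Types (A : 'M[C]_n).

Lemma opbound_nrm A : opbound A (rval (nrm A)).
Proof.
split; first exact: (nrm_ge0 A).
move=> v; have S0 : 0 <= vnorm2 v by apply: sumr_ge0 => k _; rewrite exprn_ge0.
set t := sqrtC (vnorm2 v); have t0 : 0 <= t by rewrite sqrtC_ge0.
have -> : vnorm2 v = t ^+ 2 by rewrite sqrtCK.
have vt k : `|v k 0| <= t.
  rewrite -(@ler_pXn2r _ 2) ?nnegrE // sqrtCK /vnorm2 (bigD1 k) //= lerDl.
  by apply: sumr_ge0 => l _; rewrite exprn_ge0.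
pose r i := \sum_j `|A i j|; have r0 i : 0 <= r i by apply: sumr_ge0.
have rE : rval (nrm A) = \sum_i r i.
  by rewrite /nrm (rmorph_sum (@rval C)); apply: eq_bigr => i _; rewrite (rmorph_sum (@rval C)).
have row i : `|(A *m v) i 0| <= r i * t.
  rewrite mxE mulr_suml; apply: le_trans (ler_norm_sum _ _ _) _.
  by apply: ler_sum => k _; rewrite normrM ler_wpM2l.
rewrite rE; set S := \sum_i r i.
apply: (@le_trans _ _ (\sum_i r i ^+ 2 * t ^+ 2)).
  by apply: ler_sum => i _; rewrite -exprMn ler_pXn2r ?nnegrE ?mulr_ge0.
rewrite -mulr_suml ler_wpM2r ?exprn_ge0 // [X in _ <= X]expr2 [X in _ <= X]mulr_suml.
apply: ler_sum => i _; rewrite expr2 ler_wpM2l //.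
by rewrite /S (bigD1 i) //= lerDl sumr_ge0.
Qed.

Lemma opbound_entry A (c : C) i j : opbound A c -> `|A i j| <= c.
Proof.
move=> [c0 Ac]; have := Ac (delta_mx j 0).
have -> : vnorm2 (delta_mx j 0 : 'cV[C]_n) = 1.
  rewrite /vnorm2 (bigD1 j) //= big1 ?addr0 => [|k kj]; rewrite mxE ?eqxx ?normr1 ?expr1n //.
  by rewrite (negPf kj) normr0 expr0n.
rewrite mulr1 -colE => h; rewrite -(@ler_pXn2r _ 2) ?nnegrE //.
apply: le_trans h; rewrite /vnorm2 (bigD1 i) //= mxE lerDl.
by apply: sumr_ge0 => k _; rewrite exprn_ge0.
Qed.

(** The operator norm dominates each entry and is dominated by the sum of the moduli, so the
    Lipschitz condition transfers with a factor [n * n]. *)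
Lemma lipschitz_op_nrm (F : 'M[C]_n -> 'M[C]_n) : lipschitz_op F ->
  exists2 L : R, 0 <= L & lipschitz_nrm L F.
Proof.
move=> [L [L0 FL]]; pose L' : R := Reals (ger0_real L0).
exists (L' * (n * n)%:R); first by rewrite mulr_ge0.
move=> x y; have B := FL x y _ (opbound_nrm (x - y)).
apply: (@le_trans _ _ (\sum_(i < n) \sum_(j < n) L' * nrm (x - y))).
  by apply: ler_sum => i _; apply: ler_sum => j _; apply: (opbound_entry i j B).
by rewrite !sumr_const card_ord -mulrnA -[_ *+ _]mulr_natl; lra.
Qed.

End OperatorNorm.

Theorem theorem4 (C : numClosedFieldType) (hC : real_complete C)
  (n : nat) (hn : (0 < n)%N) (F : 'M[C]_n -> 'M[C]_n)
  (hLip : lipschitz_op F) (hF0 : F 0 = 0)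
  (hspec : forall x y : 'M[C]_n, spec_meet (F x - F y) (x - y)) :
  exists u : 'M[C]_n, u \in unitmx /\
    ((forall x, F x = u *m x *m invmx u) \/
     (forall x, F x = u *m x^T *m invmx u)).
Proof.
have [L L_ge0 FL] := lipschitz_op_nrm hLip.
have FS : spec_class L F by [].
apply: additive_spec_classification hn (spec_class_additive hC hn L_ge0 FS) _ => x.
by have := hspec x 0; rewrite hF0 !subr0.
Qed.
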